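(* Let $\Lambda$ be a countable discrete group acting on a nonempty countable set $I$ without invariant mean. Let $\xi$ be any nonzero finite Borel measure on $\mathbf R^+_0$ with finite first moment, normalized so that $\int_{\mathbf R^+_0}(1+x)\,d\xi(x)=1$. Let $\tau(\xi)$ be the weakest topology on $\mathbf R$ that makes the unitary representation $\rho_\xi:\mathbf R\to\mathcal U(L^2(\mathbf R^+_0,\xi))$, $(\rho_\xi(t)f)(x)=x^{it}f(x)$, continuous. Let $Y=\mathbf R^+_0\times\{0,1\}$ and let $\eta$ be the unique probability measure on $Y$ satisfying $$\int_Yf(x,i)\,d\eta(x,i)=\int_{\mathbf R^+_0}f(x,0)\,d\xi(x)+\int_{\mathbf R^+_0}xf(x,1)\,d\xi(x)$$ for every nonnegative Borel function $f$ on $Y$. Let $\mathcal S$ be the equivalence relation on $(Y,\eta)$ defined by $((x_1,i_1),(x_2,i_2))\in\mathcal S\Leftrightarrow x_1=x_2$. Then the generalized Bernoulli equivalence relation $\mathcal R=\mathcal S^{\otimes I}\rtimes\Lambda$ on $(X,\mu)=(Y,\eta)^I$ is strongly ergodic and $\tau(\mathcal R)=\tau(\xi)$.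
   Context: $\mathbf R^+_0=(0,\infty)$; the unitary group $\mathcal U(H)$ of a Hilbert space $H$ carries the strong operator topology. An invariant mean for $\Lambda\curvearrowright I$ is a $\Lambda$-invariant finitely additive probability measure on the subsets of $I$. Generalized Bernoulli relations. On the product probability space $(X,\mu)=(Y,\eta)^I$, $\mathcal S^{\otimes I}$ is the equivalence relation in which $(x_i)_{i\in I}\sim(y_i)_{i\in I}$ iff there is a finite $\mathcal F\subset I$ with $(x_i,y_i)\in\mathcal S$ for $i\in\mathcal F$ and $x_i=y_i$ for $i\in I\setminus\mathcal F$. $\Lambda$ acts on $X$ by $\lambda\cdot(x_i)_{i}=(x_{\lambda^{-1}i})_{i}$. $\mathcal R=\mathcal S^{\otimes I}\rtimes\Lambda$ is the equivalence relation generated by $\mathcal S^{\otimes I}$ and the orbit equivalence relation $\mathcal R(\Lambda\curvearrowright X)$. Everything is up to null sets; a subset of $\mathcal R$ is null iff one of its coordinate projections to $X$ is null. The full group $[\mathcal R]$ is the group of nonsingular automorphisms $\theta$ of $X$ with $(x,\theta(x))\in\mathcal R$ a.e. $\mathcal R$ is strongly ergodic if every sequence of measurable $A_n\subset X$ with $\mu(A_n\triangle\theta(A_n))\to0$ for all $\theta\in[\mathcal R]$ satisfies $\mu(A_n)(1-\mu(A_n))\to0$. $Z^1(\mathcal R,\mathbf T)$ is the group of measurable $c:\mathcal R\to\mathbf T$ with $c(x,y)c(y,z)=c(x,z)$ a.e., with the topology of convergence in measure; $B^1(\mathcal R,\mathbf T)$ is the subgroup of functions $f(x)f(y)^{-1}$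 with $f:X\to\mathbf T$ measurable; $H^1(\mathcal R,\mathbf T)=Z^1/B^1$ with the quotient topology. Let $\mu_\ell(W)=\int_X\sharp\{y:(x,y)\in W\}\,d\mu(x)$, $\mu_r(W)=\int_X\sharp\{x:(x,y)\in W\}\,d\mu(y)$ for measurable $W\subset\mathcal R$, and $\delta_\mu=\frac{d\mu_\ell}{d\mu_r}:\mathcal R\to\mathbf R^+_0$. For strongly ergodic $\mathcal R$, $\tau(\mathcal R)$ is the weakest topology on $\mathbf R$ making $\mathbf R\to H^1(\mathcal R,\mathbf T)$, $t\mapsto[\delta_\mu^{it}]$, continuous. *)

(* Defs.v *)
From HB Require Import structures.
From mathcomp Require Import all_boot all_order all_algebra.
From mathcomp Require Import all_classical all_reals all_analysis.
From mathcomp Require Import measurable_realfun complex ring lra.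
Import Order.TTheory GRing.Theory Num.Theory.
Import numFieldNormedType.Exports.
Set Implicit Arguments.
Unset Strict Implicit.
Unset Printing Implicit Defensive.

Local Open Scope classical_set_scope.
Local Open Scope ring_scope.
Local Open Scope complex_scope.
Local Open Scope quotient_scope.

Record posR (R : realType) := PosR { posR_val :> R ; posR_gt0 : 0 < posR_val }.
HB.instance Definition _ (R : realType) := [isSub for @posR_val R].
HB.instance Definition _ (R : realType) := [Choice of posR R by <:].
HB.instance Definition _ (R : realType) := isPointed.Build (posR R) (PosR ltr01).
HB.instance Definition _ (R : realType) :=
  Measurable.copy (posR R) (g_sigma_algebra_preimageType (@posR_val R)).

Section ComplexMeasurable.
Context d (T : measurableType d) (R : realType).
Implicit Types (D : set T) (f g : T -> R[i]).

Definition cmeasurable_fun D f :=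
  measurable_fun D (fun x => complex.Re (f x)) /\
  measurable_fun D (fun x => complex.Im (f x)).

Lemma cmeasurable_cst D (z : R[i]) : cmeasurable_fun D (fun=> z).
Proof. by split; exact: measurable_cst. Qed.

Lemma cmeasurable_funD D f g :
  cmeasurable_fun D f -> cmeasurable_fun D g -> cmeasurable_fun D (f \+ g).
Proof.
move=> [f1 f2] [g1 g2]; split.
  rewrite [X in measurable_fun _ X](_ : _ =
    (fun x => complex.Re (f x)) \+ (fun x => complex.Re (g x))).
    exact: measurable_funD.
  by apply/funext => x /=; case: (f x) => ? ?; case: (g x) => ? ?.
rewrite [X in measurable_fun _ X](_ : _ =
    (fun x => complex.Im (f x)) \+ (fun x => complex.Im (g x))).
  exact: measurable_funD.
by apply/funext => x /=; case: (f x) => ? ?; case: (g x) => ? ?.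
Qed.

Lemma cmeasurable_funM D f g :
  cmeasurable_fun D f -> cmeasurable_fun D g -> cmeasurable_fun D (f \* g).
Proof.
move=> [f1 f2] [g1 g2]; split.
  rewrite [X in measurable_fun _ X](_ : _ =
    (fun x => complex.Re (f x) * complex.Re (g x)) \-
    (fun x => complex.Im (f x) * complex.Im (g x))).
    by apply: measurable_funB; exact: measurable_funM.
  by apply/funext => x /=; case: (f x) => ? ?; case: (g x) => ? ?.
rewrite [X in measurable_fun _ X](_ : _ =
    (fun x => complex.Re (f x) * complex.Im (g x)) \+
    (fun x => complex.Im (f x) * complex.Re (g x))).
  by apply: measurable_funD; exact: measurable_funM.
by apply/funext => x /=; case: (f x) => ? ?; case: (g x) => ? ?.
Qed.

Lemma cmeasurable_conjc D f :
  cmeasurable_fun D f -> cmeasurable_fun D (fun x => (f x)^*).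
Proof.
move=> [f1 f2]; split.
  rewrite [X in measurable_fun _ X](_ : _ = fun x => complex.Re (f x)) //.
  by apply/funext => x /=; case: (f x) => ? ?.
rewrite [X in measurable_fun _ X](_ : _ = \- (fun x => complex.Im (f x))).
  exact: measurable_funN.
by apply/funext => x /=; case: (f x) => ? ?.
Qed.

Lemma normc2E (z : R[i]) :
  Normc.normc z ^+ 2 = complex.Re z ^+ 2 + complex.Im z ^+ 2.
Proof. by case: z => a b /=; rewrite sqr_sqrtr// addr_ge0// sqr_ge0. Qed.

Lemma measurable_normc2 D f : cmeasurable_fun D f ->
  measurable_fun D (fun x => (Normc.normc (f x) ^+ 2)%:E).
Proof.
move=> [f1 f2]; apply/measurable_EFinP.
under eq_fun do rewrite normc2E.
by apply: measurable_funD; exact: measurable_funX.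
Qed.

End ComplexMeasurable.

Section L2.
Context d (T : measurableType d) (R : realType).
Variable mu : {measure set T -> \bar R}.
Implicit Types (f g m : T -> R[i]).

Definition square_integrable : {pred T -> R[i]} := [pred f | `[<
  cmeasurable_fun setT f /\
  (\int[mu]_x (Normc.normc (f x) ^+ 2)%:E < +oo)%E >]].

Lemma square_integrableP f : reflect
  (cmeasurable_fun setT f /\
   (\int[mu]_x (Normc.normc (f x) ^+ 2)%:E < +oo)%E)
  (f \in square_integrable).
Proof. exact: asboolP. Qed.

Definition bounded_cmeasurable m := cmeasurable_fun setT m /\
  exists K : R, forall x, Normc.normc (m x) <= K.

Lemma square_integrableM m f : bounded_cmeasurable m ->
  f \in square_integrable -> m \* f \in square_integrable.
Proof.
move=> [mm [K mK]] /square_integrableP[mf ioo].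
apply/square_integrableP; split; first exact: cmeasurable_funM.
apply: (@le_lt_trans _ _
  (\int[mu]_x ((K ^+ 2)%:E * (Normc.normc (f x) ^+ 2)%:E))%E).
  apply: ge0_le_integral => //.
  - by move=> x _; rewrite lee_fin sqr_ge0.
  - exact/measurable_normc2/cmeasurable_funM.
  - by apply: emeasurable_funM => //; exact: measurable_normc2.
  - move=> x _; rewrite -EFinM lee_fin /= Normc.normcM exprMn ler_wpM2r ?sqr_ge0//.
    have n0 : 0 <= Normc.normc (m x) by case: (m x) => ? ? /=; rewrite sqrtr_ge0.
    by rewrite lerXn2r ?nnegrE// (le_trans n0).
rewrite ge0_integralZl//.
- by rewrite lte_mul_pinfty// lee_fin sqr_ge0.
- exact: measurable_normc2.
- by move=> x _; rewrite lee_fin sqr_ge0.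
- by rewrite lee_fin sqr_ge0.
Qed.

Lemma bounded_cmeasurable_cst (a : R[i]) : bounded_cmeasurable (fun=> a).
Proof. by split; [exact: cmeasurable_cst|exists (Normc.normc a)]. Qed.

Lemma square_integrable_zmod_closed : zmod_closed square_integrable.
Proof.
have opp f : f \in square_integrable -> - f \in square_integrable.
  move=> /(square_integrableM (bounded_cmeasurable_cst (-1))).
  have -> // : (fun=> -1) \* f = - f.
  by apply/funext => x /=; rewrite mulN1r.
split.
  apply/(@square_integrableP (fun=> 0)); split; first exact: cmeasurable_cst.
  rewrite integral0_eq ?ltry// => x _.
  by rewrite Normc.normc0 expr0n.
move=> f g fL /opp; move: (- g) => {}g.
move: fL => /square_integrableP[mf foo] /square_integrableP[mg goo].
apply/square_integrableP; split; first exact: cmeasurable_funD.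
apply: (@le_lt_trans _ _
  (\int[mu]_x (2%:E * (Normc.normc (f x) ^+ 2)%:E +
               2%:E * (Normc.normc (g x) ^+ 2)%:E))%E).
  apply: ge0_le_integral => //.
  - by move=> x _; rewrite lee_fin sqr_ge0.
  - exact/measurable_normc2/cmeasurable_funD.
  - by apply: emeasurable_funD; apply: emeasurable_funM => //;
      exact: measurable_normc2.
  - move=> x _; rewrite -!EFinM -EFinD lee_fin !normc2E fctE.
    case: (f x) (g x) => a b [a' b'] /=.
    rewrite -!/(GRing.add _ _) -subr_ge0.
    rewrite (_ : _ - _ = (a - a') ^+ 2 + (b - b') ^+ 2); last first.
      by ring.
    by rewrite addr_ge0 ?sqr_ge0.
rewrite ge0_integralD//.
- rewrite !ge0_integralZl//.
  + by rewrite lte_add_pinfty// lte_mul_pinfty// ?lee_fin//.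
  + exact: measurable_normc2.
  + by move=> x _; rewrite lee_fin sqr_ge0.
  + exact: measurable_normc2.
  + by move=> x _; rewrite lee_fin sqr_ge0.
- by move=> x _; rewrite lee_fin mulr_ge0 ?sqr_ge0.
- by apply: emeasurable_funM => //; exact: measurable_normc2.
- by move=> x _; rewrite lee_fin mulr_ge0 ?sqr_ge0.
- by apply: emeasurable_funM => //; exact: measurable_normc2.
Qed.

HB.instance Definition _ := GRing.isZmodClosed.Build _ square_integrable
  square_integrable_zmod_closed.

Record L2fun := MkL2fun {
  L2fun_val :> T -> R[i] ; L2funP : L2fun_val \in square_integrable }.

HB.instance Definition _ := [isSub for L2fun_val].
HB.instance Definition _ := [Choice of L2fun by <:].
HB.instance Definition _ := [SubChoice_isSubZmodule of L2fun by <:].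

Definition L2null : {pred L2fun} :=
  [pred f : L2fun | `[< {ae mu, forall x, f x = 0} >]].

Lemma L2null_zmod_closed : zmod_closed L2null.
Proof.
split; first by apply/asboolP; exact: aeW.
move=> f g /asboolP f0 /asboolP g0; apply/asboolP.
by apply: filterS2 f0 g0 => x /= ; rewrite !fctE => -> ->; rewrite subrr.
Qed.

HB.instance Definition _ := GRing.isZmodClosed.Build _ L2null L2null_zmod_closed.

Definition L2 : Type := Quotient.quot L2null.
HB.instance Definition _ := GRing.Zmodule.on L2.
HB.instance Definition _ := EqQuotient.on L2.


Lemma pi_L2P (f g : L2fun) :
  \pi_L2 f = \pi_L2 g <-> {ae mu, forall x, f x = g x}.
Proof.
split=> [/eqP|fg].
  rewrite -Quotient.idealrBE => /asboolP; apply: filterS => x /= /eqP.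
  by rewrite !fctE subr_eq0 => /eqP.
apply/eqP; rewrite -Quotient.idealrBE; apply/asboolP.
by apply: filterS fg => x /= ; rewrite !fctE => ->; rewrite subrr.
Qed.

Lemma reprL2K (f : L2fun) : {ae mu, forall x, repr (\pi_L2 f) x = f x}.
Proof. by apply/pi_L2P; rewrite reprK. Qed.

Lemma L2_eqP (u v : L2) : u = v <-> {ae mu, forall x, repr u x = repr v x}.
Proof. by rewrite -{1}(reprK u) -{1}(reprK v); exact: pi_L2P. Qed.

Lemma reprL2D (u v : L2) :
  {ae mu, forall x, repr (u + v) x = repr u x + repr v x}.
Proof.
have -> : u + v = \pi_L2 (repr u + repr v).
  by rewrite (@Quotient.pi_add _ L2null) !reprK.
exact: reprL2K.
Qed.

Definition mulL2fun m (mb : bounded_cmeasurable m) (f : L2fun) : L2fun :=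
  MkL2fun (square_integrableM mb (L2funP f)).

Definition mulL2 m (mb : bounded_cmeasurable m) (u : L2) : L2 :=
  \pi_L2 (mulL2fun mb (repr u)).

Lemma reprL2M m (mb : bounded_cmeasurable m) u :
  {ae mu, forall x, repr (mulL2 mb u) x = m x * repr u x}.
Proof. exact: reprL2K. Qed.

Definition scaleL2 (a : R[i]) : L2 -> L2 := mulL2 (bounded_cmeasurable_cst a).

Fact scaleL2A a b u : scaleL2 a (scaleL2 b u) = scaleL2 (a * b) u.
Proof.
apply/L2_eqP.
have ha := reprL2M (bounded_cmeasurable_cst a) (scaleL2 b u).
have hb := reprL2M (bounded_cmeasurable_cst b) u.
have hab := reprL2M (bounded_cmeasurable_cst (a * b)) u.
by apply: filterS3 ha hb hab => x /= -> -> ->; rewrite mulrA.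
Qed.

Fact scale1L2 u : scaleL2 1 u = u.
Proof.
apply/L2_eqP; have := reprL2M (bounded_cmeasurable_cst 1) u.
by apply: filterS => x /= ->; rewrite mul1r.
Qed.

Fact mulL2Dr m (mb : bounded_cmeasurable m) : {morph mulL2 mb : u v / u + v}.
Proof.
move=> u v; apply/L2_eqP.
have h1 := reprL2M mb (u + v); have h2 := reprL2D u v.
have h3 := reprL2D (mulL2 mb u) (mulL2 mb v).
have hu := reprL2M mb u; have hv := reprL2M mb v.
apply: filterS3 (filterI h1 h2) h3 (filterI hu hv).
by move=> x /= [-> ->] -> [-> ->]; rewrite mulrDr.
Qed.

Fact scaleL2Dl u : {morph scaleL2^~ u : a b / a + b}.
Proof.
move=> a b; apply/L2_eqP.
have h1 := reprL2M (bounded_cmeasurable_cst (a + b)) u.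
have h2 := reprL2D (scaleL2 a u) (scaleL2 b u).
have ha := reprL2M (bounded_cmeasurable_cst a) u.
have hb := reprL2M (bounded_cmeasurable_cst b) u.
by apply: filterS3 h1 h2 (filterI ha hb) => x /= -> -> [-> ->]; rewrite mulrDl.
Qed.

HB.instance Definition _ := GRing.Zmodule_isLmodule.Build R[i] L2
  scaleL2A scale1L2 (fun a => mulL2Dr (bounded_cmeasurable_cst a)) scaleL2Dl.

Definition ipL2 (u v : L2) : R[i] :=
  (\int[mu]_x complex.Re (repr u x * (repr v x)^* )) +i*
  (\int[mu]_x complex.Im (repr u x * (repr v x)^* )).

Definition normL2 (u : L2) : R := Num.sqrt (complex.Re (ipL2 u u)).

Definition is_unitary (U : L2 -> L2) :=
  [/\ linear U, bijective U & forall u v, ipL2 (U u) (U v) = ipL2 u v].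

Record unitary := MkUnitary {
  unitary_val :> L2 -> L2 ; unitaryP : is_unitary unitary_val }.

HB.instance Definition _ := gen_eqMixin unitary.
HB.instance Definition _ := gen_choiceMixin unitary.

(* The seminorm balls [strong_ball] are open in the strong operator topology and
   generate it. *)
Definition strong_ball (U : unitary) (u : L2) (e : R) : set unitary :=
  [set V : unitary | normL2 (V u - U u) < e].

HB.instance Definition _ := isSubBaseTopological.Build unitary
  [set A | exists U u e, 0 < e /\ A = strong_ball U u e] id.

Lemma measurable_reprL2 (u : L2) : cmeasurable_fun setT (repr u).
Proof. by have /square_integrableP[] := L2funP (repr u). Qed.

Lemma mulL2_unitary m (mb : bounded_cmeasurable m) :
  (forall x, m x * (m x)^* = 1) -> is_unitary (mulL2 mb).
Proof.
move=> m1.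
have mm x : (m x)^* * m x = 1 by rewrite mulrC.
have [mV [K mK]] := mb.
have mVb : bounded_cmeasurable (fun x => (m x)^* ).
  split; first exact: cmeasurable_conjc.
  by exists K => x; case: (m x) (mK x) => a b /=; rewrite sqrrN.
have cancelM (m1' m2' : T -> R[i]) (b1 : bounded_cmeasurable m1')
    (b2 : bounded_cmeasurable m2') :
    (forall x, m2' x * m1' x = 1) -> cancel (mulL2 b1) (mulL2 b2).
  move=> e u; apply/L2_eqP.
  have h1 := reprL2M b1 u; have h2 := reprL2M b2 (mulL2 b1 u).
  by apply: filterS2 h1 h2 => x /= e1 ->; rewrite e1 mulrA e mul1r.
have ae_ip (u v : L2) : {ae mu, forall x,
    repr (mulL2 mb u) x * (repr (mulL2 mb v) x)^* = repr u x * (repr v x)^*}.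
  have hu := reprL2M mb u; have hv := reprL2M mb v.
  apply: filterS2 hu hv => x -> ->.
  by rewrite rmorphM mulrACA m1 mul1r.
split.
- move=> a u v; rewrite mulL2Dr; congr (_ + _); apply/L2_eqP.
  have h1 := reprL2M mb (a *: u); have h2 := reprL2M (bounded_cmeasurable_cst a) u.
  have h3 := reprL2M (bounded_cmeasurable_cst a) (mulL2 mb u).
  have h4 := reprL2M mb u.
  apply: filterS2 (filterI h1 h2) (filterI h3 h4) => x /= [-> ->] [-> ->].
  by rewrite mulrCA.
- by exists (mulL2 mVb); exact: cancelM.
- have mip (u v : L2) : cmeasurable_fun setT (fun x => repr u x * (repr v x)^* ).
    exact: (cmeasurable_funM (measurable_reprL2 u)
      (cmeasurable_conjc (measurable_reprL2 v))).
  move=> u v; rewrite /ipL2; congr (_ +i* _); rewrite /Rintegral; congr fine.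
  + apply: ae_eq_integral => //.
    * by apply/measurable_EFinP; exact: (mip _ _).1.
    * by apply/measurable_EFinP; exact: (mip _ _).1.
    * by apply: filterS (ae_ip u v) => x /= ->.
  + apply: ae_eq_integral => //.
    * by apply/measurable_EFinP; exact: (mip _ _).2.
    * by apply/measurable_EFinP; exact: (mip _ _).2.
    * by apply: filterS (ae_ip u v) => x /= ->.
Qed.

End L2.

(* $x^{it} = e^{it\ln x}$ for $x > 0$. *)
Definition powRit (R : realType) (x t : R) : R[i] :=
  cos (t * ln x) +i* sin (t * ln x).

Section rho.
Context (R : realType) (xi : {measure set (posR R) -> \bar R}).

Lemma powRit_normE (x t : R) : powRit x t * (powRit x t)^* = 1.
Proof.
rewrite /powRit /=; set a := t * _.
apply/eqP; rewrite eq_complex /=; apply/andP; split; apply/eqP.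
  by rewrite mulrN opprK -!expr2 cos2Dsin2.
by rewrite mulrN addrC mulrC subrr.
Qed.

Lemma powRit_bounded t : bounded_cmeasurable (fun x : posR R => powRit x t).
Proof.
have mpos : measurable_fun setT (@posR_val R).
  by move=> _ B mB; exists B.
have ml : measurable_fun setT (fun x : posR R => t * ln x).
  apply: measurable_funM => //.
  exact: (measurableT_comp (@measurable_ln R)).
split.
  split => /=.
    exact: (measurableT_comp (continuous_measurable_fun (@continuous_cos R))).
  exact: (measurableT_comp (continuous_measurable_fun (@continuous_sin R))).
by exists 1 => x /=; rewrite cos2Dsin2 sqrtr1.
Qed.

Definition rho (t : R) : unitary xi :=
  MkUnitary (mulL2_unitary xi (powRit_bounded t)
    (fun x : posR R => powRit_normE x t)).

Definition tau_measure : set (set R) := @open (initial_topology rho).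

End rho.

Section Relation.
Context d (X : measurableType d) (R : realType).
Variables (mu : probability X R) (E : set (X * X)).

(* [P] holds a.e. on [E]: the exceptional subset of [E] has a null first
   projection.  For a nonsingular relation the two projections of a subset
   are null simultaneously. *)
Definition rel_ae (P : X -> X -> Prop) :=
  {ae mu, forall x, forall y, E (x, y) -> P x y}.

(* Every automorphism modulo null sets whose graph lies a.e. in [E] agrees a.e.
   with a bijection of [X] as below: on a standard probability space, extend it
   by the identity off an invariant conull set. *)
Definition full_group : set (X -> X) := [set theta : X -> X |
  [/\ bijective theta,
      measurable_fun setT theta,
      forall A, measurable A -> measurable (theta @` A),
      forall A, measurable A -> (mu (theta @^-1` A) = 0%E <-> mu A = 0%E) &
      {ae mu, forall x, E (x, theta x)}]].

Definition strongly_ergodic := forall A : nat -> set X,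
  (forall n, measurable (A n)) ->
  (forall theta, full_group theta ->
    mu (A n `+` theta @` A n) @[n --> \oo] --> 0%E) ->
  (mu (A n) * (1 - mu (A n)))%E @[n --> \oo] --> 0%E.

(* Set functions on [X * X]; they are measures on the measurable subsets of a
   countable measurable equivalence relation. *)
Definition mu_left (W : set (X * X)) : \bar R :=
  (\int[mu]_x counting (xsection W x))%E.

Definition mu_right (W : set (X * X)) : \bar R :=
  (\int[mu]_y counting (ysection W y))%E.

Definition is_RN_derivative (D : X * X -> R) :=
  [/\ measurable_fun E D,
      forall p, E p -> 0 < D p &
      forall W, measurable W -> W `<=` E ->
        mu_left W = (\int[mu_right]_(p in W) (D p)%:E)%E].

(* A version of $\delta_\mu$; it is unique up to null sets. *)
Definition delta_mu : X * X -> R := xget (fun=> 1) is_RN_derivative.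

(* The identity is required on $\{(x,y,z) : x \sim y \sim z\}$ outside of a set
   whose projection on the first coordinate is null.  Values off [E] are
   irrelevant, and are identified in [H1]. *)
Definition cocycle : {pred X * X -> R[i]} := [pred c | `[<
  [/\ cmeasurable_fun E c,
      forall p, E p -> Normc.normc (c p) = 1 &
      {ae mu, forall x, forall y z, E (x, y) -> E (y, z) ->
        c (x, y) * c (y, z) = c (x, z)}] >]].

Record Z1 := MkZ1 { Z1_val :> X * X -> R[i] ; Z1P : Z1_val \in cocycle }.

HB.instance Definition _ := [isSub for Z1_val].
HB.instance Definition _ := [Choice of Z1 by <:].

(* Convergence in measure for the (sigma-finite) measure $\mu_\ell$ on [E], i.e.
   in measure on every measurable [W] of finite measure.  With [e <=] rather
   than [e <] these sets are open, so that as a subbase they generate the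
   topology for which they are neighborhoods of [c]. *)
Definition measure_ball (c : Z1) (W : set (X * X)) (e r : R) : set Z1 :=
  [set c' : Z1 |
    (mu_left (W `&` [set p | (e <= Normc.normc (c' p - c p))%R]) < r%:E)%E].

HB.instance Definition _ := isSubBaseTopological.Build Z1
  [set A | exists c W e r,
    [/\ measurable W, W `<=` E, (mu_left W < +oo)%E, 0 < e & 0 < r] /\
    A = measure_ball c W e r] id.

Definition coboundary : set (X * X -> R[i]) := [set b | exists f : X -> R[i],
  [/\ cmeasurable_fun setT f,
      forall x, Normc.normc (f x) = 1 &
      rel_ae (fun x y => b (x, y) = f x / f y)]].

Definition cohomologous (c c' : Z1) : bool :=
  `[< coboundary (fun p => c p / c' p) >].

Let normc_neq0 (z : R[i]) : Normc.normc z = 1 -> z != 0.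
Proof.
move=> z1; apply/eqP => z0; move: z1 (oner_neq0 R).
by rewrite z0 Normc.normc0 => ->; rewrite eqxx.
Qed.

Let Z1_neq0 (c : Z1) p : E p -> c p != 0.
Proof.
by move=> Ep; have /asboolP[_ c1 _] := Z1P c; exact/normc_neq0/c1.
Qed.

Let normc_conj (z : R[i]) : Normc.normc z = 1 -> z^* = z^-1.
Proof.
move=> z1; apply: (mulfI (normc_neq0 z1)); rewrite divff ?normc_neq0//.
have := normc2E z; rewrite z1 expr1n; case: z {z1} => a b /= ab.
apply/eqP; rewrite eq_complex /= mulrN opprK -!expr2 -ab eqxx /=.
by rewrite mulrN mulrC addNr.
Qed.

Fact cohomologous_refl : reflexive cohomologous.
Proof.
move=> c; apply/asboolP; exists (fun=> 1); split => [|x|].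
- exact: cmeasurable_cst.
- exact: Normc.normc1.
- by apply: aeW => x y /(Z1_neq0 c) cxy; rewrite !divff// oner_neq0.
Qed.

Let cohomologous_symP c c' : cohomologous c c' -> cohomologous c' c.
Proof.
move=> /asboolP[f [mf f1 fc]]; apply/asboolP.
have fV x : (f x)^* = (f x)^-1 by exact: normc_conj.
exists (fun x => (f x)^* ); split => [|x|].
- exact: cmeasurable_conjc.
- by rewrite fV Normc.normcV f1 invr1.
- apply: filterS fc => x fc y Exy.
  by rewrite -[LHS]invrK invf_div fc// !fV invf_div invrK mulrC.
Qed.

Fact cohomologous_sym : symmetric cohomologous.
Proof. by move=> c c'; apply/idP/idP; exact: cohomologous_symP. Qed.

Fact cohomologous_trans : transitive cohomologous.
Proof.
move=> c2 c1 c3 /asboolP[f [mf f1 fc]] /asboolP[g [mg g1 gc]]; apply/asboolP.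
exists (f \* g); split => [|x|].
- exact: cmeasurable_funM.
- by rewrite /= Normc.normcM f1 g1 mulr1.
- apply: filterS2 fc gc => x fc gc y Exy /=.
  have := fc y Exy; have := gc y Exy; move=> eg ef.
  rewrite invfM mulrACA -ef -eg mulrA divfK//; exact: Z1_neq0.
Qed.

Canonical cohomologous_equiv := EquivRel cohomologous
  cohomologous_refl cohomologous_sym cohomologous_trans.

Definition H1 : Type := quotient_topology {eq_quot cohomologous}.
HB.instance Definition _ := Topological.on H1.
HB.instance Definition _ := Quotient.on H1.

Fact one_cocycle : (fun=> 1) \in cocycle.
Proof.
apply/asboolP; split => [|p _|]; first exact: cmeasurable_cst.
  exact: Normc.normc1.
by apply: aeW => x y z _ _; rewrite mulr1.
Qed.

(* The function $\delta_\mu^{it}$ is a cocycle when [E] is a countable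
   nonsingular measurable equivalence relation; the default is then unused. *)
Definition delta_cocycle (t : R) : Z1 :=
  insubd (MkZ1 one_cocycle) (fun p => powRit (delta_mu p) t).

Definition delta_class (t : R) : H1 := \pi_H1 (delta_cocycle t).

Definition tau_rel : set (set R) := @open (initial_topology delta_class).

End Relation.

Section Bernoulli.
Context (I : choiceType) d (Y : measurableType d).

Definition cylinders : set (set (I -> Y)) := [set A | exists i B,
  measurable B /\ A = [set x | B (x i)]].

Definition bernoulli_space : Type := g_sigma_algebraType cylinders.
HB.instance Definition _ := Measurable.on bernoulli_space.

(* These values determine [mu] on the sigma-algebra generated by [cylinders]. *)
Definition is_product_measure (R : realType) (eta : probability Y R)
    (mu : probability bernoulli_space R) :=
  forall (s : seq I) (B : I -> set Y), uniq s ->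
    (forall i, measurable (B i)) ->
    mu [set x | forall i, i \in s -> B i (x i)] =
    (\prod_(i <- s) eta (B i))%E.

End Bernoulli.

Definition is_equivalence (T : Type) (E : set (T * T)) :=
  [/\ forall x, E (x, x),
      forall x y, E (x, y) -> E (y, x) &
      forall x y z, E (x, y) -> E (y, z) -> E (x, z)].

Section Action.
Context (Lam : groupType) (I : choiceType) (act : Lam -> I -> I).

Definition is_action :=
  (forall i, act 1%g i = i) /\
  (forall g h i, act (g * h)%g i = act g (act h i)).

Definition invariant_mean (R : realType) (m : set I -> R) :=
  [/\ forall A, 0 <= m A,
      m setT = 1,
      forall A B, A `&` B = set0 -> m (A `|` B) = m A + m B &
      forall g A, m (act g @` A) = m A].

Context d (Y : measurableType d) (S : set (Y * Y)).
Local Notation X := (bernoulli_space I Y).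

Definition bernoulli_act (g : Lam) (x : X) : X := fun i => x (act g^-1%g i).

Definition tensor_rel : set (X * X) := [set p | exists F : set I,
  [/\ finite_set F,
      forall i, F i -> S (p.1 i, p.2 i) &
      forall i, ~ F i -> p.1 i = p.2 i]].

Definition orbit_rel : set (X * X) :=
  [set p | exists g, p.2 = bernoulli_act g p.1].

Definition bernoulli_rel : set (X * X) :=
  smallest (@is_equivalence X) (tensor_rel `|` orbit_rel).

End Action.

Definition same_fst (A B : Type) : set ((A * B) * (A * B)) :=
  [set p | p.1.1 = p.2.1].

(* Main.v *)
(* [R] is the orbit relation of a group generated by [Lam] and the flips
   [(x_i, b_i) |-> (x_i, 1 - b_i)] of a single coordinate; the Radon-Nikodym cocycle
   is [1] on [Lam] and [x_i] or [x_i^-1] on a flip.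

   Spectral gap.  The Efron-Stein decomposition [f = \sum_F f_F] over the finite
   subsets [F] of [I] attaches to each non-constant [f] in [L^2(X)] a mean on [I],
   namely the average of the uniform measures on the nonempty [F] with weights
   [|f_F|^2 / Var f].  It depends continuously and [Lam]-equivariantly on [f], so a
   bounded sequence that is asymptotically [Lam]-invariant in [L^2] but whose variance
   stays away from [0] yields, along an ultrafilter, an invariant mean.  Hence such
   sequences are asymptotically constant; on indicators this is strong ergodicity.

   Topologies.  In both of them the sets [{s | eta {|x^{is} - x^{it}| >= e} < e}] form
   a basis of neighborhoods of [t].  For [tau(R)]: if [delta^{i s_n} f_n(x) / f_n(y)]
   tends to [delta^{it}] in measure, then on the graphs of [Lam], where [delta = 1],
   it says that [f_n] is asymptotically invariant, hence close to constants, and on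
   the graph of a flip it then says that [x_i^{i s_n}] tends to [x_i^{it}]. *)
From HB Require Import structures.
Require Import Defs.
From mathcomp Require Import all_boot all_order all_algebra.
From mathcomp Require Import all_classical all_reals all_analysis measurable_realfun.
From mathcomp Require Import complex ring lra.
Import Order.TTheory GRing.Theory Num.Theory.
Import numFieldNormedType.Exports.
Set Implicit Arguments.
Unset Strict Implicit.
Unset Printing Implicit Defensive.
Local Open Scope classical_set_scope.
Local Open Scope ring_scope.

(** The decomposition is run along a finite list of coordinates, on bounded functions of finitely
    many coordinates, which are dense in L^2. It is nevertheless canonical: the projections commute,
    so the order of the list is irrelevant, and coordinates on which the function does not depend
    contribute nothing, so the list can be enlarged until a function and its translate are compared
    over the same one. Continuity comes from the weighted sum of the pieces being a quadratic form
    between 0 and the square of the L^2 norm.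

    On the cohomology side the obstacle is the quotient topology: a set of classes is open when its
    saturation is. Multiplication by a coboundary preserves the pointwise distance of cocycles, so
    saturations of open sets are open, and neighborhoods of a class can be tested on finitely many
    words with one radius. Letting the words and the radius vary together produces the sequence of
    functions [f_n].

    The coordinates of [X] have law [eta], whereas [rho] lives over [xi]. On sets that ignore the
    bit, [eta] is the measure with density 1 + x with respect to [xi], which is finite; hence
    smallness for [xi] and for [eta] can be exchanged. *)

Definition bmeas d (T : measurableType d) (R : realType) (f : T -> R) :=
  measurable_fun setT f /\ exists K : R, forall x, `|f x| <= K.

(** * Bounded measurable functions, their integrals and Fubini's theorem *)

Section BoundedMeasurable.
Context d (T : measurableType d) (R : realType).
Implicit Types (f g : T -> R).

Lemma bmeas_cst (a : R) : bmeas (fun _ : T => a).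
Proof. by split => //; exists `|a|. Qed.

Lemma bmeasN f : bmeas f -> bmeas (fun x => - f x).
Proof.
move=> [mf [K fK]]; split; first exact: measurable_funN.
by exists K => x; rewrite normrN.
Qed.

Lemma bmeasD f g : bmeas f -> bmeas g -> bmeas (fun x => f x + g x).
Proof.
move=> [mf [K fK]] [mg [L gL]]; split; first exact: measurable_funD.
by exists (K + L) => x; rewrite (le_trans (ler_normD _ _))// lerD.
Qed.

Lemma bmeasB f g : bmeas f -> bmeas g -> bmeas (fun x => f x - g x).
Proof. by move=> bf bg; apply: bmeasD => //; exact: bmeasN. Qed.

Lemma bmeasM f g : bmeas f -> bmeas g -> bmeas (fun x => f x * g x).
Proof.
move=> [mf [K fK]] [mg [L gL]]; split; first exact: measurable_funM.
by exists (K * L) => x; rewrite normrM ler_pM.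
Qed.

Lemma bmeasX f n : bmeas f -> bmeas (fun x => f x ^+ n).
Proof.
move=> bf; elim: n => [|n IH].
  by under eq_fun do rewrite expr0; exact: bmeas_cst.
by under eq_fun do rewrite exprS; exact: bmeasM.
Qed.

Lemma bmeas_indic (A : set T) : measurable A -> bmeas (\1_A : T -> R).
Proof.
move=> mA; split; first exact: measurable_indic.
by exists 1 => x; rewrite indicE; case: (x \in A); rewrite ?normr1 ?normr0.
Qed.

Lemma bmeas_comp d' (T' : measurableType d') (h : T' -> T) f :
  measurable_fun setT h -> bmeas f -> bmeas (fun x => f (h x)).
Proof.
by move=> mh [mf [K fK]]; split; [exact: measurableT_comp|exists K => x].
Qed.

Variable P : {finite_measure set T -> \bar R}.

Lemma bmeas_integrable f : bmeas f -> P.-integrable setT (EFin \o f).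
Proof.
move=> [mf [K fK]]; apply: measurable_bounded_integrable => //.
  exact: fin_num_fun_lty.
exists K; split; first exact: num_real.
by move=> M KM x _ /=; rewrite (le_trans (fK x))// ltW.
Qed.

Lemma bintegralD f g : bmeas f -> bmeas g ->
  \int[P]_x (f x + g x) = \int[P]_x f x + \int[P]_x g x.
Proof. by move=> bf bg; rewrite RintegralD//; exact: bmeas_integrable. Qed.

Lemma bintegralB f g : bmeas f -> bmeas g ->
  \int[P]_x (f x - g x) = \int[P]_x f x - \int[P]_x g x.
Proof. by move=> bf bg; rewrite RintegralB//; exact: bmeas_integrable. Qed.

Lemma bintegralZ (a : R) f : bmeas f ->
  \int[P]_x (a * f x) = a * \int[P]_x f x.
Proof. by move=> bf; rewrite RintegralZl//; exact: bmeas_integrable. Qed.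

Lemma le_bintegral f g : bmeas f -> bmeas g -> (forall x, f x <= g x) ->
  \int[P]_x f x <= \int[P]_x g x.
Proof. by move=> bf bg fg; apply: le_Rintegral => //; exact: bmeas_integrable. Qed.

Lemma EFin_bintegral f : bmeas f -> (\int[P]_x f x)%:E = (\int[P]_x (f x)%:E)%E.
Proof.
by move=> bf; rewrite fineK// integrable_fin_num//; exact: bmeas_integrable.
Qed.

Lemma bintegral_indic (A : set T) : measurable A ->
  \int[P]_x (\1_A x : R) = fine (P A).
Proof. by move=> mA; rewrite /Rintegral integral_indic// setIT. Qed.

Lemma bintegral_sqr_ge0 f : 0 <= \int[P]_x f x ^+ 2.
Proof. by apply: Rintegral_ge0 => x _; exact: sqr_ge0. Qed.

End BoundedMeasurable.

Lemma bintegral_cst d (T : measurableType d) (R : realType)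
  (P : probability T R) (a : R) : \int[P]_x a = a.
Proof.
rewrite Rintegral_cst//= (_ : fine _ = 1) ?mulr1//.
by rewrite (_ : 1 = fine (1 : \bar R)%E)//; congr fine; exact: probability_setT.
Qed.

Section BoundedFubini.
Context d1 d2 (T1 : measurableType d1) (T2 : measurableType d2) (R : realType).
Variables (P1 : probability T1 R) (P2 : probability T2 R).
Variable f : T1 * T2 -> R.
Hypothesis bf : bmeas f.

Let bf1 x : bmeas (fun y => f (x, y)).
Proof. by apply: bmeas_comp bf; exact: measurable_pair1. Qed.
Let bf2 y : bmeas (fun x => f (x, y)).
Proof. by apply: bmeas_comp bf; exact: measurable_pair2. Qed.

Lemma bmeas_integrable_prod : (P1 \x P2)%E.-integrable setT (EFin \o f).
Proof.
have [mf [K fK]] := bf; apply: measurable_bounded_integrable => //.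
  rewrite -setXTT [ltLHS]product_measure1E//.
  apply: lte_mul_pinfty => //; first exact: fin_num_measure.
  by rewrite ltey_eq fin_num_measure.
exists K; split; first exact: num_real.
by move=> M KM x _ /=; rewrite (le_trans (fK x))// ltW.
Qed.

Lemma bmeas_fubini1 : bmeas (fun x => \int[P2]_y f (x, y)).
Proof.
split.
  apply/measurable_EFinP.
  rewrite [X in measurable_fun _ X](_ : _ = fubini_F P2 (EFin \o f)).
    exact: measurable_fubini_F bmeas_integrable_prod.
  by apply/funext => x; rewrite /fubini_F /= EFin_bintegral.
have [_ [K fK]] := bf; exists K => x.
rewrite (le_trans (le_normr_Rintegral _ (bmeas_integrable _ (bf1 x))))//.
rewrite -[leRHS](bintegral_cst P2); apply: le_bintegral => //; last exact: bmeas_cst.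
by case: (bf1 x) => mf _; split; [exact: measurableT_comp|exists K => y; rewrite normr_id].
Qed.

Lemma bfubini1 : \int[P1]_x \int[P2]_y f (x, y) = fine (\int[(P1 \x P2)%E]_z (f z)%:E)%E.
Proof.
rewrite -integral12_prod_meas1//; last exact: bmeas_integrable_prod.
congr fine; apply: eq_integral => x _.
by rewrite EFin_bintegral.
Qed.

Lemma bfubini2 : \int[P2]_y \int[P1]_x f (x, y) = fine (\int[(P1 \x P2)%E]_z (f z)%:E)%E.
Proof.
rewrite -integral21_prod_meas1//; last exact: bmeas_integrable_prod.
congr fine; apply: eq_integral => x _.
by rewrite EFin_bintegral.
Qed.

End BoundedFubini.

(** * Coordinate expectations on the Bernoulli space *)

Section BernoulliSpace.
Context (I : choiceType) d (Y : measurableType d).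
Local Notation X := (bernoulli_space I Y).

Lemma measurable_coord i : measurable_fun setT (fun x : X => x i).
Proof.
by move=> _ B mB; rewrite setTI; apply: sub_sigma_algebra; exists i, B.
Qed.

Lemma measurable_bernoulli d' (T : measurableType d') (f : T -> X) :
  (forall i, measurable_fun setT (fun t => f t i)) -> measurable_fun setT f.
Proof.
move=> mf; have gen : @measurable _ X = <<s @cylinders I d Y >> by [].
apply: (measurability _ gen).
move=> _ [_ [i [B [mB ->]]] <-]; exact: (mf i).
Qed.

Definition upd (i : I) (x : X) (y : Y) : X := fun j => if j == i then y else x j.

Lemma updE i x y : upd i x y i = y.
Proof. by rewrite /upd eqxx. Qed.

Lemma updN i x y j : j != i -> upd i x y j = x j.
Proof. by rewrite /upd => /negPf ->. Qed.

Lemma upd_upd i x y z : upd i (upd i x y) z = upd i x z.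
Proof. by apply/funext => j; rewrite /upd; case: (j == i). Qed.

Lemma updC i j x y z : i != j -> upd i (upd j x y) z = upd j (upd i x z) y.
Proof.
move=> ij; apply/funext => k; rewrite /upd.
by case: (eqVneq k i) => // ->; rewrite (negPf ij).
Qed.

Lemma upd_id i x : upd i x (x i) = x.
Proof. by apply/funext => j; rewrite /upd; case: eqVneq => [->|]. Qed.

Lemma measurable_upd_comp d' (T : measurableType d') i (u : T -> X) (v : T -> Y) :
  measurable_fun setT u -> measurable_fun setT v ->
  measurable_fun setT (fun t => upd i (u t) (v t)).
Proof.
move=> mu' mv; apply: measurable_bernoulli => j; rewrite /upd; case: (j == i) => //.
exact: (measurableT_comp (measurable_coord j) mu').
Qed.

Lemma measurable_upd i : measurable_fun setT (fun p : X * Y => upd i p.1 p.2).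
Proof. by apply: measurable_upd_comp; [exact: measurable_fst|exact: measurable_snd]. Qed.

Definition rect (s : seq I) (B : I -> set Y) : set X :=
  [set x | forall i, i \in s -> B i (x i)].

Lemma rect_cons i s B : rect (i :: s) B = [set x : X | B i (x i)] `&` rect s B.
Proof.
apply/seteqP; split => x /=.
  move=> h; split; first by apply: h; rewrite inE eqxx.
  by move=> j js; apply: h; rewrite inE js orbT.
by move=> [h1 h2] j; rewrite inE => /predU1P[-> //|/h2].
Qed.

Lemma measurable_rect s B : (forall i, measurable (B i)) -> measurable (rect s B).
Proof.
move=> mB; elim: s => [|i s IH].
  by rewrite (_ : rect _ _ = setT)//; apply/seteqP; split.
rewrite rect_cons; apply: measurableI => //.
by rewrite -[X in measurable X]setTI; exact: measurable_coord.
Qed.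

Definition rects : set (set X) := [set C | exists s B,
  [/\ uniq s, forall i, measurable (B i) & C = rect s B]].

Lemma rects_gen : @measurable _ X = <<s rects >>.
Proof.
apply/seteqP; split.
  apply: smallest_sub; first exact: smallest_sigma_algebra.
  move=> _ [i [B [mB ->]]]; apply: sub_sigma_algebra.
  exists [:: i], (fun=> B); split => //; apply/seteqP; split => x /=.
    by move=> Bx j; rewrite inE => /eqP ->.
  by apply; rewrite inE.
apply: smallest_sub; first exact: sigma_algebra_measurable.
by move=> _ [s [B [_ mB ->]]]; exact: measurable_rect.
Qed.

Lemma rects_setI_closed : setI_closed rects.
Proof.
move=> _ _ [s [B [us mB ->]]] [s' [B' [us' mB' ->]]].
exists (undup (s ++ s')), (fun i => (if i \in s then B i else setT) `&`
  (if i \in s' then B' i else setT)); split; first exact: undup_uniq.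
  by move=> i; apply: measurableI; case: ifP.
apply/seteqP; split => x /=.
  move=> [h h'] i _; split; case: ifP => // is_; [exact: h|exact: h'].
move=> h; split => i is_.
  by have := h i; rewrite mem_undup mem_cat is_ => /(_ isT)[].
by have := h i; rewrite mem_undup mem_cat is_ orbT => /(_ isT)[].
Qed.

Section ProductMeasure.
Context (R : realType) (eta : probability Y R) (mu : probability X R).
Hypothesis mu_prod : is_product_measure eta mu.

Lemma product_measure_uniq (m : {measure set X -> \bar R}) :
  (forall s B, uniq s -> (forall i, measurable (B i)) ->
     m (rect s B) = (\prod_(i <- s) eta (B i))%E) ->
  forall A, measurable A -> m A = mu A.
Proof.
move=> mE A mA.
have rT : rect [::] (fun=> setT) = setT by apply/seteqP; split.
apply: (@measure_unique _ _ _ rects (fun=> setT)) => //.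
- exact: rects_gen.
- exact: rects_setI_closed.
- by move=> _; exists [::], (fun=> setT); split.
- by apply/seteqP; split => // x _; exists 0%N.
- by move=> _ [s [B [us mB ->]]]; rewrite mE// -mu_prod.
- move=> _; rewrite -rT mE// big_nil ltry //.
Qed.

Lemma mu_coord i B : measurable B -> mu [set x : X | B (x i)] = eta B.
Proof.
move=> mB; have := mu_prod (s := [:: i]) (B := fun=> B) isT (fun=> mB).
rewrite big_seq1 => <-; congr (mu _); apply/seteqP; split => x /=.
  by move=> h j; rewrite inE => /eqP ->.
by apply; rewrite inE.
Qed.

(** Resampling one coordinate by an independent variable of law [eta] preserves the product law: on
    a rectangle the new variable supplies the factor at [i], and the old point supplies all the
    others. *)
Lemma prod_upd i A : measurable A ->
  pushforward (mu \x eta)%E (fun p : X * Y => upd i p.1 p.2) A = mu A.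
Proof.
have mu' := measurable_upd i.
pose m' := isMeasurableFun.Build _ _ _ _ _ mu'.
pose f : {mfun _ >-> _} := HB.pack (fun p : X * Y => upd i p.1 p.2) m'.
move: A; apply: (product_measure_uniq (m := pushforward (mu \x eta)%E f)).
move=> s B us mB.
transitivity ((mu \x eta)%E (rect (rem i s) B `*` (if i \in s then B i else setT))).
  congr ((mu \x eta)%E _).
  apply/seteqP; split => -[x y] /=.
    move=> h; split => [j|].
      by rewrite mem_rem_uniq// !inE => /andP[ji js]; have := h j js; rewrite updN.
    by case: ifP => // is_; have := h i is_; rewrite updE.
  move=> [h1 h2] j js; rewrite /upd; case: eqVneq => [ji|ji].
    by move: h2; rewrite -ji js.
  by apply: h1; rewrite mem_rem_uniq// !inE ji.
rewrite product_measure1E; [|exact: measurable_rect|by case: ifP].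
transitivity ((\prod_(j <- rem i s) eta (B j)) *
    eta (if i \in s then B i else setT))%E.
  by congr (_ * _)%E; apply: mu_prod => //; exact: rem_uniq.
have [is_|is_] := boolP (i \in s).
  by rewrite (perm_big _ (perm_to_rem is_)) big_cons muleC.
rewrite rem_id// (_ : eta setT = 1%E) ?mule1//; exact: probability_setT.
Qed.

Lemma ge0_integral_upd i (f : X -> \bar R) : measurable_fun setT f ->
  (forall x, 0 <= f x)%E ->
  (\int[mu]_x f x = \int[mu]_x \int[eta]_y f (upd i x y))%E.
Proof.
move=> mf f0.
have mu' := measurable_upd i.
transitivity (\int[(mu \x eta)%E]_p f (upd i p.1 p.2))%E; last first.
  apply: (@fubini_tonelli1 _ _ _ _ _ mu eta (fun p => f (upd i p.1 p.2))) => //.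
  exact: (measurableT_comp mf mu').
transitivity (\int[pushforward (mu \x eta)%E (fun p => upd i p.1 p.2)]_x f x)%E.
  by apply: eq_measure_integral => A mA _; exact/esym/prod_upd.
by rewrite (ge0_integral_pushforward mu' _ measurableT).
Qed.

(** The conditional expectation given all coordinates but [i], defined at every point. Hence
    idempotence and commutation of these operators are equalities of functions on bounded [f], with
    no null sets to carry along. *)
Definition E_ (i : I) (f : X -> R) (x : X) : R := \int[eta]_y f (upd i x y).

Section E_theory.
Variable i : I.
Implicit Types f g : X -> R.

Lemma bmeas_upd2 f : bmeas f -> bmeas (fun p : X * Y => f (upd i p.1 p.2)).
Proof. by move=> bf; exact: (bmeas_comp (measurable_upd i) bf). Qed.

Lemma bmeas_upd f x : bmeas f -> bmeas (fun y => f (upd i x y)).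
Proof.
by move=> /bmeas_upd2 bf; apply: (bmeas_comp (measurable_pair1 x) bf).
Qed.

Lemma bmeas_E f : bmeas f -> bmeas (E_ i f).
Proof. by move=> /bmeas_upd2; exact: bmeas_fubini1. Qed.

Lemma bintegral_E f : bmeas f -> \int[mu]_x E_ i f x = \int[mu]_x f x.
Proof.
move=> bf; have bf2 := bmeas_upd2 bf.
rewrite /E_ (bfubini1 mu eta bf2); congr fine.
have mf : measurable_fun setT (EFin \o f) by apply/measurable_EFinP; case: bf.
transitivity (\int[pushforward (mu \x eta)%E (fun p => upd i p.1 p.2)]_x (f x)%:E)%E.
  rewrite (integral_pushforward (measurable_upd i) mf _ measurableT)//.
  exact: bmeas_integrable_prod.
apply: eq_measure_integral => [|? A mA _]; [exact: measurable_upd|exact: prod_upd].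
Qed.

Lemma E_B f g : bmeas f -> bmeas g ->
  E_ i (fun x => f x - g x) = fun x => E_ i f x - E_ i g x.
Proof.
by move=> bf bg; apply/funext => x; rewrite /E_ bintegralB//; exact: bmeas_upd.
Qed.

Lemma E_D f g : bmeas f -> bmeas g ->
  E_ i (fun x => f x + g x) = fun x => E_ i f x + E_ i g x.
Proof.
by move=> bf bg; apply/funext => x; rewrite /E_ bintegralD//; exact: bmeas_upd.
Qed.

Lemma E_upd f x y : E_ i f (upd i x y) = E_ i f x.
Proof. by rewrite /E_; under eq_Rintegral do rewrite upd_upd. Qed.

Lemma E_id f : (forall x y, f (upd i x y) = f x) -> E_ i f = f.
Proof.
move=> fi; apply/funext => x; rewrite /E_.
by under eq_Rintegral do rewrite fi; rewrite bintegral_cst.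
Qed.

Lemma E_pullout f g : bmeas f -> bmeas g -> (forall x y, g (upd i x y) = g x) ->
  E_ i (fun x => g x * f x) = fun x => g x * E_ i f x.
Proof.
move=> bf bg gi; apply/funext => x; rewrite /E_ -bintegralZ; last exact: bmeas_upd.
by apply: eq_Rintegral => y _; rewrite gi.
Qed.

(** [E_ i] is an orthogonal projection: [E_ i f] ignores coordinate [i], so it can be pulled out of
    [E_ i] in the cross term. *)
Lemma pythagoras f : bmeas f ->
  \int[mu]_x f x ^+ 2 = \int[mu]_x E_ i f x ^+ 2 + \int[mu]_x (f x - E_ i f x) ^+ 2.
Proof.
move=> bf; have bE := bmeas_E bf.
have cross : \int[mu]_x (E_ i f x * f x) = \int[mu]_x E_ i f x ^+ 2.
  rewrite -bintegral_E; last exact: bmeasM.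
  by rewrite E_pullout//; exact: E_upd.
have -> : (fun x => (f x - E_ i f x) ^+ 2) =
    fun x => f x ^+ 2 + (E_ i f x ^+ 2 - 2 * (E_ i f x * f x)).
  by apply/funext => x; ring.
have b1 : bmeas (fun x => 2 * (E_ i f x * f x)).
  by apply: bmeasM; [exact: bmeas_cst|exact: bmeasM].
rewrite bintegralD; [|exact: bmeasX|by apply: bmeasB => //; exact: bmeasX].
rewrite bintegralB//; last exact: bmeasX.
rewrite bintegralZ ?cross; last exact: bmeasM.
by ring.
Qed.

End E_theory.

Lemma E_C i j f : bmeas f -> E_ i (E_ j f) = E_ j (E_ i f).
Proof.
have [-> //|ij bf] := eqVneq i j; apply/funext => x; rewrite /E_.
have bf2 : bmeas (fun p : Y * Y => f (upd j (upd i x p.1) p.2)).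
  apply: (bmeas_comp _ bf).
  apply: measurable_upd_comp; last exact: measurable_snd.
  by apply: measurable_upd_comp; [exact: measurable_cst|exact: measurable_fst].
rewrite (bfubini1 eta eta bf2) -(bfubini2 eta eta bf2).
by apply: eq_Rintegral => y _; apply: eq_Rintegral => z _ /=; rewrite (updC _ _ _ ij).
Qed.

End ProductMeasure.

End BernoulliSpace.

(** * Efron-Stein masses *)

Section EfronStein.
Context (I : choiceType) d (Y : measurableType d) (R : realType).
Local Notation X := (bernoulli_space I Y).
Context (eta : probability Y R) (mu : probability X R).
Hypothesis mu_prod : is_product_measure eta mu.
Local Notation E_ := (E_ eta).
Local Notation N2 f := (\int[mu]_x f x ^+ 2).
Implicit Types (f h : X -> R) (chi : I -> R) (J L : seq I).

Definition indep (i : I) f := forall x y, f (upd i x y) = f x.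

Lemma indep_E i j f : indep i f -> indep i (E_ j f).
Proof.
move=> fi x y; have [->|ij] := eqVneq i j; first exact: E_upd.
by apply: eq_Rintegral => z _; rewrite (updC _ _ _ (_ : j != i)) ?fi// eq_sym.
Qed.

Lemma indepB i f h : indep i f -> indep i h -> indep i (fun x => f x - h x).
Proof. by move=> fi hi x y; rewrite fi hi. Qed.

Lemma bmeas_subE i f : bmeas f -> bmeas (fun x => f x - E_ i f x).
Proof. by move=> bf; apply: bmeasB => //; exact: bmeas_E. Qed.

(* Expanding [f] along [J] into the pieces [f_F = prod_(i in F) (1 - E_i)
   prod_(i in J :\: F) E_i f], [mass chi J 0 0 f] is the sum over the subsets [F]
   of [J] of [|f_F|^2] weighted by the average of [chi] over [F]; [c] and [b]
   accumulate the sum of [chi] over [F] and the cardinality of [F].  The piece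
   [F = set0] has weight [0 / 0 = 0]. *)
Fixpoint mass chi J (c b : R) f : R :=
  if J is i :: J' then
    mass chi J' c b (E_ i f) + mass chi J' (c + chi i) (b + 1) (fun x => f x - E_ i f x)
  else c / b * N2 f.

Fixpoint E_seq J f : X -> R := if J is i :: J' then E_seq J' (E_ i f) else f.

Lemma mass_ge0 chi J c b f : (forall i, 0 <= chi i) -> 0 <= c -> 0 <= b ->
  0 <= mass chi J c b f.
Proof.
move=> chi0; elim: J c b f => [|i J IH] c b f c0 b0 /=.
  by rewrite mulr_ge0 ?divr_ge0// bintegral_sqr_ge0.
by rewrite addr_ge0// IH// addr_ge0.
Qed.

(** This becomes the finite additivity of the mean when [chi] and [chi'] are indicators of disjoint
    sets. *)
Lemma massD chi chi' J c c' b f :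
  mass (fun i => chi i + chi' i) J (c + c') b f =
  mass chi J c b f + mass chi' J c' b f.
Proof.
elim: J c c' b f => [|i J IH] c c' b f /=; first by rewrite !mulrDl.
by rewrite IH (_ : c + c' + _ = (c + chi i) + (c' + chi' i)) ?IH; ring.
Qed.

Lemma mass_total_gt0 J b f : 0 < b -> bmeas f -> mass (fun=> 1) J b b f = N2 f.
Proof.
elim: J b f => [|i J IH] b f b0 bf /=; first by rewrite divff ?mul1r// gt_eqF.
rewrite !IH ?addr_gt0//; [|exact: bmeas_subE|exact: bmeas_E].
by rewrite -pythagoras.
Qed.

(** For constant weight 1 every piece over a nonempty set has average 1, while the piece over the
    empty set, which is [E_seq J f], is lost because 0 / 0 = 0. *)
Lemma mass_total J f : bmeas f ->
  mass (fun=> 1) J 0 0 f = N2 f - N2 (E_seq J f).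
Proof.
elim: J f => [|i J IH] f bf /=; first by rewrite !mul0r subrr.
rewrite IH; last exact: bmeas_E.
rewrite add0r mass_total_gt0//; last exact: bmeas_subE.
by rewrite [in RHS](pythagoras mu_prod i bf); ring.
Qed.

(** On each piece |u^2 - v^2| = |u - v| |u + v|, which is at most (l^-1 (u - v)^2 + l (u + v)^2) / 2
    because the difference of the two sides is a perfect square. The averages [c / b] lie in [0, 1],
    and Pythagoras adds the bounds up along [J]. Keeping [l] free replaces the Cauchy-Schwarz
    inequality. *)
Lemma mass_lip chi J c b f h l : (forall i, 0 <= chi i <= 1) -> 0 <= c <= b ->
  bmeas f -> bmeas h -> 0 < l ->
  `|mass chi J c b f - mass chi J c b h| <=
    (l^-1 * N2 (fun x => f x - h x) + l * N2 (fun x => f x + h x)) / 2.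
Proof.
move=> chi01; elim: J c b f h => [|i J IH] c b f h cb bf hf l0 /=.
  have cb1 : 0 <= c / b <= 1.
    case/andP: cb => c0 cb; rewrite divr_ge0//=; last exact: le_trans cb.
    have [->|b0] := eqVneq b 0; first by rewrite invr0 mulr0.
    by rewrite ler_pdivrMr ?mul1r// lt_def b0 (le_trans c0).
  rewrite -mulrBr normrM ger0_norm; last by case/andP: cb1.
  set K := (X in _ <= X).
  have bD := bmeasD bf hf; have bB := bmeasB bf hf.
  have bX2 := bmeasX 2 bD; have bY2 := bmeasX 2 bB.
  have ZD := bmeasM (bmeas_cst _ (l / 2)) bX2.
  have ZB := bmeasM (bmeas_cst _ (l^-1 / 2)) bY2.
  have KE : K = \int[mu]_x (l^-1 / 2 * (f x - h x) ^+ 2 + l / 2 * (f x + h x) ^+ 2).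
    by rewrite bintegralD// !bintegralZ// /K; ring.
  have K0 : `|N2 f - N2 h| <= K.
    rewrite -bintegralB; [|exact: bmeasX|exact: bmeasX].
    have bfh : bmeas (fun x => f x ^+ 2 - h x ^+ 2) by apply: bmeasB; exact: bmeasX.
    rewrite (le_trans (le_normr_Rintegral _ (bmeas_integrable _ bfh)))// KE.
    apply: le_bintegral.
    - case: bfh => m [k fk]; split; first exact: measurableT_comp.
      by exists k => x; rewrite normr_id.
    - exact: bmeasD.
    - move=> x; set u := f x; set v := h x.
      have l_neq0 : l != 0 by rewrite gt_eqF.
      have l2 : 0 <= l / 2 by rewrite divr_ge0// ltW.
      rewrite ler_norml; apply/andP; split; rewrite -subr_ge0.
        rewrite (_ : _ - _ = l / 2 * (l^-1 * (u - v) + (u + v)) ^+ 2); last by field.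
        by rewrite mulr_ge0 ?sqr_ge0.
      rewrite (_ : _ - _ = l / 2 * (l^-1 * (u - v) - (u + v)) ^+ 2); last by field.
      by rewrite mulr_ge0 ?sqr_ge0.
  case/andP: cb1 => r0 r1; apply: le_trans K0.
  by rewrite -[leRHS]mul1r ler_wpM2r.
have /andP[c0 cb0] := cb; have /andP[chi0 chi1] := chi01 i.
have cb' : 0 <= c + chi i <= b + 1 by rewrite addr_ge0//= lerD.
have h1 := IH c b (E_ i f) (E_ i h) cb (bmeas_E eta mu i bf) (bmeas_E eta mu i hf) l0.
have h2 := IH _ _ _ _ cb' (bmeas_subE i bf) (bmeas_subE i hf) l0.
rewrite opprD addrACA (le_trans (ler_normD _ _))// (le_trans (lerD h1 h2))//.
rewrite (pythagoras mu_prod i (bmeasB bf hf)).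
rewrite (pythagoras mu_prod i (bmeasD bf hf)) E_B// E_D//.
rewrite (_ : (fun x => (f x - E_ i f x - (h x - E_ i h x)) ^+ 2) =
  fun x => (f x - h x - (E_ i f x - E_ i h x)) ^+ 2); last by apply/funext => x; ring.
rewrite (_ : (fun x => (f x - E_ i f x + (h x - E_ i h x)) ^+ 2) =
  fun x => (f x + h x - (E_ i f x + E_ i h x)) ^+ 2); last by apply/funext => x; ring.
by rewrite le_eqVlt; apply/orP; left; apply/eqP; ring.
Qed.

(** The projections commute, so exchanging [i] and [j] only exchanges the two middle pieces, those
    with exactly one of [i] and [j] in F. *)
Lemma mass_swap chi i j J c b f : bmeas f ->
  mass chi (i :: j :: J) c b f = mass chi (j :: i :: J) c b f.
Proof.
move=> bf; have bE k := bmeas_E eta mu k bf.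
have eE k l : E_ k (fun x => f x - E_ l f x) = fun x => E_ k f x - E_ k (E_ l f) x.
  exact: E_B.
rewrite [LHS]/= [RHS]/= (eE j i) (eE i j) (E_C eta i j bf).
rewrite [c + chi j + chi i]addrAC addrACA; congr (_ + _ + (_ + mass _ _ _ _ _)).
by apply/funext => x; rewrite !opprB addrACA [RHS]addrACA; congr (_ + _); rewrite addrC.
Qed.

Lemma mass_cat_cons chi i J L c b f : bmeas f ->
  mass chi (J ++ i :: L) c b f = mass chi (i :: J ++ L) c b f.
Proof.
elim: J c b f => [//|j J IH] c b f bf; rewrite cat_cons mass_swap//.
by rewrite [LHS]/= [RHS]/= !IH //; [exact: bmeas_subE|exact: bmeas_E].
Qed.

Lemma mass_perm chi J L c b f : perm_eq J L -> bmeas f ->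
  mass chi J c b f = mass chi L c b f.
Proof.
elim: J L c b f => [|i J IH] L c b f pJL bf.
  by have /perm_nilP -> : perm_eq L [::] by rewrite perm_sym.
have iL : i \in L by rewrite -(perm_mem pJL) mem_head.
move: pJL; case/splitPr: iL => L1 L2; rewrite perm_sym -[i :: L2]cat1s perm_catCA cat1s perm_cons perm_sym => pJL.
rewrite mass_cat_cons//=.
by rewrite !(IH (L1 ++ L2))//; [exact: bmeas_subE|exact: bmeas_E].
Qed.

Lemma mass0 chi J c b : mass chi J c b (fun=> 0) = 0.
Proof.
elim: J c b => [|i J IH] c b /=.
  under eq_Rintegral do rewrite expr0n/=.
  by rewrite bintegral_cst mulr0.
rewrite E_id// IH add0r; rewrite -[RHS](IH (c + chi i) (b + 1)).
by congr mass; apply/funext => x; rewrite subrr.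
Qed.

Lemma mass_cat chi J L c b f : bmeas f -> {in L, forall i, indep i f} ->
  mass chi (J ++ L) c b f = mass chi J c b f.
Proof.
elim: J c b f => [|j J IH] c b f bf fL /=.
  elim: L fL c b => [//|i L IHL] fL c b /=.
  have fi : indep i f by apply: fL; rewrite mem_head.
  rewrite E_id// (_ : (fun x => f x - f x) = fun=> 0); last first.
    by apply/funext => x; rewrite subrr.
  rewrite mass0 addr0 IHL// => j jL; apply: fL; by rewrite inE jL orbT.
rewrite !IH//.
- exact: bmeas_subE.
- by move=> i iL; apply: indepB; [exact: fL|exact/indep_E/fL].
- exact: bmeas_E.
- by move=> i iL; exact/indep_E/fL.
Qed.

(** For a coordinate [i] on which [f] does not depend, f - E_i f vanishes, so every piece over a set
    containing [i] is 0. This frees the mass from the choice of the list. *)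
Lemma mass_widen chi J L f : uniq J -> uniq L -> {subset J <= L} -> bmeas f ->
  (forall i, i \notin J -> indep i f) -> mass chi L 0 0 f = mass chi J 0 0 f.
Proof.
move=> uJ uL JL bf fJ.
rewrite (@mass_perm _ _ (J ++ [seq i <- L | i \notin J]))//.
  by rewrite mass_cat// => i; rewrite mem_filter => /andP[/fJ].
apply: uniq_perm => //.
  rewrite cat_uniq uJ filter_uniq// andbT /=; apply/hasPn => i.
  by rewrite mem_filter => /andP[].
move=> i; rewrite mem_cat mem_filter.
by case: (boolP (i \in J)) => //= /JL.
Qed.

(** Once all the coordinates that [f] depends on are integrated out, a constant is left, and each
    [E_ i] preserves the integral. *)
Lemma E_seq_constant J f : bmeas f -> (forall i, i \notin J -> indep i f) ->
  (forall x x', (forall i, i \in J -> x i = x' i) -> f x = f x') ->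
  E_seq J f = fun=> \int[mu]_x f x.
Proof.
elim: J f => [|i J IH] f bf fJ fdep /=.
  apply/funext => x; rewrite -[LHS](bintegral_cst mu).
  by apply: eq_Rintegral => y _; exact: fdep.
rewrite IH; last 3 first.
- exact: bmeas_E.
- move=> j jJ; have [->|ji] := eqVneq j i; first exact: E_upd.
  by apply/indep_E/fJ; rewrite inE (negPf ji).
- move=> x x' xx'; apply: eq_Rintegral => y _; apply: fdep => j.
  by rewrite inE /upd => /predU1P[->|/xx' ->]; [rewrite eqxx|].
by apply/funext => _; exact: bintegral_E.
Qed.

Section Action.
Context (Lam : groupType) (act : Lam -> I -> I).
Hypothesis act_action : is_action act.

Lemma actK g : cancel (act g) (act g^-1%g).
Proof. by move=> i; rewrite -act_action.2 mulVg act_action.1. Qed.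

Lemma actVK g : cancel (act g^-1%g) (act g).
Proof. by move=> i; rewrite -act_action.2 mulgV act_action.1. Qed.

Local Notation bact := (@bernoulli_act _ _ act d Y).

Lemma bactK g : cancel (bact g) (bact g^-1%g).
Proof.
by move=> x; apply/funext => i; rewrite /bernoulli_act invgK actK.
Qed.

Lemma bactVK g : cancel (bact g^-1%g) (bact g).
Proof.
by move=> x; apply/funext => i; rewrite /bernoulli_act invgK actVK.
Qed.

Lemma measurable_bact g : measurable_fun setT (bact g).
Proof. by apply: measurable_bernoulli => i; exact: measurable_coord. Qed.

Lemma bact_upd g i x y : bact g (upd i x y) = upd (act g i) (bact g x) y.
Proof.
apply/funext => j; rewrite /bernoulli_act /upd.
by rewrite -(inj_eq (can_inj (actK g))) actVK.
Qed.

Lemma mu_bact g A : measurable A -> mu (bact g @^-1` A) = mu A.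
Proof.
have mg := measurable_bact g.
pose m' := isMeasurableFun.Build _ _ _ _ _ mg.
pose f : {mfun _ >-> _} := HB.pack (bact g) m'.
move: A; apply: (product_measure_uniq mu_prod (m := pushforward mu f)).
move=> s B us mB.
have us' : uniq (map (act g^-1%g) s) by rewrite map_inj_uniq//; exact: can_inj (actVK g).
transitivity (mu (rect (map (act g^-1%g) s) (fun i => B (act g i)))).
  congr (mu _); apply/seteqP; split => x /=.
    by move=> h _ /mapP[i is_ ->]; rewrite actVK; exact: h.
  by move=> h i is_; have := h _ (map_f _ is_); rewrite actVK.
have := mu_prod us' (B := fun i => B (act g i)) (fun i => mB _).
rewrite big_map; under [in X in _ = X -> _]eq_bigr do rewrite actVK; exact.
Qed.

Lemma ge0_integral_bact g (f : X -> \bar R) : measurable_fun setT f ->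
  (forall x, 0 <= f x)%E -> (\int[mu]_x f (bact g x) = \int[mu]_x f x)%E.
Proof.
move=> mf f0; have mg := measurable_bact g.
transitivity (\int[pushforward mu (bact g)]_x f x)%E.
  by rewrite (ge0_integral_pushforward mg _ measurableT).
by apply: eq_measure_integral => A mA _; exact: mu_bact.
Qed.

Lemma bintegral_bact g f : bmeas f -> \int[mu]_x f (bact g x) = \int[mu]_x f x.
Proof.
move=> bf; have mg := measurable_bact g; congr fine.
have mf : measurable_fun setT (EFin \o f) by apply/measurable_EFinP; case: bf.
transitivity (\int[pushforward mu (bact g)]_x (f x)%:E)%E.
  rewrite (integral_pushforward mg mf _ measurableT)//.
  exact: bmeas_integrable (bmeas_comp mg bf).
by apply: eq_measure_integral => A mA _; exact: mu_bact.
Qed.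

Lemma E_bact g i f : E_ i (fun x => f (bact g x)) = fun x => E_ (act g i) f (bact g x).
Proof. by apply/funext => x; apply: eq_Rintegral => y _; rewrite bact_upd. Qed.

(** Equivariance of the decomposition: the piece over F of the translate is the translate of the
    piece of [f] over the image of F under [act g], and translation preserves [mu]. *)
Lemma mass_bact chi J c b f g : bmeas f ->
  mass chi J c b (fun x => f (bact g x)) =
  mass (chi \o act g^-1%g) (map (act g) J) c b f.
Proof.
elim: J c b f => [|i J IH] c b f bf /=.
  by rewrite (bintegral_bact g (bmeasX 2 bf)).
rewrite E_bact IH; last exact: bmeas_E.
by rewrite (IH _ _ _ (bmeas_subE (act g i) bf)) actK.
Qed.

End Action.

End EfronStein.

(** * Approximation by functions of finitely many coordinates *)

Section L2Distance.
Context d (T : measurableType d) (R : realType) (mu : probability T R).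
Local Notation N2 f := (\int[mu]_x f x ^+ 2).
Implicit Types f h : T -> R.

Lemma N2D f h : bmeas f -> bmeas h ->
  N2 (fun x => f x + h x) <= 2 * N2 f + 2 * N2 h.
Proof.
move=> bf bh; have b2 := bmeas_cst T (2 : R).
rewrite -!bintegralZ -?bintegralD; try exact: bmeasX; try by apply/bmeasM/bmeasX.
apply: le_bintegral; first exact/bmeasX/bmeasD.
  by apply: bmeasD; apply/bmeasM/bmeasX.
by move=> x; have := sqr_ge0 (f x - h x); nra.
Qed.

Lemma N2Z a f : bmeas f -> N2 (fun x => a * f x) = a ^+ 2 * N2 f.
Proof.
move=> bf; rewrite -bintegralZ; last exact: bmeasX.
by apply: eq_Rintegral => x _; rewrite exprMn.
Qed.

Lemma N2_dist f h : N2 (fun x => f x - h x) = N2 (fun x => h x - f x).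
Proof. by apply: eq_Rintegral => x _; rewrite -sqrrN opprB. Qed.

Lemma N2_trans f g h : bmeas f -> bmeas g -> bmeas h ->
  N2 (fun x => f x - h x) <=
  2 * N2 (fun x => f x - g x) + 2 * N2 (fun x => g x - h x).
Proof.
move=> bf bg bh.
rewrite (_ : (fun x => (f x - h x) ^+ 2) =
  fun x => ((f x - g x) + (g x - h x)) ^+ 2); last by apply/funext => x; ring.
by apply: N2D; exact: bmeasB.
Qed.

Lemma N2_le f a : bmeas f -> (forall x, `|f x| <= a) -> N2 f <= a ^+ 2.
Proof.
move=> bf fa; rewrite -[leRHS](bintegral_cst mu); apply: le_bintegral.
- exact: bmeasX.
- exact: bmeas_cst.
- move=> x; have := fa x; rewrite ler_norml => /andP[? ?]; nra.
Qed.

(** The difference of the two sides is the square of the distance from [a] to the mean. It bounds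
    variances below and above after [f] is replaced by an approximation. *)
Lemma variance_le f a : bmeas f ->
  N2 (fun x => f x - \int[mu]_x f x) <= N2 (fun x => f x - a).
Proof.
move=> bf; set m := \int[mu]_x f x.
have expand b : N2 (fun x => f x - b) = N2 f - 2 * b * m + b ^+ 2.
  rewrite (_ : (fun x => (f x - b) ^+ 2) =
    fun x => f x ^+ 2 - 2 * b * f x + b ^+ 2); last by apply/funext => x; ring.
  have bM : bmeas (fun x => 2 * b * f x) by apply: bmeasM => //; exact: bmeas_cst.
  have bX := bmeasX 2 bf.
  rewrite bintegralD; [|exact: bmeasB|exact: bmeas_cst].
  by rewrite bintegralB// bintegralZ// bintegral_cst.
by rewrite !expand; have := sqr_ge0 (m - a); nra.
Qed.

End L2Distance.

Section CylinderDensity.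
Context (I : choiceType) d (Y : measurableType d) (R : realType).
Local Notation X := (bernoulli_space I Y).
Context (mu : probability X R).
Local Notation N2 f := (\int[mu]_x f x ^+ 2).
Implicit Types (f h : X -> R) (J : seq I).

Definition depends_on J f :=
  forall x x', (forall i, i \in J -> x i = x' i) -> f x = f x'.

Lemma depends_on_indep J f i : depends_on J f -> i \notin J -> indep i f.
Proof.
move=> fJ iJ x y; apply: fJ => j jJ; rewrite /upd.
by case: eqVneq => // ji; rewrite -ji jJ in iJ.
Qed.

Definition approximable f := forall e, 0 < e -> exists J h,
  [/\ uniq J, bmeas h, depends_on J h & N2 (fun x => f x - h x) < e].

Lemma approximable_dep J f : uniq J -> bmeas f -> depends_on J f -> approximable f.
Proof.
move=> uJ bf fJ e e0; exists J, f; split => //.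
under eq_Rintegral do rewrite subrr expr0n/=.
by rewrite bintegral_cst.
Qed.

Lemma approximableD f h : bmeas f -> bmeas h -> approximable f ->
  approximable h -> approximable (fun x => f x + h x).
Proof.
move=> bf bh af ah e e0; have e4 : 0 < e / 4 by rewrite divr_gt0.
have [J [f' [uJ bf' fJ fe]]] := af _ e4; have [L [h' [uL bh' hL he]]] := ah _ e4.
exists (undup (J ++ L)), (fun x => f' x + h' x); split.
- exact: undup_uniq.
- exact: bmeasD.
- move=> x x' xx'; congr (_ + _); [apply: fJ|apply: hL] => i iJ; apply: xx';
    by rewrite mem_undup mem_cat iJ ?orbT.
- rewrite (_ : (fun x => (f x + h x - (f' x + h' x)) ^+ 2) =
    fun x => ((f x - f' x) + (h x - h' x)) ^+ 2); last by apply/funext => x; ring.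
  by rewrite (le_lt_trans (N2D _ (bmeasB bf bf') (bmeasB bh bh')))//; lra.
Qed.

Lemma approximableZ a f : bmeas f -> approximable f -> approximable (fun x => a * f x).
Proof.
move=> bf af e e0; have e4 : 0 < e / (a ^+ 2 + 1).
  by rewrite divr_gt0// ltr_wpDl ?sqr_ge0.
have [J [f' [uJ bf' fJ fe]]] := af _ e4.
exists J, (fun x => a * f' x); split => //.
- by apply: bmeasM => //; exact: bmeas_cst.
- by move=> x x' xx'; rewrite (fJ x x').
- rewrite (_ : (fun x => (a * f x - a * f' x) ^+ 2) =
    fun x => (a * (f x - f' x)) ^+ 2); last by apply/funext => x; ring.
  rewrite N2Z; last exact: bmeasB.
  move: fe; rewrite ltr_pdivlMr ?ltr_wpDl ?sqr_ge0// => fe.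
  apply: le_lt_trans fe; rewrite mulrC ler_wpM2l ?bintegral_sqr_ge0//.
  by rewrite lerDl.
Qed.

Lemma approximable_lim f : bmeas f ->
  (forall e, 0 < e -> exists f', [/\ bmeas f', approximable f' &
     N2 (fun x => f x - f' x) < e]) -> approximable f.
Proof.
move=> bf fl e e0; have e4 : 0 < e / 4 by rewrite divr_gt0.
have [f' [bf' af' ff']] := fl _ e4; have [J [h [uJ bh hJ he]]] := af' _ e4.
exists J, h; split => //.
by rewrite (le_lt_trans (N2_trans _ bf bf' bh))//; lra.
Qed.

Lemma approximable_cst a : approximable (fun=> a).
Proof. by apply: (@approximable_dep [::]) => //; exact: bmeas_cst. Qed.

Lemma depends_on_rect s B : depends_on s (\1_(rect s B : set X)).
Proof.
move=> x x' xx'; rewrite !indicE; congr (_%:R); congr nat_of_bool.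
by apply/idP/idP; rewrite !inE => h i is_; have := h i is_; rewrite xx'.
Qed.

Lemma approximable_indic A : measurable A -> approximable (\1_A : X -> R).
Proof.
move=> mA.
suff: <<s @rects I d Y >> `<=` [set A | measurable A /\ approximable (\1_A : X -> R)].
  by move=> h; apply: (h A _).2; rewrite -rects_gen.
apply: lambda_system_subset => //.
- exact: rects_setI_closed.
(* Dynkin's argument: rectangles are stable under intersection, and the sets with approximable
   indicator form a lambda-system. *)
- split.
  + by [].
  + split => //; rewrite indicT; exact: approximable_cst.
  + move=> B C CB [mB aB] [mC aC]; split; first exact: measurableD.
    rewrite (_ : \1_(B `\` C) = fun x : X => (\1_B x + (-1) * \1_C x : R)).
      apply: approximableD => //; first exact: bmeas_indic.
        by apply: bmeasM; [exact: bmeas_cst|exact: bmeas_indic].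
      by apply: approximableZ => //; exact: bmeas_indic.
    apply/funext => x; rewrite !indicE in_setD mulN1r.
    have [xC|xC] := boolP (x \in C); last by rewrite subr0 andbT.
    by rewrite andbF (mem_set (CB _ (set_mem xC))) subrr.
  + move=> F ndF FG; have mF n : measurable (F n) by case: (FG n).
    have mU : measurable (\bigcup_n F n) by exact: bigcupT_measurable.
    split => //; apply: approximable_lim; first exact: bmeas_indic.
    move=> e e0; have := nondecreasing_cvg_mu mF mU ndF (mu := mu).
    rewrite -[X in _ --> X]fineK ?fin_num_measure// => /fine_cvg.
    move=> /cvgrPdist_lt /(_ _ e0)[N _ /(_ N (leqnn N)) /=] FN.
    exists (\1_(F N)); split; [exact: bmeas_indic|by case: (FG N)|].
    apply: le_lt_trans FN; rewrite -!bintegral_indic// -bintegralB; try exact: bmeas_indic.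
    apply: le_trans (ler_norm _); rewrite le_eqVlt; apply/orP; left; apply/eqP.
    apply: eq_Rintegral => x _; rewrite !indicE.
    have [xF|xF] := boolP (x \in F N).
      by rewrite mem_set ?subrr ?expr0n//; exists N => //; exact: set_mem.
    by rewrite subr0; case: (_ \in _); rewrite ?expr1n ?expr0n.
- move=> _ [s [B [us mB ->]]]; have mr := measurable_rect s mB; split => //.
  by apply: (approximable_dep us); [exact: bmeas_indic|exact: depends_on_rect].
Qed.

Lemma bmeas_approximable f : bmeas f -> approximable f.
Proof.
move=> bf; apply: approximable_lim => // e e0.
(* Halving the sup norm by subtracting a two-valued function. *)
have step n : forall K f, 0 <= K -> bmeas f -> (forall x, `|f x| <= K) ->
    exists f', [/\ bmeas f', approximable f' & forall x, `|f x - f' x| <= K / 2 ^+ n].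
  elim: n => [|n IH] K h K0 bh hK.
    exists (fun=> 0); split; [exact: bmeas_cst|exact: approximable_cst|].
    by move=> x; rewrite subr0 expr0 divr1.
  pose A := [set x | 0 <= h x].
  have mA : measurable A.
    rewrite (_ : A = setT `&` h @^-1` `[0, +oo[); first by case: bh => mh _; exact: mh.
    by apply/seteqP; split => x /=; rewrite in_itv/= andbT// => -[].
  pose s x := K * \1_A x + (- (K / 2)).
  have bKA : bmeas (fun x => K * \1_A x).
    by apply: bmeasM; [exact: bmeas_cst|exact: bmeas_indic].
  have bs : bmeas s by apply: bmeasD => //; exact: bmeas_cst.
  have as_ : approximable s.
    apply: approximableD => //; [exact: bmeas_cst| |exact: approximable_cst].
    by apply: approximableZ; [exact: bmeas_indic|exact: approximable_indic].
  have [||x|f' [bf' af' hf']] := IH (K / 2) (fun x => h x - s x).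
  - by rewrite divr_ge0.
  - exact: bmeasB.
  - rewrite /s indicE; have := hK x; rewrite ler_norml => /andP[? ?].
    have [/set_mem xA|/negP xA] := boolP (x \in A); rewrite ler_norml ?mulr1 ?mulr0 ?add0r.
      by rewrite /A /= in xA; apply/andP; split; lra.
    have : h x < 0 by rewrite ltNge; apply/negP => h0; apply: xA; rewrite inE.
    by move=> h0; apply/andP; split; lra.
  - exists (fun x => s x + f' x); split; [exact: bmeasD|exact: approximableD|].
    move=> x; rewrite opprD addrA; apply: le_trans (hf' x) _.
    by rewrite exprS invfM mulrA.
have [_ [K fK]] := bf.
have K0 : 0 <= `|K| by [].
have fK' x : `|f x| <= `|K| by rewrite (le_trans (fK x))// ler_norm.
have [n nK] : exists n, (`|K| / 2 ^+ n) ^+ 2 < e.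
  have : (`|K| / 2 ^+ n) ^+ 2 @[n --> \oo] --> (0 : R).
    rewrite (_ : (fun n => _) = fun n => `|K| ^+ 2 * (4^-1) ^+ n); last first.
      apply/funext => n; rewrite exprMn; congr (_ * _).
      rewrite !exprVn -exprM mulnC exprM; congr ((_ ^+ _)^-1).
      by ring.
    rewrite -[X in _ --> X](mulr0 (`|K| ^+ 2)); apply: cvgMr.
    by apply: cvg_expr; rewrite ger0_norm ?invr_ge0// invf_lt1// ltr1n.
  move=> /cvgrPdist_lt/(_ _ e0)[N _ /(_ N (leqnn N)) /=].
  rewrite sub0r normrN ger0_norm ?sqr_ge0// => h; by exists N.
have [f' [bf' af' ff']] := step n _ _ K0 bf fK'.
exists f'; split => //; apply: le_lt_trans nK.
by apply: N2_le => //; exact: bmeasB.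
Qed.

End CylinderDensity.

(** * Asymptotically invariant functions *)

Lemma fmap_ultra (T U : Type) (f : T -> U) (F : set_system T) :
  UltraFilter F -> UltraFilter (f @ F).
Proof.
move=> FU; split; first exact: fmap_proper_filter.
move=> G GP sFG; apply/seteqP; split => [B GB|]; last exact: sFG.
have [//|FnB] := in_ultra_setVsetC (f @^-1` B) FU.
have GnB : G (~` B) by apply: sFG.
have G0 : G set0 by rewrite -(setICr B); exact: filterI.
by case: (@filter_not_empty _ _ GP G0).
Qed.

Lemma ultra_cvg01 (R : realType) (T : Type) (F : set_system T) (u : T -> R) :
  UltraFilter F -> (forall t, 0 <= u t <= 1) -> cvg (u t @[t --> F]).
Proof.
move=> FU u01; have := @segment_compact R 0 1; rewrite compact_ultra.
move=> /(_ (u @ F) (fmap_ultra u FU)) => -[|l [_ ul]]; last by apply/cvg_ex; exists l.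
suff : F (u @^-1` `[0, 1]) by [].
by apply: filterE => t /=; rewrite in_itv/=; exact: u01.
Qed.

Section SpectralGap.
Context (I : choiceType) d (Y : measurableType d) (R : realType).
Local Notation X := (bernoulli_space I Y).
Context (eta : probability Y R) (mu : probability X R).
Hypothesis mu_prod : is_product_measure eta mu.
Context (Lam : groupType) (act : Lam -> I -> I).
Hypothesis act_action : is_action act.
Local Notation bact := (@bernoulli_act _ _ act d Y).
Local Notation N2 f := (\int[mu]_x f x ^+ 2).

Lemma N2_bact g f : bmeas f -> N2 (fun x => f (bact g x)) = N2 f.
Proof. by move=> bf; exact: (bintegral_bact mu_prod act_action g (bmeasX 2 bf)). Qed.

Lemma indic_act g A : (\1_(act g @` A) : I -> R) = \1_A \o act g^-1%g.
Proof.
apply/funext => i; rewrite !indicE /=; congr (_%:R); congr nat_of_bool.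
apply/idP/idP; rewrite !inE.
  by move=> [j Aj <-]; rewrite (actK act_action).
by move=> Ai; exists (act g^-1%g i); rewrite ?(actVK act_action).
Qed.

(** Moving the set by [g] amounts to translating the function, after which the masses of [f] and of
    its translate are compared by [mass_lip]. The factor 4 bounds the square norm of their sum. *)
Lemma mass_almost_invariant g A J f l : uniq J -> bmeas f -> depends_on J f -> 0 < l ->
  `|mass eta mu (\1_(act g @` A)) J 0 0 f - mass eta mu \1_A J 0 0 f| <=
    (* The proof below works over a list [L] such that both [L] and its image under [act g] contain
       [J]; both masses are widened before the translation is applied. *)
    (l^-1 * N2 (fun x => f (bact g x) - f x) + l * (4 * N2 f)) / 2.
Proof.
move=> uJ bf fJ l0; set L := undup (J ++ map (act g^-1%g) J).
have bfg : bmeas (fun x => f (bact g x)).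
  by apply: (bmeas_comp _ bf); exact: measurable_bact.
have find i : i \notin J -> indep i f by exact: depends_on_indep.
have uL : uniq L by exact: undup_uniq.
have widen chi K : uniq K -> {subset J <= K} ->
    mass eta mu chi K 0 0 f = mass eta mu chi J 0 0 f.
  by move=> uK JK; exact: mass_widen.
rewrite -(widen _ (map (act g) L)); last 2 first.
  by rewrite map_inj_uniq//; exact: can_inj (actK act_action g).
  move=> i iJ; apply/mapP; exists (act g^-1%g i); last by rewrite actVK.
  by rewrite mem_undup mem_cat map_f ?orbT.
rewrite indic_act -(mass_bact mu_prod act_action)//.
rewrite -(widen _ L)//; last first.
  by move=> i iJ; rewrite mem_undup mem_cat iJ.
apply: le_trans (mass_lip mu_prod _ _ _ bfg bf l0) _ => //.
- by move=> i; rewrite indicE; case: (_ \in _); rewrite ?lexx ler01.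
- by rewrite lexx.
- rewrite ler_pM2r ?invr_gt0// lerD2l ler_pM2l//.
  by apply: le_trans (N2D _ bfg bf) _; rewrite N2_bact//; lra.
Qed.

Section Mean.
Variables (k : nat -> X -> R) (J : nat -> seq I) (a C : R).
Hypotheses (a0 : 0 < a) (bk : forall n, bmeas (k n)) (uJ : forall n, uniq (J n)).
Hypotheses (kJ : forall n, depends_on (J n) (k n)).
Hypotheses (kmean : forall n, \int[mu]_x k n x = 0).
Hypotheses (ka : forall n, a <= N2 (k n)) (kC : forall n, N2 (k n) <= C).
Hypothesis (kinv : forall g, N2 (fun x => k n (bact g x) - k n x) @[n --> \oo] --> (0 : R)).

Lemma almost_invariant_mean : exists m : set I -> R, invariant_mean act m.
Proof.
have k0 n : 0 < N2 (k n) by exact: lt_le_trans (ka n).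
pose m n A := mass eta mu \1_A (J n) 0 0 (k n) / N2 (k n).
have mge0 n A : 0 <= m n A.
  by apply: divr_ge0; [apply: mass_ge0 => // i; rewrite indicE|exact: ltW].
have mT n : m n setT = 1.
  (* The mean of [k n] is 0, so the lost piece over the empty set vanishes and the total mass is
     exactly 1. *)
  rewrite /m indicT mass_total// (E_seq_constant mu_prod (bk n))//.
  - by rewrite kmean expr0n/= bintegral_cst subr0 divff ?gt_eqF.
  - by move=> i; exact: depends_on_indep (@kJ n).
  - exact: kJ.
have mU n A B : A `&` B = set0 -> m n (A `|` B) = m n A + m n B.
  move=> AB; rewrite /m -mulrDl -massD addr0; congr (mass _ _ _ _ _ _ _ / _).
  apply/funext => i; rewrite !indicE in_setU.
  have [iA|iA] := boolP (i \in A); have [iB|iB] := boolP (i \in B);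
    rewrite ?addr0 ?add0r//.
  have : (A `&` B) i by split; exact: set_mem.
  by rewrite AB.
have mle1 n A : m n A <= 1.
  by rewrite -(mT n) -(setUv A) mU ?setICr// lerDl.
have m01 n A : 0 <= m n A <= 1 by rewrite mge0 mle1.
have minv g A : m n (act g @` A) - m n A @[n --> \oo] --> (0 : R).
  apply/cvgrPdist_le => e e0.
  have C0 : 0 < C by exact: lt_le_trans (k0 0%N) (kC 0%N).
  (* With this [l] the term l * 4C equals e * a. The other term is at most e * a once the translates
     differ by at most e * a * l. Half of the sum, divided by a norm that is at least [a], is at
     most [e]. *)
  pose l := e * a / (4 * C).
  have l0 : 0 < l by apply: divr_gt0; exact: mulr_gt0.
  have eal : 0 < e * a * l by apply: mulr_gt0 => //; exact: mulr_gt0.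
  have /cvgrPdist_le/(_ _ eal) := kinv g; apply: filterS => n /=.
  rewrite !sub0r !normrN ger0_norm ?bintegral_sqr_ge0// => kn.
  rewrite -mulrBl normrM normfV (gtr0_norm (k0 n)) ler_pdivrMr//.
  apply: le_trans (mass_almost_invariant g A (uJ n) (bk n) (@kJ n) l0) _.
  apply: (@le_trans _ _ (e * a)); last by rewrite ler_pM2l.
  have h1 : l^-1 * N2 (fun x => k n (bact g x) - k n x) <= e * a.
    by rewrite mulrC ler_pdivrMr.
  have h2 : l * (4 * N2 (k n)) <= e * a.
    apply: (@le_trans _ _ (l * (4 * C))); first by rewrite ler_pM2l// ler_pM2l.
    by rewrite /l divfK// gt_eqF// mulr_gt0.
  by lra.
(* Along one ultrafilter the masses of all subsets of [I] converge at once, which is what finite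
   additivity of the limit requires. *)
have [U [UU sU]] := ultraFilterLemma (eventually_filter : ProperFilter (\oo : set_system nat)).
have mcvg A : m n A @[n --> U] --> lim (m n A @[n --> U]).
  by apply: (ultra_cvg01 UU) => n; exact: m01.
exists (fun A => lim (m n A @[n --> U])); split.
- move=> A; apply: (limr_ge (mcvg A)); exact: nearW.
- by apply: cvg_lim => //; under eq_fun do rewrite mT; exact: cvg_cst.
- move=> A B AB; apply: cvg_lim => //; under eq_fun do rewrite mU//.
  by apply: cvgD.
- move=> g A; apply: cvg_lim => //.
  rewrite -[X in _ --> X](add0r (lim (m n A @[n --> U]))).
  rewrite (_ : (fun n => _) = fun n => (m n (act g @` A) - m n A) + m n A); last first.
    by apply/funext => n; rewrite subrK.
  by apply: cvgD => //; apply: cvg_trans (minv g A); apply: cvg_app => B; exact: sU.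
Qed.

End Mean.

Hypothesis no_mean : ~ exists m : set I -> R, invariant_mean act m.

(** Spectral gap. If the variances do not tend to 0, then a sequence of indices [s n] with variance
    at least [e], approximated by centred functions of finitely many coordinates, satisfies the
    assumptions of [almost_invariant_mean]. *)
Lemma almost_invariant_variance (f : nat -> X -> R) (C : R) :
  (forall n, bmeas (f n)) -> (forall n, N2 (f n) <= C) ->
  (forall g, N2 (fun x => f n (bact g x) - f n x) @[n --> \oo] --> (0 : R)) ->
  N2 (fun x => f n x - \int[mu]_x f n x) @[n --> \oo] --> (0 : R).
Proof.
move=> bf fC finv; apply: contrapT => nv; apply: no_mean.
have [e e0 He] : exists2 e, 0 < e & forall N, exists2 n, (N <= n)%N &
    e <= N2 (fun x => f n x - \int[mu]_x f n x).
  apply: contrapT => H; apply: nv; apply/cvgrPdist_lt => e e0.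
  apply: contrapT => He; apply: H; exists e => // N.
  apply: contrapT => HN; apply: He; exists N => // n /= Nn.
  rewrite sub0r normrN ger0_norm ?bintegral_sqr_ge0// ltNge.
  by apply/negP => en; apply: HN; exists n.
have [s Hs] := choice (fun N => let: ex_intro2 n h1 h2 := He N in ex_intro (fun n =>
  (N <= n)%N /\ e <= N2 (fun x => f n x - \int[mu]_x f n x)) n (conj h1 h2)).
(* The bound e / 4 keeps the variance of the approximation at least e / 4; the bound 1 / (n + 1)
   preserves asymptotic invariance. *)
have H n : exists p : seq I * (X -> R), [/\ uniq p.1, bmeas p.2, depends_on p.1 p.2 &
    N2 (fun x => f (s n) x - p.2 x) < Num.min (e / 4) n.+1%:R^-1].
  have [|J [h [? ? ? ?]]] := bmeas_approximable mu (bf (s n)) (e := Num.min (e / 4) n.+1%:R^-1).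
    by rewrite lt_min divr_gt0//= invr_gt0.
  by exists (J, h).
have [p Hp] := choice H.
pose h n := (p n).2; pose c n := \int[mu]_x h n x.
have bh n : bmeas (h n) by case: (Hp n).
have fh n : N2 (fun x => f (s n) x - h n x) <= e / 4.
  by case: (Hp n) => _ _ _; rewrite lt_min => /andP[/ltW].
have fh' n : N2 (fun x => f (s n) x - h n x) <= n.+1%:R^-1.
  by case: (Hp n) => _ _ _; rewrite lt_min => /andP[_ /ltW].
have bhc n : bmeas (fun x => h n x - c n) by apply: bmeasB => //; exact: bmeas_cst.
apply: (@almost_invariant_mean (fun n x => h n x - c n) (fun n => (p n).1) (e / 4)
   (2 * (e / 4) + 2 * C)) => //.
- by rewrite divr_gt0.
- by move=> n; case: (Hp n).
- by move=> n x x' xx'; congr (_ - _); case: (Hp n) => _ _ + _; apply.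
- by move=> n; rewrite bintegralB//; [rewrite bintegral_cst subrr|exact: bmeas_cst].
- move=> n; have [_ en] := Hs n.
  have aux (x y z w : R) : e <= x -> x <= y -> y <= 2 * z + 2 * w -> z <= e / 4 ->
    e / 4 <= w by lra.
  have := N2_trans mu (bf (s n)) (bh n) (bmeas_cst _ (c n)).
  by move=> t; exact: aux en (variance_le mu (c n) (bf (s n))) t (fh n).
- move=> n; apply: le_trans (variance_le mu 0 (bh n)) _.
  under eq_Rintegral do rewrite subr0.
  have -> : h n = fun x => (h n x - f (s n) x) + f (s n) x.
    by apply/funext => x; rewrite subrK.
  apply: le_trans (N2D _ (bmeasB (bh n) (bf (s n))) (bf (s n))) _.
  by rewrite N2_dist; apply: lerD; rewrite ler_pM2l.
- move=> g.
  (* Two uses of [N2_trans], through the translate of [f (s n)] and then [f (s n)], give 2 + 4 = 6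
     approximation errors and 4 times the defect of invariance. *)
  have key n : N2 (fun x => h n (bact g x) - c n - (h n x - c n)) <=
      6 * n.+1%:R^-1 + 4 * N2 (fun x => f (s n) (bact g x) - f (s n) x).
    have mg : measurable_fun setT (bact g) by exact: measurable_bact.
    have bhg : bmeas (fun x => h n (bact g x)) by exact: (bmeas_comp mg (bh n)).
    have bfg : bmeas (fun x => f (s n) (bact g x)) by exact: (bmeas_comp mg (bf (s n))).
    rewrite (_ : (fun x => (h n (bact g x) - c n - (h n x - c n)) ^+ 2) =
      fun x => (h n (bact g x) - h n x) ^+ 2); last by apply/funext => x; ring.
    have t1 := N2_trans mu bhg bfg (bh n).
    have t2 := N2_trans mu bfg (bf (s n)) (bh n).
    have e1 : N2 (fun x => h n (bact g x) - f (s n) (bact g x)) <= n.+1%:R^-1.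
      by rewrite (N2_bact g (bmeasB (bh n) (bf (s n)))) N2_dist.
    have aux (x y z w v u : R) : x <= 2 * y + 2 * z -> z <= 2 * w + 2 * v ->
      y <= u -> v <= u -> x <= 6 * u + 4 * w by lra.
    exact: aux t1 t2 e1 (fh' n).
  apply: (@squeeze_cvgr _ _ _ _ (fun=> 0) (fun n => 6 * n.+1%:R^-1 +
      4 * N2 (fun x => f (s n) (bact g x) - f (s n) x))).
  + by apply: nearW => n; rewrite bintegral_sqr_ge0 key.
  + exact: cvg_cst.
  + rewrite -[X in _ --> X](addr0 0) -[X in _ --> X + _](mulr0 6) -[X in _ --> _ + X](mulr0 4).
    apply: cvgD; apply: cvgMr; first exact: cvg_harmonic.
    apply: (cvg_comp _ _ _ (finv g)).
    apply/cvgnyPge => N; exists N => // n /= Nn.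
    by apply: leq_trans Nn _; case: (Hs n).
Qed.

End SpectralGap.

(** * Radon-Nikodym derivative of an enumerated relation *)

Section SetFunctionIntegral.
Context d (T : measurableType d) (R : realType).
Local Open Scope ereal_scope.
Import HBNNSimple.

(* [eq_measure_integral] for set functions that need not be measures. *)
Lemma eq_setfun_integral (m1 m2 : set T -> \bar R) (D : set T) (f : T -> \bar R) :
  (forall A, measurable A -> A `<=` D -> m1 A = m2 A) ->
  \int[m1]_(x in D) f x = \int[m2]_(x in D) f x.
Proof.
move=> m12; rewrite /integral !funepos_restrict !funeneg_restrict.
have sE (g : T -> \bar R) (h : {nnsfun T >-> R}) :
    (forall x, (h x)%:E <= (g \_ D) x) -> sintegral m1 h = sintegral m2 h.
  move=> hg; apply: eq_fsbigr => r _.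
  have [->|r0] := eqVneq r 0%R; first by rewrite !mul0e.
  rewrite m12// => t /= ht; apply: contrapT => tD.
  have := hg t; rewrite patchE memNset// ht lee_fin => rle0.
  by move: r0; rewrite eq_le rle0 -ht; have -> : (0 <= h t)%R by exact: fun_ge0.
by congr (ereal_sup _ - ereal_sup _); apply/seteqP; split => _ [h hg <-];
  exists h => //; rewrite (sE _ _ hg).
Qed.

Lemma integral_indicM (m : set T -> \bar R) (D : set T) (f : T -> \bar R) :
  \int[m]_x ((\1_D x)%:E * f x) = \int[m]_(x in D) f x.
Proof.
rewrite /integral; congr (ereal_sup _ - ereal_sup _); congr (image _ _);
  congr (mkset _); apply/funext => h; apply: eq_forall => x; congr (_ <= _);
  rewrite ?funeposE ?funenegE !patchE in_setT indicE;
  by case: ifPn; rewrite ?mul1e ?mul0e.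
Qed.

End SetFunctionIntegral.

Section Graph.
Context d (X : measurableType d) (R : realType) (mu : probability X R).
Hypothesis mdiag : measurable [set p : X * X | p.1 = p.2].
Local Open Scope ereal_scope.

Definition graph (theta : X -> X) := [set p : X * X | p.2 = theta p.1].

Lemma measurable_graph theta : measurable_fun setT theta -> measurable (graph theta).
Proof.
move=> mt.
have m : measurable_fun setT (fun p : X * X => (p.2, theta p.1)).
  by apply: measurable_fun_pair => //; exact: measurableT_comp.
by rewrite -[graph _]setTI; exact: (m measurableT _ mdiag).
Qed.

Lemma counting_sub1 (A : set X) a : A `<=` [set a] -> counting A = (\1_A a)%:E :> \bar R.
Proof.
move=> Aa; rewrite indicE /counting; have [aA|aA] := boolP (a \in A).
  have -> : A = [set a].
    by apply/seteqP; split => // _ ->; exact: set_mem.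
  by rewrite asboolT; [rewrite fset_set1 finmap.cardfs1|exact: finite_set1].
rewrite (_ : A = set0); first by rewrite asboolT; [rewrite fset_set0|exact: finite_set0].
by apply/seteqP; split => // x Ax; move: aA; rewrite -(Aa _ Ax) (mem_set Ax).
Qed.

Section Bijection.
Variables theta theta' : X -> X.
Hypotheses (tK : cancel theta theta') (t'K : cancel theta' theta).
Hypotheses (mt : measurable_fun setT theta) (mt' : measurable_fun setT theta').

Lemma measurable_left_pre W : measurable W -> measurable [set x | W (x, theta x)].
Proof.
move=> mW; rewrite -[X in measurable X]setTI.
have m : measurable_fun setT (fun x => (x, theta x)) by apply: measurable_fun_pair.
exact: (m measurableT _ mW).
Qed.

Lemma measurable_right_pre W : measurable W -> measurable [set y | W (theta' y, y)].
Proof.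
move=> mW; rewrite -[X in measurable X]setTI.
have m : measurable_fun setT (fun y => (theta' y, y)) by apply: measurable_fun_pair.
exact: (m measurableT _ mW).
Qed.

Lemma counting_xsection W x : W `<=` graph theta ->
  counting (xsection W x) = (\1_[set x | W (x, theta x)] x)%:E :> \bar R.
Proof.
move=> Wg; rewrite (@counting_sub1 _ (theta x)).
  rewrite !indicE; congr (_%:R%:E); congr nat_of_bool.
  by apply/idP/idP; rewrite !inE /xsection /= ?inE.
by move=> y; rewrite /xsection /= inE => /Wg.
Qed.

Lemma counting_ysection W y : W `<=` graph theta ->
  counting (ysection W y) = (\1_[set y | W (theta' y, y)] y)%:E :> \bar R.
Proof.
move=> Wg; rewrite (@counting_sub1 _ (theta' y)).
  rewrite !indicE; congr (_%:R%:E); congr nat_of_bool.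
  by apply/idP/idP; rewrite !inE /ysection /= ?inE.
by move=> x; rewrite /ysection /= inE => /Wg yx; rewrite (_ : y = theta x) ?tK.
Qed.

Lemma mu_left_graph W : measurable W -> W `<=` graph theta ->
  mu_left mu W = mu [set x | W (x, theta x)].
Proof.
move=> mW Wg; rewrite /mu_left.
under eq_integral do rewrite counting_xsection//.
by rewrite integral_indic ?setIT//; exact: measurable_left_pre.
Qed.

Lemma mu_right_graph W : measurable W -> W `<=` graph theta ->
  mu_right mu W = mu [set y | W (theta' y, y)].
Proof.
move=> mW Wg; rewrite /mu_right.
under eq_integral do rewrite counting_ysection//.
by rewrite integral_indic ?setIT//; exact: measurable_right_pre.
Qed.

(** By the change of variables below, [omega (theta' y)] is the density at [y] of the image of [mu]
    under [theta]. Thus [omega x] is the Radon-Nikodym derivative at the point (x, theta x) of the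
    graph. *)
Variable omega : X -> R.
Hypotheses (momega : measurable_fun setT omega) (omega0 : forall x, (0 < omega x)%R).
Hypothesis change_var : forall k : X -> \bar R, measurable_fun setT k ->
  (forall x, 0 <= k x) ->
  \int[mu]_x k (theta x) = \int[mu]_y (k y * (omega (theta' y))%:E).

Lemma preimage_null N : measurable N -> mu N = 0 -> mu (theta @^-1` N) = 0.
Proof.
move=> mN N0.
have mtN : measurable (theta @^-1` N) by have := mt measurableT mN; rewrite setTI.
transitivity (\int[mu]_x (\1_N (theta x))%:E).
  by rewrite -[RHS]/(\int[mu]_x (\1_(theta @^-1` N) x)%:E) integral_indic ?setIT.
rewrite (change_var (k := fun x => (\1_N x)%:E)); last 2 first.
- by apply/measurable_EFinP; exact: measurable_indic.
- by move=> x; rewrite lee_fin.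
rewrite integral_indicM null_set_integral//.
by apply/measurable_funTS/measurable_EFinP; exact: measurableT_comp.
Qed.

Lemma ae_comp (Q : X -> Prop) :
  {ae mu, forall x, Q x} -> {ae mu, forall x, Q (theta x)}.
Proof.
move=> [N [mN N0 QN]]; exists (theta @^-1` N); split.
- by have := mt measurableT mN; rewrite setTI.
- exact: preimage_null.
- by move=> x Qx; exact: QN.
Qed.

(** The density of the image measure has integral 1, so its integral over small sets is small. This
    is a uniform form of nonsingularity, fit for convergence in measure. *)
Lemma preimage_abs_continuous (e : R) : (0 < e)%R -> exists r : R, (0 < r)%R /\
  forall B, measurable B -> mu B < r%:E -> mu (theta @^-1` B) < e%:E.
Proof.
move=> e0.
have mo : measurable_fun setT (fun y => omega (theta' y)) by exact: measurableT_comp.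
have pre B : measurable B ->
    mu (theta @^-1` B) = \int[mu]_(y in B) (omega (theta' y))%:E.
  move=> mB; have mtB : measurable (theta @^-1` B) by have := mt measurableT mB; rewrite setTI.
  transitivity (\int[mu]_x (\1_B (theta x))%:E).
    by rewrite -[RHS]/(\int[mu]_x (\1_(theta @^-1` B) x)%:E) integral_indic ?setIT.
  rewrite (change_var (k := fun x => (\1_B x)%:E)); last 2 first.
  - by apply/measurable_EFinP; exact: measurable_indic.
  - by move=> x; rewrite lee_fin.
  by rewrite integral_indicM.
have oi : mu.-integrable setT (EFin \o (fun y => omega (theta' y))).
  apply/integrableP; split; first exact/measurable_EFinP.
  under eq_integral do rewrite /= gtr0_norm//.
  by rewrite -pre// preimage_setT (le_lt_trans (probability_le1 _ _))// ?ltry.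
have [r [r0 Hr]] := integral_normr_continuous oi e0.
exists r; split => // B mB Br; have := Hr B mB Br.
rewrite -lte_fin /Rintegral fineK.
  by under eq_integral do rewrite gtr0_norm//; rewrite -pre.
under eq_integral do rewrite gtr0_norm//.
by rewrite -pre// fin_num_measure//; have := mt measurableT mB; rewrite setTI.
Qed.

Let k y := (theta' y, y).
Let mk : measurable_fun setT k.
Proof. by apply: measurable_fun_pair. Qed.

Lemma integral_mu_right_graph W (f : X * X -> \bar R) :
  measurable W -> W `<=` graph theta -> measurable_fun W f ->
  (forall p, W p -> 0 <= f p) ->
  \int[mu_right mu]_(p in W) f p =
  \int[mu]_(y in [set y | W (theta' y, y)]) f (theta' y, y).
Proof.
move=> mW Wg mf f0.
rewrite (eq_setfun_integral (m2 := pushforward mu k)).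
  by rewrite (ge0_integral_pushforward mk)// => p /set_mem; exact: f0.
move=> A mA AW; rewrite mu_right_graph//; exact: subset_trans AW Wg.
Qed.

Lemma mu_left_pre W : measurable W -> mu [set x | W (x, theta x)] =
  \int[mu]_(y in [set y | W (theta' y, y)]) (omega (theta' y))%:E.
Proof.
move=> mW; have mV := measurable_right_pre mW.
rewrite -integral_indicM -(change_var (k := fun y => (\1_[set y | W (theta' y, y)] y)%:E)).
- have mV' := measurable_left_pre mW.
  transitivity (\int[mu]_x (\1_[set x | W (x, theta x)] x)%:E).
    by rewrite integral_indic ?setIT.
  apply: eq_integral => x _; rewrite !indicE; congr (_%:R%:E); congr nat_of_bool.
  by apply/idP/idP; rewrite !inE /= tK.
- by apply/measurable_EFinP; exact: measurable_indic.
- by move=> x; rewrite lee_fin.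
Qed.

(** Testing the derivative on the parts of the graph over measurable sets [B] of second coordinates
    shows that [delta] and [omega], read at the second coordinate, have equal integrals over every
    [B]. They agree a.e. there, and [ae_comp] moves this back to the first coordinate. *)
Lemma RN_unique (E : set (X * X)) (delta : X * X -> R) :
  measurable E -> graph theta `<=` E -> is_RN_derivative mu E delta ->
  {ae mu, forall x, delta (x, theta x) = omega x}.
Proof.
move=> mE gE [mdelta delta0 RN].
have mg1 : measurable_fun setT (fun y => (delta (k y))%:E).
  apply/measurable_EFinP; apply: (measurable_comp mE _ mdelta mk).
  by move=> _ [y _ <-]; apply: gE; rewrite /graph /= t'K.
have mg2 : measurable_fun setT (fun y => (omega (theta' y))%:E).
  by apply/measurable_EFinP; exact: measurableT_comp.
have eqB B : measurable B ->
    \int[mu]_(y in B) (omega (theta' y))%:E = \int[mu]_(y in B) (delta (k y))%:E.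
  move=> mB; pose W := graph theta `&` [set p | B p.2].
  have mW : measurable W.
    apply: measurableI; first exact: measurable_graph.
    have m2 : measurable_fun setT (@snd X X) by exact: measurable_snd.
    by have := m2 measurableT B mB; rewrite setTI.
  have WB : [set y | W (theta' y, y)] = B.
    by apply/seteqP; split => y /=; [case|rewrite /W /graph /= t'K].
  have Wg : W `<=` graph theta by move=> p [].
  have := RN W mW (subset_trans Wg gE).
  rewrite mu_left_graph// mu_left_pre// integral_mu_right_graph//; last 2 first.
  - apply/measurable_EFinP; apply: measurable_funS mdelta => //.
    exact: subset_trans Wg gE.
  - by move=> p /Wg/gE/delta0; rewrite lee_fin; exact: ltW.
  by rewrite WB.
have : {ae mu, forall y, setT y -> (omega (theta' y))%:E = (delta (k y))%:E}.
  apply: integral_ae_eq => //; last by move=> B _ mB; exact: eqB.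
  apply/integrableP; split => //.
  under eq_integral do rewrite gee0_abs ?lee_fin ?ltW//.
  have := mu_left_pre (@measurableT _ (X * X)%type).
  rewrite (_ : [set y | _] = setT) => [<-|]; last by apply/seteqP.
  by apply: le_lt_trans (probability_le1 _ _) _; rewrite ?ltry.
move=> /ae_comp; apply: filterS => x /(_ I).
by rewrite /k tK => -[].
Qed.

End Bijection.

Section Enumerated.
Variables theta theta' : nat -> X -> X.
Hypotheses (tK : forall n, cancel (theta n) (theta' n)).
Hypotheses (t'K : forall n, cancel (theta' n) (theta n)).
Hypotheses (mt : forall n, measurable_fun setT (theta n)).
Hypotheses (mt' : forall n, measurable_fun setT (theta' n)).
Variable omega : nat -> X -> R.
Hypotheses (momega : forall n, measurable_fun setT (omega n)).
Hypotheses (omega0 : forall n x, (0 < omega n x)%R).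
Hypothesis change_var : forall n (k : X -> \bar R), measurable_fun setT k ->
  (forall x, 0 <= k x) ->
  \int[mu]_x k (theta n x) = \int[mu]_y (k y * (omega n (theta' n y))%:E).

Let E : set (X * X) := \bigcup_n graph (theta n).

(** Different indices may act equally at some points, so the graphs overlap; disjoint pieces turn
    [mu_left] and [mu_right] into countable sums. *)
Definition piece := seqDU (fun n => graph (theta n)).

Lemma measurable_piece n : measurable (piece n).
Proof.
apply: measurableD; first exact: measurable_graph.
by apply: bigsetU_measurable => i _; exact: measurable_graph.
Qed.

Lemma measurable_bigcup_graph : measurable E.
Proof. by apply: bigcupT_measurable => n; exact: measurable_graph. Qed.

Lemma piece_graph n : piece n `<=` graph (theta n).
Proof. exact: subset_seqDU. Qed.

Lemma bigcup_piece : E = \bigcup_n piece n.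
Proof. exact: seqDU_bigcup_eq. Qed.

Lemma piece_disj m n p : piece m p -> piece n p -> m = n.
Proof.
move=> pm pn; have := trivIset_seqDU (fun n => graph (theta n)).
by move=> /(_ m n Logic.I Logic.I); apply; exists p.
Qed.

Lemma setI_piece W : W `<=` E -> W = \bigcup_n (W `&` piece n).
Proof. by move=> WE; rewrite -setI_bigcupr -bigcup_piece setIidl. Qed.

Lemma trivIset_piece W : trivIset setT (fun n => W `&` piece n).
Proof. by move=> m n _ _ [p [[_ pm] [_ pn]]]; exact: piece_disj pm pn. Qed.

Lemma counting_xsection_series W x : measurable W -> W `<=` E ->
  counting (xsection W x) =
  \sum_(n <oo) (\1_[set x | (W `&` piece n) (x, theta n x)] x)%:E :> \bar R.
Proof.
move=> mW WE; have mWp n : measurable (W `&` piece n).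
  by apply: measurableI => //; exact: measurable_piece.
have Wg n : W `&` piece n `<=` graph (theta n) by move=> p [_ /piece_graph].
rewrite {1}(setI_piece WE) xsection_bigcup measure_semi_bigcup//.
- by apply: eq_eseriesr => n _; exact: (counting_xsection _ (Wg n)).
- by move=> n; exact: measurable_xsection.
- by apply: trivIset_xsection; exact: trivIset_piece.
- by apply: bigcupT_measurable => n; exact: measurable_xsection.
Qed.

Let measurable_left_piece W n : measurable W ->
  measurable_fun setT (fun x => (\1_[set x | (W `&` piece n) (x, theta n x)] x)%:E : \bar R).
Proof.
move=> mW; apply/measurable_EFinP/measurable_indic/measurable_left_pre => //.
by apply: measurableI => //; exact: measurable_piece.
Qed.

Lemma measurable_counting_xsection W : measurable W -> W `<=` E ->
  measurable_fun setT (fun x => counting (xsection W x) : \bar R).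
Proof.
move=> mW WE; under eq_fun do rewrite counting_xsection_series//.
apply: ge0_emeasurable_sum => [n x _ _|n _]; first by rewrite lee_fin.
exact: measurable_left_piece.
Qed.

Lemma mu_left_series W : measurable W -> W `<=` E ->
  mu_left mu W = \sum_(n <oo) mu [set x | (W `&` piece n) (x, theta n x)].
Proof.
move=> mW WE; rewrite /mu_left.
under eq_integral do rewrite counting_xsection_series//.
rewrite integral_nneseries//; last first.
  by move=> n; exact: measurable_left_piece.
apply: eq_eseriesr => n _; rewrite integral_indic ?setIT//.
apply: measurable_left_pre => //.
by apply: measurableI => //; exact: measurable_piece.
Qed.

Lemma mu_left_ae_eq W W' : measurable W -> measurable W' -> W `<=` E -> W' `<=` E ->
  {ae mu, forall x, forall y, E (x, y) -> (W (x, y) <-> W' (x, y))} ->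
  mu_left mu W = mu_left mu W'.
Proof.
move=> mW mW' WE W'E WW'; apply: ge0_ae_eq_integral => //.
- exact: measurable_counting_xsection.
- exact: measurable_counting_xsection.
- apply: filterS WW' => x h _; congr counting; apply/seteqP.
  by split => y; rewrite /xsection /= !inE => Wy; apply/h => //; [exact: WE|exact: W'E].
Qed.

(** A genuine measure agreeing with [mu_left] on [E] gives access to subadditivity and to continuity
    along monotone sequences. It is the sum of the images of [mu] on the pieces. *)
Lemma mu_left_measure : exists lam : {measure set (X * X) -> \bar R},
  forall W, measurable W -> W `<=` E -> mu_left mu W = lam W.
Proof.
pose k n x := (x, theta n x).
have mk n : measurable_fun setT (k n) by apply: measurable_fun_pair.
pose P0 n : {measure set (X * X) -> \bar R} := pushforward mu (k n).
pose P n : {measure set (X * X) -> \bar R} := mrestr (P0 mk n) (measurable_piece n).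
by exists (mseries P 0) => W mW WE; rewrite mu_left_series.
Qed.

Lemma mu_right_series W : measurable W -> W `<=` E ->
  mu_right mu W = \sum_(n <oo) mu [set y | (W `&` piece n) (theta' n y, y)].
Proof.
move=> mW WE; have mWp n : measurable (W `&` piece n).
  by apply: measurableI => //; exact: measurable_piece.
have Wg n : W `&` piece n `<=` graph (theta n) by move=> p [_ /piece_graph].
transitivity (\int[mu]_y (\sum_(n <oo) counting (ysection (W `&` piece n) y))).
  apply: eq_integral => y _; rewrite {1}(setI_piece WE).
  rewrite ysection_bigcup measure_semi_bigcup//.
  - by move=> n; exact: measurable_ysection.
  - by apply: trivIset_ysection; exact: trivIset_piece.
  - by apply: bigcupT_measurable => n; exact: measurable_ysection.
rewrite integral_nneseries//.
  by apply: eq_eseriesr => n _; rewrite -(mu_right_graph (tK n) (mt' n)).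
move=> n; under eq_fun do rewrite (counting_ysection (tK n) _ (Wg n)).
by apply/measurable_EFinP/measurable_indic/measurable_right_pre.
Qed.

(** At most one piece contains [p]. Off all the pieces the index is 0 by default, so the value is
    positive everywhere. *)
Definition RN p : R := omega (xget 0%N [set n | piece n p]) p.1.

Lemma RN_piece n p : piece n p -> RN p = omega n p.1.
Proof.
move=> pn; rewrite /RN; case: xgetP => [m -> pm|/(_ n)//].
by rewrite (piece_disj pm pn).
Qed.

Lemma RN_is_RN : is_RN_derivative mu E RN.
Proof.
have mRN n : measurable_fun (piece n) RN.
  apply: (eq_measurable_fun (omega n \o fst)).
    by move=> p /set_mem pn /=; rewrite (RN_piece pn).
  apply: measurable_funTS; apply: measurableT_comp => //.
have mR : measurable_fun E RN.
  rewrite bigcup_piece; apply/measurable_fun_bigcup => // n; exact: measurable_piece.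
split => // [p _|W mW WE]; first exact: omega0.
pose k n y := (theta' n y, y).
have mk n : measurable_fun setT (k n) by apply: measurable_fun_pair.
pose P0 n : {measure set (X * X) -> \bar R} := pushforward mu (k n).
pose P n : {measure set (X * X) -> \bar R} := mrestr (P0 mk n) (measurable_piece n).
have mWp n : measurable (W `&` piece n).
  by apply: measurableI => //; exact: measurable_piece.
have Wg n : W `&` piece n `<=` graph (theta n) by move=> p [_ /piece_graph].
have WpE n : W `&` piece n `<=` E by move=> p [/WE].
have nuE A : measurable A -> A `<=` E -> mu_right mu A = mseries P 0 A.
  by move=> mA AE; rewrite mu_right_series.
have RN0 p : 0 <= (RN p)%:E by rewrite lee_fin ltW// /RN.
(* [mu_right] is replaced by a measure that agrees with it on subsets of [E], so that the integral
   can be cut along the pieces; on each piece the replacement is undone and [mu_left_pre]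
   applies. *)
rewrite (eq_setfun_integral (m2 := mseries P 0)); last first.
  by move=> A mA AW; apply: nuE => //; exact: subset_trans WE.
rewrite {2}(setI_piece WE) ge0_integral_bigcup//; last 2 first.
- rewrite -(setI_piece WE); apply/measurable_EFinP; apply: measurable_funS mR => //;
  exact: measurable_bigcup_graph.
- exact: trivIset_piece.
rewrite mu_left_series//; apply: eq_eseriesr => n _.
rewrite -(eq_setfun_integral (m1 := mu_right mu)); last first.
  by move=> A mA AW; apply: nuE => //; exact: subset_trans (WpE n).
rewrite (integral_mu_right_graph (tK n) (mt' n))//; last first.
  by apply/measurable_EFinP; apply: measurable_funS (mRN n) => //;
    exact: measurable_piece.
rewrite (mu_left_pre (tK n) (mt n) (mt' n) (@change_var n))//.
by apply: eq_integral => y /set_mem [_ pn]; rewrite (RN_piece pn).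
Qed.

End Enumerated.

End Graph.

(** * The Bernoulli relation as an orbit relation *)

Section PosR.
Context (R : realType).
Local Notation Y := (posR R * bool)%type.

Lemma measurable_posR_val : measurable_fun setT (@posR_val R).
Proof. by move=> _ B mB; exists B. Qed.

Lemma posR_val_gt0 (v : posR R) : 0 < (v : R).
Proof. exact: posR_gt0. Qed.

Lemma measurable_diagY : measurable [set p : Y * Y | p.1 = p.2].
Proof.
have m1 : measurable_fun setT (fun p : Y * Y => posR_val p.1.1).
  apply: (measurableT_comp measurable_posR_val).
  by apply: measurableT_comp => //; exact: measurable_fst.
have m2 : measurable_fun setT (fun p : Y * Y => posR_val p.2.1).
  apply: (measurableT_comp measurable_posR_val).
  exact: (measurableT_comp (@measurable_fst _ _ (posR R) bool) measurable_snd).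
have m3 : measurable_fun setT (fun p : Y * Y => p.1.2).
  exact: (measurableT_comp (@measurable_snd _ _ (posR R) bool) measurable_fst).
have m4 : measurable_fun setT (fun p : Y * Y => p.2.2).
  exact: (measurableT_comp (@measurable_snd _ _ (posR R) bool) measurable_snd).
have m5 : measurable_fun setT (fun p : Y * Y => posR_val p.1.1 == posR_val p.2.1).
  exact: measurable_fun_eqr.
rewrite (_ : [set p | _] = (fun p : Y * Y => posR_val p.1.1 == posR_val p.2.1) @^-1` [set true] `&`
   (((fun p : Y * Y => p.1.2) @^-1` [set true] `&` (fun p : Y * Y => p.2.2) @^-1` [set true]) `|`
   ((fun p : Y * Y => p.1.2) @^-1` [set false] `&` (fun p : Y * Y => p.2.2) @^-1` [set false]))).
  apply: measurableI; first by have := m5 measurableT [set true]; rewrite setTI; apply.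
  by apply: measurableU; apply: measurableI;
    [have := m3 measurableT [set true]|have := m4 measurableT [set true]
    |have := m3 measurableT [set false]|have := m4 measurableT [set false]];
    rewrite setTI; apply.
apply/seteqP; split => -[[u b] [v c]] /=.
  by move=> [-> ->]; split; [exact/eqP|case: c; [left|right]].
move=> [/eqP uv bc]; congr (_, _); first exact: val_inj.
by case: bc => -[-> ->].
Qed.

End PosR.

Section CountableProduct.
Context (I : choiceType) d (Y : measurableType d).
Local Notation X := (bernoulli_space I Y).
Hypothesis I_countable : countable [set: I].
Hypothesis mdiagY : measurable [set p : Y * Y | p.1 = p.2].

Lemma measurable_diagX : measurable [set p : X * X | p.1 = p.2].
Proof.
have /countable_injP[f finj] := I_countable.
have injf i j : f i = f j -> i = j by move=> fij; apply: finj; rewrite ?inE.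
rewrite (_ : [set p | _] =
    \bigcap_n [set p : X * X | forall i, f i = n -> p.1 i = p.2 i]); last first.
  apply/seteqP; split => -[x y] /=; first by move=> -> n _ i.
  by move=> h; apply/funext => i; exact: (h (f i) Logic.I).
apply: bigcapT_measurable => n.
have [[i fi]|ni] := pselect (exists i, f i = n); last first.
  rewrite (_ : [set p | _] = setT)//; apply/seteqP; split => // p _ i fi.
  by exfalso; apply: ni; exists i.
rewrite (_ : [set p | _] = setT `&` (fun p : X * X => (p.1 i, p.2 i)) @^-1`
    [set p : Y * Y | p.1 = p.2]).
  have m : measurable_fun setT (fun p : X * X => (p.1 i, p.2 i)).
    apply: measurable_fun_pair.
      exact: (measurableT_comp (measurable_coord i) measurable_fst).
    exact: (measurableT_comp (measurable_coord i) measurable_snd).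
  exact: (m measurableT _ mdiagY).
apply/seteqP; split => -[x y] /=; first by move=> h; split => //; exact: h.
by move=> [_ h] j fj; rewrite (injf j i)// fj.
Qed.

End CountableProduct.

Section Words.
Context (R : realType) (Lam : groupType) (I : choiceType) (act : Lam -> I -> I).
Hypothesis act_action : is_action act.
Local Notation Y := (posR R * bool)%type.
Local Notation X := (bernoulli_space I Y).
Local Notation letter := (I + Lam)%type.
Local Notation E := (bernoulli_rel act (@same_fst (posR R) bool)).

Definition flipY (y : Y) : Y := (y.1, ~~ y.2).

Lemma flipYK : involutive flipY.
Proof. by case=> v b; rewrite /flipY /= negbK. Qed.

Lemma measurable_flipY : measurable_fun setT flipY.
Proof.
apply: measurable_fun_pair; first exact: measurable_fst.
by apply: measurableT_comp => //; exact: measurable_snd.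
Qed.

(* The relation is the orbit relation of the group generated by [Lam] and the
   flips of one bit; elements of that group are represented by words. *)
Definition lact (a : letter) (x : X) : X :=
  match a with
  | inl i => upd i x (flipY (x i))
  | inr g => bernoulli_act act g x
  end.

Definition linv (a : letter) : letter :=
  match a with inl i => inl i | inr g => inr (g^-1)%g end.

(** The weight of [eta] at [y] divided by its weight at the flipped point: [eta] is [xi] on the bit
    [false] and x times [xi] on the bit [true]. *)
Definition bitpow (y : Y) : R := if y.2 then (y.1 : R) else (y.1 : R)^-1.

Definition lom (a : letter) (x : X) : R :=
  match a with inl i => bitpow (x i) | inr _ => 1 end.

Definition wact (w : seq letter) (x : X) : X := foldr lact x w.

Definition winv (w : seq letter) : seq letter := rev (map linv w).

Fixpoint wom (w : seq letter) (x : X) : R :=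
  if w is a :: w' then wom w' x * lom a (wact w' x) else 1.

Lemma linvK : involutive linv.
Proof. by case=> [//|g] /=; rewrite invgK. Qed.

Lemma lactK a : cancel (lact a) (lact (linv a)).
Proof.
case: a => [i|g] x /=; last exact: bactK.
by rewrite updE upd_upd flipYK upd_id.
Qed.

Lemma lactVK a : cancel (lact (linv a)) (lact a).
Proof. by move=> x; rewrite -{1}(linvK a) lactK. Qed.

Lemma wact_cat w1 w2 x : wact (w1 ++ w2) x = wact w1 (wact w2 x).
Proof. exact: foldr_cat. Qed.

Lemma winv_cons a w : winv (a :: w) = winv w ++ [:: linv a].
Proof. by rewrite /winv /= rev_cons cats1. Qed.

Lemma wactK w : cancel (wact w) (wact (winv w)).
Proof.
by elim: w => [//|a w IH] x; rewrite winv_cons wact_cat /= lactK IH.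
Qed.

Lemma wactVK w : cancel (wact (winv w)) (wact w).
Proof.
by elim: w => [//|a w IH] x; rewrite winv_cons wact_cat /= IH lactVK.
Qed.

Lemma wom_cat w1 w2 x : wom (w1 ++ w2) x = wom w2 x * wom w1 (wact w2 x).
Proof.
by elim: w1 => [|a w1 IH] /=; rewrite ?mulr1// IH -mulrA wact_cat.
Qed.

Lemma measurable_lact a : measurable_fun setT (lact a).
Proof.
case: a => [i|g]; last exact: measurable_bact.
apply: measurable_upd_comp => //.
exact: (measurableT_comp measurable_flipY (measurable_coord i)).
Qed.

Lemma measurable_wact w : measurable_fun setT (wact w).
Proof.
elim: w => [|a w IH]; first exact: measurable_id.
exact: (measurableT_comp (measurable_lact a) IH).
Qed.

Lemma measurable_bitpow : measurable_fun setT bitpow.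
Proof.
have m1 : measurable_fun setT (fun y : Y => y.1 : R).
  exact: (measurableT_comp (@measurable_posR_val R) measurable_fst).
apply: measurable_fun_ifT => //.
rewrite (_ : (fun y : Y => _) = fun y => (y.1 : R) `^ (-1)).
  exact: (measurableT_comp (measurable_powR (-1)) m1).
by apply/funext => y; rewrite powR_inv1// ltW// posR_val_gt0.
Qed.

Lemma bitpow_gt0 y : 0 < bitpow y.
Proof. by rewrite /bitpow; case: ifP; rewrite ?invr_gt0 posR_val_gt0. Qed.

Lemma measurable_lom a : measurable_fun setT (lom a).
Proof.
case: a => [i|g]; last exact: measurable_cst.
exact: (measurableT_comp measurable_bitpow (measurable_coord i)).
Qed.

Lemma lom_gt0 a x : 0 < lom a x.
Proof. by case: a => [i|g] //=; exact: bitpow_gt0. Qed.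

Lemma measurable_wom w : measurable_fun setT (wom w).
Proof.
elim: w => [|a w IH]; first exact: measurable_cst.
exact: (measurable_funM IH (measurableT_comp (measurable_lom a) (measurable_wact w))).
Qed.

Lemma wom_gt0 w x : 0 < wom w x.
Proof. by elim: w => [//|a w IH] /=; rewrite mulr_gt0// lom_gt0. Qed.

Lemma wact_flips s x : uniq s ->
  wact (map inl s) x = fun i => if i \in s then flipY (x i) else x i.
Proof.
elim: s => [//|i s IH] /andP[is_ us]; apply/funext => j /=.
rewrite (IH us) /upd inE; case: eqVneq => [->|//]; by rewrite (negPf is_).
Qed.

Lemma bernoulli_relP x y : E (x, y) <-> exists w, y = wact w x.
Proof.
split.
  move=> h; apply: (h [set p | exists w, p.2 = wact w p.1]); split.
    split => [z|z t [w /= ->]|z t u [w1 /= ->] [w2 /= ->]].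
    - by exists [::].
    - by exists (winv w); rewrite /= wactK.
    - by exists (w2 ++ w1); rewrite /= wact_cat.
  move=> [z t] /= [[F [/finite_seqP[s ->] Fs Fn]]|[g /= ->]]; last by exists [:: inr g].
  rewrite /= in Fs Fn.
  (* Since first components agree, it is enough to flip each coordinate where the bits differ,
     once. *)
  exists (map inl [seq i <- undup s | (z i).2 != (t i).2]).
  rewrite wact_flips ?filter_uniq ?undup_uniq//; apply/funext => i.
  rewrite mem_filter mem_undup; have [is_|/negP is_] := boolP (i \in s); last first.
    by rewrite andbF -Fn.
  rewrite andbT; have := Fs i is_; rewrite /same_fst /= /flipY.
  case: (z i) (t i) => a b [a' b'] /= ->.
  by case: b b' => -[].
move=> [w ->]; have [Er Es Et] : is_equivalence E.
  split.
  - by move=> z M [[Mr _ _] _]; exact: Mr.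
  - by move=> z t h M HM; have [[_ Ms _] _] := HM; exact: Ms (h M HM).
  - by move=> z t u h h' M HM; have [[_ _ Mt] _] := HM; exact: Mt (h M HM) (h' M HM).
elim: w => [|a w IH] /=; first exact: Er.
apply: Et IH _; move: (wact w x) => z M [_]; apply.
case: a => [i|g]; [left|right; by exists g].
exists [set i]; split; first exact: finite_set1.
  by move=> _ ->; rewrite /same_fst /= updE.
by move=> j /= /eqP ji; rewrite updN.
Qed.

Hypothesis Lam_countable : countable [set: Lam].
Hypothesis I_countable : countable [set: I].

Lemma word_enum : exists e : nat -> seq letter, forall w, exists n, e n = w.
Proof.
have /countable_injP[f finj] := I_countable.
have /countable_injP[h hinj] := Lam_countable.
pose c (a : letter) : nat + nat := match a with inl i => inl (f i) | inr g => inr (h g) end.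
have cinj : injective c.
  by move=> [i|g] [j|k] //= [] ?; congr (_ _); [apply: finj|apply: hinj]; rewrite ?inE.
pose e n : seq letter := xget [::] [set w | pickle (map c w) = n].
exists e => w; exists (pickle (map c w)).
rewrite /e; case: xgetP => [w' _ /= ew|/(_ w)[]//].
by apply: (inj_map cinj); exact: (pcan_inj pickleK ew).
Qed.

Section ChangeOfVariables.
Context (xi : {finite_measure set (posR R) -> \bar R}) (eta : probability Y R).
Hypothesis etaE : forall f : Y -> \bar R,
  measurable_fun setT f -> (forall y, 0 <= f y)%E ->
  (\int[eta]_y f y = \int[xi]_x f (x, false) +
                        \int[xi]_x ((x : R)%:E * f (x, true)))%E.
Context (mu : probability X R).
Hypothesis mu_prod : is_product_measure eta mu.
Local Open Scope ereal_scope.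

Lemma change_var_flipY (f : Y -> \bar R) : measurable_fun setT f ->
  (forall y, 0 <= f y) ->
  \int[eta]_y f (flipY y) = \int[eta]_y (f y * (bitpow (flipY y))%:E).
Proof.
move=> mf f0.
have mff : measurable_fun setT (fun y => f (flipY y)).
  exact: (measurableT_comp mf measurable_flipY).
have mg : measurable_fun setT (fun y => f y * (bitpow (flipY y))%:E).
  apply: emeasurable_funM => //; apply/measurable_EFinP.
  exact: (measurableT_comp measurable_bitpow measurable_flipY).
rewrite !etaE//; last by move=> y; rewrite mule_ge0// lee_fin ltW// bitpow_gt0.
(* The flip exchanges the two integrals of [etaE]; [bitpow] restores the factor x in one and removes
   it in the other. *)
rewrite addeC; congr (_ + _); apply: eq_integral => x _; rewrite /flipY /bitpow/=.
  by rewrite muleC.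
by rewrite muleCA -EFinM divff ?mule1// gt_eqF// posR_val_gt0.
Qed.

Lemma change_var_lact a (k : X -> \bar R) : measurable_fun setT k ->
  (forall x, 0 <= k x) ->
  \int[mu]_x k (lact a x) = \int[mu]_y (k y * (lom a (lact (linv a) y))%:E).
Proof.
move=> mk k0; case: a => [i|g] /=; last first.
  under [RHS]eq_integral do rewrite mule1.
  exact: (ge0_integral_bact mu_prod act_action).
have mka : measurable_fun setT (fun x => k (lact (inl i) x)).
  exact: (measurableT_comp mk (measurable_lact (inl i))).
have mr : measurable_fun setT (fun x : X => (bitpow (flipY (x i)))%:E).
  apply/measurable_EFinP; apply: (measurableT_comp measurable_bitpow).
  exact: (measurableT_comp measurable_flipY (measurable_coord i)).
rewrite (ge0_integral_upd mu_prod i mka)//.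
under [RHS]eq_integral do rewrite updE.
rewrite [RHS](ge0_integral_upd mu_prod i); last 2 first.
- exact: emeasurable_funM.
- by move=> x; rewrite mule_ge0// lee_fin ltW// bitpow_gt0.
apply: eq_integral => x _ /=.
transitivity (\int[eta]_y k (upd i x (flipY y))).
  by apply: eq_integral => y _; rewrite updE upd_upd.
rewrite (change_var_flipY (f := fun y => k (upd i x y)))//.
  by apply: eq_integral => y _; rewrite updE.
apply: (measurableT_comp mk); apply: measurable_upd_comp => //.
Qed.

Lemma change_var_wact w (k : X -> \bar R) : measurable_fun setT k ->
  (forall x, 0 <= k x) ->
  \int[mu]_x k (wact w x) = \int[mu]_y (k y * (wom w (wact (winv w) y))%:E).
Proof.
elim: w k => [|a w IH] k mk k0 /=; first by under [RHS]eq_integral do rewrite mule1.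
rewrite (IH (fun x => k (lact a x)))//; last first.
  exact: (measurableT_comp mk (measurable_lact a)).
have mm : measurable_fun setT (fun y => (wom w (wact (winv w) y))%:E).
  apply/measurable_EFinP.
  exact: (measurableT_comp (measurable_wom w) (measurable_wact (winv w))).
pose h y := k y * (wom w (wact (winv w) (lact (linv a) y)))%:E.
transitivity (\int[mu]_y h (lact a y)).
  by apply: eq_integral => y _; rewrite /h lactK.
rewrite change_var_lact.
- apply: eq_integral => y _; rewrite /h winv_cons wact_cat /=.
  by rewrite wactVK EFinM muleA.
- apply: emeasurable_funM => //.
  exact: (measurableT_comp mm (measurable_lact (linv a))).
- by move=> x; rewrite mule_ge0// lee_fin ltW// wom_gt0.
Qed.

End ChangeOfVariables.

End Words.

(** * Neighborhoods given by convergence in measure *)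

Section ComplexNorm.
Variable R : realType.
Implicit Types (z w : R[i]).
Local Notation normc := (@Normc.normc R).

Lemma normc_ge0 z : 0 <= normc z.
Proof. by case: z => a b /=; exact: sqrtr_ge0. Qed.

Lemma ler_normcD z w : normc (z + w) <= normc z + normc w.
Proof. exact: (@le_normcD R z w). Qed.

Lemma normc_opp z : normc (- z) = normc z.
Proof. exact: (@normcN R z). Qed.

Lemma normc_dist z w : normc (z - w) = normc (w - z).
Proof. by rewrite -normc_opp opprB. Qed.

Lemma ler_normc_dist z u w : normc (z - w) <= normc (z - u) + normc (u - w).
Proof. by apply: le_trans (ler_normcD _ _); rewrite addrA subrK. Qed.

Lemma normc_conjc z : normc (z^*)%C = normc z.
Proof. by case: z => a b /=; rewrite sqrrN. Qed.

Lemma normc1_neq0 z : normc z = 1 -> z != 0.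
Proof.
move=> z1; apply/eqP => z0; move: z1; rewrite z0 Normc.normc0 => /eqP.
by rewrite eq_sym oner_eq0.
Qed.

Lemma normc1_inv z : normc z = 1 -> z^-1 = (z^*)%C.
Proof.
move=> z1; apply: (mulfI (normc1_neq0 z1)); rewrite divff ?normc1_neq0//.
have := normc2E z; rewrite z1 expr1n; case: z {z1} => a b /= ab.
apply/eqP; rewrite eq_complex /= mulrN opprK -!expr2 -ab eqxx /=.
by rewrite mulrN mulrC addNr.
Qed.

Lemma normc_unit_mul_dist z z' w w' : normc w = 1 -> normc z' = 1 ->
  normc (z * w - z' * w') <= normc (z - z') + normc (w - w').
Proof.
move=> w1 z'1.
rewrite (_ : _ - _ = (z - z') * w + z' * (w - w')); last by ring.
by apply: le_trans (ler_normcD _ _) _; rewrite !Normc.normcM w1 z'1 mulr1 mul1r.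
Qed.

Lemma measurable_normc d (T : measurableType d) (D : set T) (f : T -> R[i]) :
  cmeasurable_fun D f -> measurable_fun D (fun x => normc (f x)).
Proof.
move=> [f1 f2].
rewrite [X in measurable_fun _ X](_ : _ =
  Num.sqrt \o (fun x => complex.Re (f x) ^+ 2 + complex.Im (f x) ^+ 2)).
  apply: measurableT_comp.
    by apply: continuous_measurable_fun; exact: sqrt_continuous.
  by apply: measurable_funD; exact: measurable_funX.
by apply/funext => x /=; case: (f x).
Qed.

Lemma cmeasurable_funB d (T : measurableType d) (D : set T) (f g : T -> R[i]) :
  cmeasurable_fun D f -> cmeasurable_fun D g ->
  cmeasurable_fun D (fun x => f x - g x).
Proof.
move=> mf mg; have mN : cmeasurable_fun D (fun x => -1 * g x).
  exact: (cmeasurable_funM (cmeasurable_cst D (-1)) mg).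
rewrite [X in cmeasurable_fun _ X](_ : _ = f \+ (fun x => -1 * g x)).
  exact: cmeasurable_funD.
by apply/funext => x; rewrite /= mulN1r.
Qed.

Lemma cmeasurable_comp d d' (T : measurableType d) (T' : measurableType d')
    (h : T -> T') (f : T' -> R[i]) :
  measurable_fun setT h -> cmeasurable_fun setT f ->
  cmeasurable_fun setT (fun x => f (h x)).
Proof.
by move=> mh [f1 f2]; split; [exact: (measurableT_comp f1)|exact: (measurableT_comp f2)].
Qed.

Lemma measurable_normc_ge d (T : measurableType d) (D : set T) (f : T -> R[i]) e :
  measurable D -> cmeasurable_fun D f -> measurable (D `&` [set x | e <= normc (f x)]).
Proof.
move=> mD mf.
rewrite (_ : [set x | _] = (fun x => normc (f x)) @^-1` `[e, +oo[).
  by apply: (measurable_normc mf).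
by apply/seteqP; split => x /=; rewrite in_itv/= andbT.
Qed.

Lemma normc_powRit (x t : R) : normc (powRit x t) = 1.
Proof. by rewrite /powRit /= cos2Dsin2 sqrtr1. Qed.

Lemma powRit1 (t : R) : powRit 1 t = 1.
Proof. by rewrite /powRit ln1 mulr0 cos0 sin0. Qed.

Lemma powRitM (x y t : R) : 0 < x -> 0 < y ->
  powRit (x * y) t = powRit x t * powRit y t.
Proof.
move=> x0 y0; rewrite /powRit lnM ?posrE// mulrDr cosD sinD.
by apply/eqP; rewrite eq_complex /= eqxx /= addrC.
Qed.

Lemma powRitV (x t : R) : 0 < x -> powRit x^-1 t = (powRit x t)^*%C.
Proof. by move=> x0; rewrite /powRit lnV ?posrE// mulrN cosN sinN. Qed.

Lemma cmeasurable_powRit d (T : measurableType d) (D : set T) (f : T -> R) t :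
  measurable_fun D f -> cmeasurable_fun D (fun x => powRit (f x) t).
Proof.
move=> mf; have ml : measurable_fun D (fun x => t * ln (f x)).
  by apply: measurable_funM => //; apply: measurableT_comp mf; exact: measurable_ln.
split; rewrite /powRit /=.
  by apply: measurableT_comp ml; exact: continuous_measurable_fun (@continuous_cos R).
by apply: measurableT_comp ml; exact: continuous_measurable_fun (@continuous_sin R).
Qed.

End ComplexNorm.

Lemma ae_sub_le_measure d (T : measurableType d) (R : realType)
    (mu : {measure set T -> \bar R}) (A B : set T) :
  measurable A -> measurable B -> {ae mu, forall x, A x -> B x} -> (mu A <= mu B)%E.
Proof.
move=> mA mB [N [mN N0 AB]].
apply: (@le_trans _ _ (mu (B `|` N))).
  apply: le_measure; rewrite ?inE//; first exact: measurableU.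
  move=> x Ax; have [Bx|nBx] := pselect (B x); first by left.
  by right; apply: AB => /(_ Ax).
apply: le_trans (measureU2 _ mB mN) _.
by rewrite [X in (_ + X)%E](_ : _ = 0%E) ?adde0//; exact: N0.
Qed.

(** * Comparing an initial topology on the real line with a system of neighborhoods *)

Section TopologyCriterion.
Context (R : realType) (near_ : R -> R -> R -> Prop).
Hypothesis near_mono : forall t e e' s, e <= e' -> near_ t e s -> near_ t e' s.

Definition near_open (U : set R) :=
  forall t, U t -> exists e, 0 < e /\ forall s, near_ t e s -> U s.

(** The unfolded form of the open sets generated by the subbase [D], as in the topologies on [Z1]
    and on [unitary]. *)
Definition subbase_open (T : Type) (D : set (set T)) : set (set T) :=
  [set \bigcup_(A in D') A | D' in subset^~ (finI_from D id)].

Lemma near_open_subbase (T : Type) (D : set (set T)) (f : R -> T) :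
  (forall A, D A -> near_open (f @^-1` A)) ->
  forall O, subbase_open D O -> near_open (f @^-1` O).
Proof.
move=> Df _ [D' sD' <-] t [B D'B Bt].
have [J sJ JB] := sD' _ D'B.
suff [e [e0 He]] : exists e, 0 < e /\ forall s, near_ t e s ->
    forall A, A \in finmap.enum_fset J -> A (f s).
  exists e; split => // s /He HA; exists B => //; rewrite -JB => A /= AJ; exact: HA.
have : forall A, A \in finmap.enum_fset J -> D A /\ A (f t).
  move=> A AJ; split; first by have := sJ _ AJ; rewrite inE.
  by move: Bt; rewrite -JB; apply.
elim: (finmap.enum_fset J) => [_|A s IH HA]; first by exists 1; split.
have [|e [e0 He]] := IH; first by move=> C Cs; apply: HA; rewrite inE Cs orbT.
have [DA At] := HA A (mem_head _ _).
have [e' [e'0 He']] := Df _ DA t At.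
exists (Num.min e e'); split; first by rewrite lt_min e0 e'0.
move=> u nu C; rewrite inE => /predU1P[->|Cs].
  by apply: He'; apply: near_mono nu; rewrite ge_min lexx orbT.
by apply: He => //; apply: near_mono nu; rewrite ge_min lexx.
Qed.

(** The first premise is continuity of [f] for the [near_] topology; the second says that each
    [near_ t e] is a neighborhood of [t] in the initial one. The open set to be pulled back is the
    union of all those whose preimage lies in [U]. *)
Lemma initial_open_near (T : topologicalType) (f : R -> T) :
  (forall O, open O -> near_open (f @^-1` O)) ->
  (forall t e, 0 < e -> exists O, [/\ open O, O (f t) & forall s, O (f s) -> near_ t e s]) ->
  @open (initial_topology f) = near_open.
Proof.
move=> H1 H2; apply/seteqP; split => U; first by move=> [V oV <-]; exact: H1.
move=> nU; exists (\bigcup_(O in [set O | open O /\ f @^-1` O `<=` U]) O).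
  by apply: bigcup_open => V [].
apply/seteqP; split => [t [V [_ VU] Vt]|t Ut]; first exact: VU.
have [e [e0 He]] := nU t Ut; have [V [oV Vt VU]] := H2 t e e0.
by exists V => //; split => // s Vs; exact/He/VU.
Qed.

End TopologyCriterion.

(** * Nearness of parameters and the derivative along a word *)

Section Nearness.
Context (R : realType) (Lam : groupType) (I : choiceType) (act : Lam -> I -> I).
Local Notation Y := (posR R * bool)%type.
Local Notation X := (bernoulli_space I Y).
Context (eta : probability Y R) (mu : probability X R).
Hypothesis mu_prod : is_product_measure eta mu.
Local Notation normc := (@Normc.normc R).

Definition far (s t e : R) : set Y :=
  [set y : Y | e <= normc (powRit y.1 s - powRit y.1 t)].

(** One number serves as threshold and as bound on the measure, as in the Ky Fan metric for
    convergence in measure. *)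
Definition near_t (t e s : R) : Prop := (eta (far s t e) < e%:E)%E.

Lemma measurable_far s t e : measurable (far s t e).
Proof.
have m1 : measurable_fun setT (fun y : Y => y.1 : R).
  exact: (measurableT_comp (@measurable_posR_val R) measurable_fst).
rewrite -[far _ _ _]setTI; apply: measurable_normc_ge => //.
by apply: cmeasurable_funB; exact: cmeasurable_powRit.
Qed.

Lemma near_t_mono t e e' s : e <= e' -> near_t t e s -> near_t t e' s.
Proof.
move=> ee' n; apply: le_lt_trans (lt_le_trans n _); last by rewrite lee_fin.
apply: le_measure; rewrite ?inE; try exact: measurable_far.
by move=> y; exact: le_trans.
Qed.

(** Inverting x conjugates x^{is}, so the bit does not affect the distance. *)
Lemma normc_bitpow (y : Y) s t : normc (powRit (bitpow y) s - powRit (bitpow y) t) =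
  normc (powRit y.1 s - powRit y.1 t).
Proof.
rewrite /bitpow; case: ifP => // _; rewrite !powRitV ?posR_val_gt0//.
by rewrite -rmorphB normc_conjc.
Qed.

(** Flips change only bits and [Lam] moves coordinates, so a first component after any word is still
    a first component of the original point, and its law is known from [eta]. *)
Lemma wact_fst w i : exists j, forall x : X, (wact act w x i).1 = (x j).1.
Proof.
elim: w i => [|[k|g] w IH] i /=; first by exists i.
- have [j Hj] := IH i; have [l Hl] := IH k.
  have [ik|ik] := boolP (i == k); [exists l => x|exists j => x].
    by rewrite /upd ik; exact: Hl.
  by rewrite /upd (negPf ik); exact: Hj.
- by have [j Hj] := IH (act g^-1%g i); exists j.
Qed.

Lemma wom_near w t e : 0 < e -> exists e', 0 < e' /\ forall s, near_t t e' s ->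
  (mu [set x | (e <= normc (powRit (wom act w x) s - powRit (wom act w x) t))%R] < e%:E)%E.
Proof.
elim: w e => [|a w IH] e e0.
  exists 1; split => // s _; rewrite (_ : [set x | _] = set0) ?measure0 ?lte_fin//.
  apply/seteqP; split => // x h.
  have : e <= normc (powRit 1 s - powRit 1 t) := h.
  by rewrite !powRit1 subrr Normc.normc0 leNgt e0.
have e2 : 0 < e / 2 by rewrite divr_gt0.
have [e1 [e10 He1]] := IH _ e2.
have mset v u s : measurable [set x | u <= normc (powRit (wom act v x) s - powRit (wom act v x) t)].
  rewrite -[X in measurable X]setTI; apply: measurable_normc_ge => //.
  by apply: cmeasurable_funB; apply: cmeasurable_powRit; exact: measurable_wom.
pose A s := [set x | e / 2 <= normc (powRit (lom a (wact act w x)) s -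
  powRit (lom a (wact act w x)) t)].
have mA s : measurable (A s).
  have ml : measurable_fun setT (fun x : X => lom a (wact act w x)).
    exact: (measurableT_comp (measurable_lom a) (measurable_wact act w)).
  rewrite -[A s]setTI; apply: measurable_normc_ge => //.
  by apply: cmeasurable_funB; exact: cmeasurable_powRit.
have [e3 [e30 He3]] : exists e', 0 < e' /\ forall s, near_t t e' s ->
    (mu (A s) < (e / 2)%:E)%E.
  exists (e / 2); split => // s ns; case: a @A mA {IH} => [i|g] A mA.
    have [j Hj] := wact_fst w i.
    rewrite (_ : A s = [set x : X | far s t (e / 2) (x j)]).
      by rewrite (mu_coord mu_prod j (measurable_far _ _ _)).
    have Ex x : normc (powRit (lom (inl i) (wact act w x)) s -
        powRit (lom (inl i) (wact act w x)) t) =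
        normc (powRit (x j).1 s - powRit (x j).1 t).
      by rewrite -Hj; exact: normc_bitpow.
    by apply/seteqP; split => x; rewrite /A /far /mkset Ex.
  rewrite (_ : A s = set0) ?measure0 ?lte_fin//; apply/seteqP; split => // x h.
  have : e / 2 <= normc (powRit 1 s - powRit 1 t) := h.
  by rewrite !powRit1 subrr Normc.normc0 leNgt e2.
exists (Num.min e1 e3); split; first by rewrite lt_min e10.
move=> s ns.
have ge1 : Num.min e1 e3 <= e1 by rewrite ge_min lexx.
have ge3 : Num.min e1 e3 <= e3 by rewrite ge_min lexx orbT.
have n1 := He1 s (near_t_mono ge1 ns); have n3 := He3 s (near_t_mono ge3 ns).
have := lteD n1 n3; rewrite -EFinD -splitr; apply: le_lt_trans.
apply: le_trans (measureU2 _ (mset _ _ _) (mA s)).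
apply: le_measure; rewrite ?inE; [exact: mset|apply: measurableU; [exact: mset|exact: mA]|].
move=> x ex.
have {}ex : e <= normc (powRit (wom act w x * lom a (wact act w x)) s -
  powRit (wom act w x * lom a (wact act w x)) t) := ex.
have w0 := wom_gt0 act w x; have l0 := lom_gt0 a (wact act w x).
rewrite (powRitM s w0 l0) (powRitM t w0 l0) in ex.
have := le_trans ex (normc_unit_mul_dist _ _ (normc_powRit _ _) (normc_powRit _ _)).
rewrite {1}(splitr e) => ex'.
have [h|h] := leP (e / 2) (normc (powRit (wom act w x) s - powRit (wom act w x) t)).
  by left.
by right; rewrite /A /= leNgt; apply/negP => h'; move: ex'; rewrite leNgt ltrD.
Qed.

End Nearness.

(** * Continuity of the Radon-Nikodym cocycle *)

Section DeltaBalls.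
Context (R : realType) (Lam : groupType) (I : choiceType) (act : Lam -> I -> I).
Local Notation Y := (posR R * bool)%type.
Local Notation X := (bernoulli_space I Y).
Local Notation normc := (@Normc.normc R).
Local Notation wact := (@wact R Lam I act).
Local Notation wom := (@wom R Lam I act).
Context (eta : probability Y R) (mu : probability X R).
Hypothesis mu_prod : is_product_measure eta mu.
Variable en : nat -> seq (I + Lam).
Local Notation th := (fun n => wact (en n)).
Variables (E : set (X * X)) (delta : X * X -> R).
Hypothesis EE : E = \bigcup_n graph (th n).
Hypothesis mE : measurable E.
Hypothesis mgraph : forall w, measurable (graph (wact w)).
Hypothesis graphE : forall w, graph (wact w) `<=` E.
Hypothesis mdelta : measurable_fun E delta.
Hypothesis delta_wact : forall w, {ae mu, forall x, delta (x, wact w x) = wom w x}.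
Variable lam : {measure set (X * X) -> \bar R}.
Hypothesis lam_graph : forall w W, measurable W -> W `<=` graph (wact w) ->
  lam W = mu [set x | W (x, wact w x)].
Local Notation dc := (fun t p => powRit (delta p) t).

Lemma measurable_dc_dist (c : X * X -> R[i]) W t e : cmeasurable_fun E c ->
  measurable W -> W `<=` E -> measurable (W `&` [set p | e <= normc (dc t p - c p)]).
Proof.
move=> [c1 c2] mW WE; apply: measurable_normc_ge => //.
apply: cmeasurable_funB; last by split; exact: measurable_funS WE _.
by apply: cmeasurable_powRit; exact: measurable_funS WE _.
Qed.

Lemma cmeasurable_dc t : cmeasurable_fun E (dc t).
Proof. exact: cmeasurable_powRit. Qed.

(** As [W] has finite measure, all but r / 2 of it lies on finitely many graphs; on each of these
    [delta] is the product [wom], controlled by [wom_near]. *)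
Lemma near_delta_W W t e r : measurable W -> W `<=` E -> (lam W < +oo)%E ->
  0 < e -> 0 < r -> exists e', 0 < e' /\ forall s, near_t eta t e' s ->
  (lam (W `&` [set p | (e <= normc (dc s p - dc t p))%R]) < r%:E)%E.
Proof.
move=> mW WE Woo e0 r0.
pose Wn n := W `&` \big[setU/set0]_(i < n) graph (th i).
have mWn n : measurable (Wn n).
  apply: measurableI => //; apply: bigsetU_measurable => i _.
  exact: mgraph.
have WnW n : Wn n `<=` W by move=> p [].
pose B s := W `&` [set p | e <= normc (dc s p - dc t p)].
have mB s : measurable (B s) := measurable_dc_dist s e (cmeasurable_dc t) mW WE.
have step n r' : 0 < r' -> exists e', 0 < e' /\ forall s, near_t eta t e' s ->
    (lam (Wn n `&` B s) < r'%:E)%E.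
  elim: n r' => [|n IH] r' r'0.
    exists 1; split => // s _.
    by rewrite /Wn big_ord0 setI0 set0I measure0 lte_fin.
  have r2 : 0 < r' / 2 by rewrite divr_gt0.
  have [e1 [e10 He1]] := IH _ r2.
  (* [wom_near] uses one number twice: it must be at most [e] as a threshold and at most r' / 2 as a
     measure. *)
  have er : 0 < Num.min e (r' / 2) by rewrite lt_min e0.
  have [e2 [e20 He2]] := wom_near act mu_prod (en n) t er.
  exists (Num.min e1 e2); split; first by rewrite lt_min e10.
  move=> s ns.
  have ge1 : Num.min e1 e2 <= e1 by rewrite ge_min lexx.
  have ge2 : Num.min e1 e2 <= e2 by rewrite ge_min lexx orbT.
  have n1 := He1 s (near_t_mono ge1 ns); have n2 := He2 s (near_t_mono ge2 ns).
  pose C := graph (th n) `&` B s.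
  have mC : measurable C by apply: measurableI => //; exact: mgraph.
  have CE : C `<=` E by move=> p [/graphE].
  have sub : Wn n.+1 `&` B s `<=` (Wn n `&` B s) `|` C.
    move=> p [[Wp]]; rewrite big_ord_recr /= => -[h|h] Bp; first by left.
    by right.
  have mWB m : measurable (Wn m `&` B s) := measurableI _ _ (mWn m) (mB s).
  apply: (@le_lt_trans _ _ (lam (Wn n `&` B s) + lam C)%E).
    have : (lam ((Wn n `&` B s) `|` C) <= lam (Wn n `&` B s) + lam C)%E.
      exact: measureU2.
    apply: le_trans.
    apply: (le_measure _ (mem_set (mWB _)) (mem_set (measurableU _ _ (mWB _) mC))).
    exact: sub.
  rewrite (splitr r') EFinD; apply: lteD => //.
  rewrite (lam_graph (w := en n))//; last by move=> p [].
  pose D := [set x | Num.min e (r' / 2) <=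
     normc (powRit (wom (en n) x) s - powRit (wom (en n) x) t)].
  have mD : measurable D.
    rewrite -[D]setTI; apply: measurable_normc_ge => //.
    by apply: cmeasurable_funB; apply: cmeasurable_powRit; exact: measurable_wom.
  apply: (@le_lt_trans _ _ (mu D)); last first.
    by apply: lt_le_trans n2 _; rewrite lee_fin ge_min lexx orbT.
  have mpre : measurable [set x | C (x, wact (en n) x)].
    by apply: measurable_left_pre => //; exact: measurable_wact.
  apply: (ae_sub_le_measure mpre mD).
  have := delta_wact (en n); apply: filterS => x hx [_ [_ h]].
  move: h; rewrite /mkset hx => h.
  by apply: le_trans h; rewrite ge_min lexx.
have r2 : 0 < r / 2 by rewrite divr_gt0.
have [n Hn] : exists n, (lam (W `\` Wn n) < (r / 2)%:E)%E.
  have ni : nonincreasing_seq (fun n => W `\` Wn n).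
    move=> m n mn; rewrite subsetEset; apply: setDS; apply: setIS.
    exact: (@subset_bigsetU _ (fun i => graph (th i)) _ _ mn).
  have mWD n : measurable (W `\` Wn n) by exact: measurableD.
  have capE : \bigcap_n (W `\` Wn n) = set0.
    apply/seteqP; split => // p h.
    have [Wp _] := h 0%N Logic.I; have := WE p Wp.
    rewrite EE => -[k _ gk]; have [_] := h k.+1 Logic.I; apply.
    by split => //; rewrite big_ord_recr /=; right.
  have := nonincreasing_cvg_mu (mu := lam) _ mWD _ ni.
  rewrite capE measure0 => /(_ _ _)/fine_cvgP H.
  have [] := H.
  - by apply: le_lt_trans Woo; apply: le_measure; rewrite ?inE.
  - exact: measurable0.
  move=> [N1 _ H1] /cvgrPdist_lt/(_ _ r2)[N2 _ H2].
  exists (maxn N1 N2); have := H2 _ (leq_maxr N1 N2).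
  rewrite /= sub0r normrN => h.
  rewrite -[X in (X < _)%E]fineK; last exact: (H1 _ (leq_maxl _ _)).
  by rewrite lte_fin; apply: le_lt_trans h; exact: ler_norm.
have [e' [e'0 He']] := step n _ r2.
exists e'; split; first exact: e'0.
move=> s ns; rewrite -/(B s).
have mWB m : measurable (Wn m `&` B s) := measurableI _ _ (mWn m) (mB s).
apply: (@le_lt_trans _ _ (lam (Wn n `&` B s) + lam (W `\` Wn n))%E).
  have mD : measurable (W `\` Wn n) by exact: measurableD.
  have : (lam ((Wn n `&` B s) `|` (W `\` Wn n)) <=
      lam (Wn n `&` B s) + lam (W `\` Wn n))%E.
    exact: measureU2.
  apply: le_trans.
  apply: (le_measure _ (mem_set (mB s)) (mem_set (measurableU _ _ (mWB _) mD))).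
  move=> p Bp; have [h|h] := pselect (Wn n p); first by left.
  by right; split => //; case: Bp.
by rewrite (splitr r) EFinD; apply: lteD => //; exact: He'.
Qed.

(** The bound holds with room in both parameters: by continuity from above it persists for some
    threshold u < e. The gap e - u and the remaining measure are then spent on the distance from [t]
    to [s]. *)
Lemma near_delta_ball (c : X * X -> R[i]) W e r t : cmeasurable_fun E c ->
  measurable W -> W `<=` E -> (lam W < +oo)%E -> 0 < e -> 0 < r ->
  (lam (W `&` [set p | (e <= normc (dc t p - c p))%R]) < r%:E)%E ->
  exists e', 0 < e' /\ forall s, near_t eta t e' s ->
  (lam (W `&` [set p | (e <= normc (dc s p - c p))%R]) < r%:E)%E.
Proof.
move=> mc mW WE Woo e0 r0 ht.
pose B u := W `&` [set p | u <= normc (dc t p - c p)].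
have mB u : measurable (B u) := measurable_dc_dist t u mc mW WE.
have BE u : B u `<=` E by move=> p [/WE].
have [u [u0 ue Hu]] : exists u, [/\ 0 < u, u < e & (lam (B u) < r%:E)%E].
  (* Thresholds in [e / 2, e) increasing to [e]: the closed inequality in [B] makes the intersection
     of the sets exactly [B e]. *)
  pose un (n : nat) := e - e / 2 * n.+1%:R^-1.
  have un_lt n : un n < e by rewrite ltrBlDr ltrDl mulr_gt0 ?divr_gt0 ?invr_gt0.
  have un_gt0 n : 0 < un n.
    rewrite subr_gt0; apply: (@le_lt_trans _ _ (e / 2)); last by lra.
    have i1 : n.+1%:R^-1 <= 1 :> R by rewrite invf_le1 ?ltr0n// ler1n.
    by apply: ler_piMr => //; rewrite divr_ge0// ltW.
  have ni : nonincreasing_seq (fun n => B (un n)).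
    move=> m n mn; rewrite subsetEset => p [Wp h]; split => //.
    apply: le_trans h; rewrite lerD2l lerN2 ler_pM2l ?divr_gt0//.
    by rewrite lef_pV2 ?posrE ?ltr0n// ler_nat.
  have capE : \bigcap_n B (un n) = B e.
    apply/seteqP; split => p; last first.
      by move=> [Wp h] n _; split => //; apply: le_trans h; exact/ltW.
    move=> h; have [Wp _] := h 0%N Logic.I; split => //.
    have cu : un n @[n --> \oo] --> e.
      rewrite -[X in _ --> X]subr0; apply: cvgB; first exact: cvg_cst.
      rewrite -[X in _ --> X](mulr0 (e / 2)); apply: cvgMr; exact: cvg_harmonic.
    have ecu : lim (un n @[n --> \oo]) = e by exact: cvg_lim cu.
    rewrite /mkset -ecu; apply: limr_le; first by apply/cvg_ex; exists e.
    by apply: nearW => n; have [] := h n Logic.I.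
  have := nonincreasing_cvg_mu (mu := lam) _ (fun n => mB (un n)) _ ni.
  rewrite capE => /(_ _ (mB e)) H.
  have {}H : lam (B (un n)) @[n --> \oo] --> lam (B e).
    apply: H; apply: le_lt_trans Woo.
    by apply: le_measure; rewrite ?inE// => p [].
  have lt : (lam (B e) < r%:E)%E := ht.
  have [n _ Hn] := H _ (open_ereal_lt' lt).
  by exists (un n); split => //; exact: (Hn n (leqnn n)).
have Bfin : lam (B u) \is a fin_num.
  by rewrite ge0_fin_numE// (lt_trans Hu)// ltry.
pose r' := r - fine (lam (B u)).
have r'0 : 0 < r' by rewrite subr_gt0 -lte_fin fineK.
have eu : 0 < e - u by rewrite subr_gt0.
have [e' [e'0 He']] := near_delta_W t mW WE Woo eu r'0.
exists e'; split; first exact: e'0.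
move=> s ns0; have ns := He' s ns0.
pose B' := W `&` [set p | e - u <= normc (dc s p - dc t p)].
have mB' : measurable B' := measurable_dc_dist s (e - u) (cmeasurable_dc t) mW WE.
have ms := measurable_dc_dist s e mc mW WE.
apply: (@le_lt_trans _ _ (lam (B u) + lam B')%E).
  have : (lam (B u `|` B') <= lam (B u) + lam B')%E by exact: measureU2.
  apply: le_trans.
  apply: (le_measure _ (mem_set ms) (mem_set (measurableU _ _ (mB u) mB'))).
  move=> p [Wp h].
  have [hu|hu] := leP u (normc (dc t p - c p)); first by left.
  right; split => //; rewrite /mkset.
  have := le_trans h (ler_normc_dist _ (dc t p) _) => h'.
  by rewrite lerBlDr; apply: le_trans h' _; rewrite lerD2l ltW.
by rewrite -(fineK Bfin) -lteBrDl//; rewrite -EFinB.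
Qed.

End DeltaBalls.

(** * The Radon-Nikodym cocycle of the Bernoulli relation *)

Section RelationFacts.
Context (R : realType) (Lam : groupType) (I : choiceType) (act : Lam -> I -> I).
Hypothesis act_action : is_action act.
Hypothesis I_countable : countable [set: I].
Local Notation Y := (posR R * bool)%type.
Local Notation X := (bernoulli_space I Y).
Local Notation E := (bernoulli_rel act (@same_fst (posR R) bool)).
Local Notation normc := (@Normc.normc R).
Local Notation wact := (@wact R Lam I act).
Local Notation wom := (@wom R Lam I act).
Context (xi : {finite_measure set (posR R) -> \bar R}) (eta : probability Y R).
Hypothesis etaE : forall f : Y -> \bar R,
  measurable_fun setT f -> (forall y, 0 <= f y)%E ->
  (\int[eta]_y f y = \int[xi]_x f (x, false) +
                        \int[xi]_x ((x : R)%:E * f (x, true)))%E.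
Context (mu : probability X R).
Hypothesis mu_prod : is_product_measure eta mu.
Variable en : nat -> seq (I + Lam).
Hypothesis en_surj : forall w, exists n, en n = w.
Local Notation delta := (delta_mu mu E).
Local Notation dc := (delta_cocycle mu E).
Local Notation th := (fun n => wact (en n)).
Local Notation th' := (fun n => wact (winv (en n))).
Local Notation om := (fun n => wom (en n)).

Let mdiag : measurable [set p : X * X | p.1 = p.2].
Proof. exact: (measurable_diagX I_countable (@measurable_diagY R)). Qed.
Let tK n : cancel (th n) (th' n). Proof. exact: wactK. Qed.
Let t'K n : cancel (th' n) (th n). Proof. exact: wactVK. Qed.
Let mt n : measurable_fun setT (th n). Proof. exact: measurable_wact. Qed.
Let mt' n : measurable_fun setT (th' n). Proof. exact: measurable_wact. Qed.
Let mom n : measurable_fun setT (om n). Proof. exact: measurable_wom. Qed.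
Let om0 n x : 0 < om n x. Proof. exact: wom_gt0. Qed.
Let cv n (k : X -> \bar R) : measurable_fun setT k -> (forall x, 0 <= k x)%E ->
  (\int[mu]_x k (th n x) = \int[mu]_y (k y * (om n (th' n y))%:E))%E.
Proof. exact: (change_var_wact act_action etaE mu_prod). Qed.

Lemma bernoulli_relE : E = \bigcup_n graph (th n).
Proof.
apply/seteqP; split => -[x y].
  move=> /(bernoulli_relP act_action)[w ->]; have [n nw] := en_surj w.
  by exists n => //; rewrite /graph /= nw.
by move=> [n _ h]; apply/(bernoulli_relP act_action); exists (en n).
Qed.

Lemma bernoulli_rel_wact w x : E (x, wact w x).
Proof. by apply/(bernoulli_relP act_action); exists w. Qed.

Lemma measurable_bernoulli_rel : measurable E.
Proof. by rewrite bernoulli_relE; exact: measurable_bigcup_graph. Qed.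

Lemma graph_wact_sub w : graph (wact w) `<=` E.
Proof. by move=> [x y] h; rewrite (h : y = _); exact: bernoulli_rel_wact. Qed.

Lemma measurable_graph_wact w : measurable (graph (wact w)).
Proof. by apply: (measurable_graph mdiag); exact: measurable_wact. Qed.

Lemma delta_mu_RN : is_RN_derivative mu E delta.
Proof.
apply: (@xgetPex _ (fun=> 1) (is_RN_derivative mu E)).
exists (RN th om); rewrite [X in is_RN_derivative _ X]bernoulli_relE.
exact: (RN_is_RN mdiag tK mt mt' mom om0 cv).
Qed.

Lemma ae_wact w (Q : X -> Prop) :
  {ae mu, forall x, Q x} -> {ae mu, forall x, Q (wact w x)}.
Proof.
exact: (ae_comp (measurable_wact act w) (measurable_wact act (winv w))
  (measurable_wom act w) (change_var_wact act_action etaE mu_prod w)).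
Qed.

Lemma delta_mu_wact1 w : {ae mu, forall x, delta (x, wact w x) = wom w x}.
Proof.
exact: (RN_unique mdiag (wactK act_action w) (wactVK act_action w)
  (measurable_wact act w) (measurable_wact act (winv w)) (measurable_wom act w)
  (wom_gt0 act w) (change_var_wact act_action etaE mu_prod w)
  measurable_bernoulli_rel (@graph_wact_sub w) delta_mu_RN).
Qed.

Lemma ae_forall_word (P : seq (I + Lam) -> X -> Prop) :
  (forall w, {ae mu, forall x, P w x}) -> {ae mu, forall x, forall w, P w x}.
Proof.
move=> h; have : {ae mu, forall x, forall n, P (en n) x} by exact: ae_foralln.
by apply: filterS => x hx w; have [n <-] := en_surj w.
Qed.

Lemma delta_mu_wact : {ae mu, forall x, forall w, delta (x, wact w x) = wom w x}.
Proof. by apply: ae_forall_word => w; exact: delta_mu_wact1. Qed.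

(** The cocycle identity reduces to [wom_cat], so the default of [insubd] is not taken. *)
Lemma delta_cocycleE t : Z1_val (dc t) = fun p => powRit (delta p) t.
Proof.
rewrite /delta_cocycle insubdK//; apply/asboolP; split.
- by apply: cmeasurable_powRit; case: delta_mu_RN.
- by move=> p _; exact: normc_powRit.
(* The identity also evaluates [delta] at pairs starting from the moved point, so the null set of
   [delta_mu_wact] is pulled back along [w1]. *)
- have h : {ae mu, forall x, forall w1 w2,
      delta (wact w1 x, wact w2 (wact w1 x)) = wom w2 (wact w1 x)}.
    by apply: ae_forall_word => w1; exact: (ae_wact w1 delta_mu_wact).
  have := delta_mu_wact; apply: filterS2 h => x h1 h2 y z.
  move=> /(bernoulli_relP act_action)[w1 ->] /(bernoulli_relP act_action)[w2 ->].
  rewrite h1 -wact_cat !h2 wom_cat powRitM//; exact: wom_gt0.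
Qed.

Lemma mu_left_rel_measure : exists lam : {measure set (X * X) -> \bar R},
  forall W, measurable W -> W `<=` E -> mu_left mu W = lam W.
Proof.
have [lam H] := mu_left_measure mu mdiag mt.
exists lam => W mW; rewrite bernoulli_relE => WE; exact: H mW WE.
Qed.

Lemma mu_left_rel_ae_eq W W' : measurable W -> measurable W' -> W `<=` E -> W' `<=` E ->
  {ae mu, forall x, forall y, E (x, y) -> (W (x, y) <-> W' (x, y))} ->
  mu_left mu W = mu_left mu W'.
Proof.
move=> mW mW' WE W'E; rewrite bernoulli_relE in WE W'E *.
exact: (mu_left_ae_eq mdiag mt).
Qed.

Lemma mu_left_graph_wact w W : measurable W -> W `<=` graph (wact w) ->
  mu_left mu W = mu [set x | W (x, wact w x)].
Proof. by move=> mW Wg; apply: mu_left_graph => //; exact: measurable_wact. Qed.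

Lemma Z1_cmeasurable (c : Z1 mu E) : cmeasurable_fun E c.
Proof. by have /asboolP[] := Z1P c. Qed.

Lemma Z1_normc (c : Z1 mu E) p : E p -> normc (c p) = 1.
Proof. by have /asboolP[_ + _] := Z1P c; apply. Qed.

Lemma measurable_Z1_dist (c c' : Z1 mu E) W e : measurable W -> W `<=` E ->
  measurable (W `&` [set p | e <= normc (c' p - c p)]).
Proof.
move=> mW WE; apply: measurable_normc_ge => //.
have mE := measurable_bernoulli_rel.
have [c1 c2] := Z1_cmeasurable c; have [c3 c4] := Z1_cmeasurable c'.
by apply: cmeasurable_funB; split; apply: measurable_funS WE _.
Qed.

Lemma near_open_delta_ball c W e r :
  measurable W -> W `<=` E -> (mu_left mu W < +oo)%E -> 0 < e -> 0 < r ->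
  near_open (near_t eta) (dc @^-1` measure_ball c W e r).
Proof.
move=> mW WE Woo e0 r0 t ht.
have [lam lamE] := mu_left_rel_measure.
have lamG w V : measurable V -> V `<=` graph (wact w) ->
    lam V = mu [set x | V (x, wact w x)].
  move=> mV Vw; rewrite -lamE//; last exact: subset_trans Vw (@graph_wact_sub w).
  exact: mu_left_graph_wact.
have ballE s : mu_left mu (W `&` [set p | e <= normc (dc s p - c p)]) =
    lam (W `&` [set p | e <= normc (powRit (delta p) s - c p)]).
  rewrite lamE; [|exact: measurable_Z1_dist|by move=> p [/WE]].
  by rewrite delta_cocycleE.
have ht' : (lam (W `&` [set p | (e <= normc (powRit (delta p) t - c p))%R]) < r%:E)%E.
  by rewrite -ballE.
have md : measurable_fun E delta by case: delta_mu_RN.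
rewrite lamE// in Woo.
have [e' [e'0 He']] := near_delta_ball mu_prod bernoulli_relE
  measurable_bernoulli_rel measurable_graph_wact graph_wact_sub md
  delta_mu_wact1 lamG (Z1_cmeasurable c) mW WE Woo e0 r0 ht'.
exists e'; split; first exact: e'0.
move=> s ns; rewrite /preimage /measure_ball /mkset ballE; exact: He'.
Qed.

End RelationFacts.

(** * Convergence in measure and open sets of cohomology classes *)

Section ConvergenceInMeasure.
Context d (T : measurableType d) (R : realType) (mu : probability T R).
Local Notation N2 f := (\int[mu]_x f x ^+ 2).

Definition cvg_measure (g : nat -> T -> R) := forall k, 0 < k ->
  exists N, forall n, (N <= n)%N -> (mu [set x | k <= g n x]%R < k%:E)%E.

Lemma measurable_ge (g : T -> R) k : measurable_fun setT g -> measurable [set x | k <= g x].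
Proof.
move=> mg; rewrite (_ : [set x | _] = setT `&` g @^-1` `[k, +oo[); first exact: mg.
by apply/seteqP; split => x /=; rewrite in_itv/= andbT// => -[].
Qed.

Lemma cvg_measureD (g h u : nat -> T -> R) : (forall n, measurable_fun setT (g n)) ->
  (forall n, measurable_fun setT (h n)) -> (forall n, measurable_fun setT (u n)) ->
  (forall n x, u n x <= g n x + h n x) ->
  cvg_measure g -> cvg_measure h -> cvg_measure u.
Proof.
move=> mg mh mu' ugh cg ch k k0; have k2 : 0 < k / 2 by rewrite divr_gt0.
have [N1 H1] := cg _ k2; have [N2 H2] := ch _ k2.
exists (maxn N1 N2) => n; rewrite geq_max => /andP[/H1 n1 /H2 n2].
have m1 := measurable_ge (k / 2) (mg n); have m2 := measurable_ge (k / 2) (mh n).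
have := lteD n1 n2; rewrite -EFinD -splitr; apply: le_lt_trans.
have : (mu ([set x | k / 2 <= g n x]%R `|` [set x | k / 2 <= h n x]%R) <=
  mu [set x | k / 2 <= g n x]%R + mu [set x | k / 2 <= h n x]%R)%E by exact: measureU2.
apply: le_trans; apply: le_measure; rewrite ?inE.
- exact: measurable_ge.
- exact: measurableU.
- move=> x /= kx; have [h1|h1] := leP (k / 2) (g n x); first by left.
  right; rewrite leNgt; apply/negP => h2.
  by have := le_trans kx (ugh n x); rewrite (splitr k) leNgt ltrD.
Qed.

Lemma sqr_integral_split (u g : T -> R) k : bmeas u -> measurable_fun setT g ->
  (forall x, `|u x| <= 2) -> (forall x, `|u x| <= g x) -> 0 < k ->
  N2 u <= k ^+ 2 + 4 * fine (mu [set x | k <= g x]).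
Proof.
move=> bu mg u2 ug k0; have mA := measurable_ge k mg; set A := [set x | k <= g x] in mA *.
have bA : bmeas (\1_A : T -> R) by exact: bmeas_indic.
have b4 : bmeas (fun x => 4 * \1_A x : R) by apply: bmeasM => //; exact: bmeas_cst.
rewrite -bintegral_indic// -bintegralZ// -[k ^+ 2](bintegral_cst mu) -bintegralD//; last first.
  exact: bmeas_cst.
apply: le_bintegral; [exact: bmeasX|by apply: bmeasD => //; exact: bmeas_cst|].
move=> x; rewrite indicE; have [xA|xA] := boolP (x \in A).
  rewrite mulr1; have := u2 x; rewrite ler_norml => /andP[? ?].
  by have := sqr_ge0 k; nra.
rewrite mulr0 addr0; have gk : g x < k.
  by rewrite ltNge; apply/negP => h; move/negP: xA; apply; rewrite inE.
have := le_lt_trans (ug x) gk; rewrite ltr_norml => /andP[? ?]; nra.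
Qed.

Lemma cvg_measure_N2 (u g : nat -> T -> R) : (forall n, bmeas (u n)) ->
  (forall n, measurable_fun setT (g n)) ->
  (forall n x, `|u n x| <= 2) -> (forall n x, `|u n x| <= g n x) ->
  cvg_measure g -> N2 (u n) @[n --> \oo] --> (0 : R).
Proof.
move=> bu mg u2 ug cg; apply/cvgrPdist_le => e e0.
(* For k at most 1, the bound k^2 + 4k is at most 5k. *)
pose k := Num.min 1 (e / 5).
have k0 : 0 < k by rewrite lt_min ltr01 divr_gt0.
have [N HN] := cg _ k0; exists N => // n /= /HN h.
rewrite sub0r normrN ger0_norm ?bintegral_sqr_ge0//.
apply: le_trans (sqr_integral_split (bu n) (mg n) (u2 n) (ug n) k0) _.
have mA := measurable_ge k (mg n).
have hk : fine (mu [set x | k <= g n x]) <= k.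
  by rewrite -lee_fin fineK ?fin_num_measure// ltW.
have k1 : k <= 1 by rewrite ge_min lexx.
have ke : k <= e / 5 by rewrite ge_min lexx orbT.
by nra.
Qed.

(* Chebyshev *)
Lemma N2_cvg_measure (u v : nat -> T -> R) (g : nat -> T -> R) :
  (forall n, bmeas (u n)) -> (forall n, bmeas (v n)) ->
  (forall n, measurable_fun setT (g n)) ->
  (forall n x, 0 <= g n x) ->
  (forall n x, g n x ^+ 2 = u n x ^+ 2 + v n x ^+ 2) ->
  N2 (u n) @[n --> \oo] --> (0 : R) -> N2 (v n) @[n --> \oo] --> (0 : R) ->
  cvg_measure g.
Proof.
move=> bu bv mg g0 guv cu cv k k0.
have cuv : N2 (u n) + N2 (v n) @[n --> \oo] --> (0 : R).
  by rewrite -[X in _ --> X]addr0; exact: cvgD.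
have k3 : 0 < k ^+ 3 by rewrite exprn_gt0.
have /cvgrPdist_lt/(_ _ k3)[N _ HN] := cuv; exists N => n /HN /=.
rewrite sub0r normrN ger0_norm ?addr_ge0 ?bintegral_sqr_ge0// => h.
have mA := measurable_ge k (mg n); set A := [set x | _] in mA *.
have bA : bmeas (\1_A : T -> R) by exact: bmeas_indic.
have : k ^+ 2 * fine (mu A) <= N2 (u n) + N2 (v n).
  have bX w : bmeas w -> bmeas (fun x : T => w x ^+ 2 : R) by exact: bmeasX.
  rewrite -bintegral_indic// -bintegralZ// -bintegralD; [|exact: bX|exact: bX].
  apply: le_bintegral.
  - by apply: bmeasM => //; exact: bmeas_cst.
  - by apply: bmeasD; exact: bX.
  - move=> x; rewrite -guv indicE; have [/set_mem xA|_] := boolP (x \in A).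
      by rewrite mulr1 lerXn2r// nnegrE ?g0// ltW.
    by rewrite mulr0 sqr_ge0.
move=> /le_lt_trans /(_ h); rewrite (exprSr k 2) ltr_pM2l ?exprn_gt0// => hk.
by rewrite -[X in (X < _)%E]fineK ?fin_num_measure// lte_fin.
Qed.

End ConvergenceInMeasure.

Lemma pi_H1P d (T : measurableType d) (R : realType) (mu : probability T R)
    (E : set (T * T)) (c c' : Z1 mu E) :
  (\pi_(H1 mu E) c = \pi_(H1 mu E) c')%qT <-> cohomologous c c'.
Proof.
split=> h; first by apply/(@eqmodP _ (cohomologous_equiv mu E)); exact: h.
have /(@eqmodP _ (cohomologous_equiv mu E)) h' : cohomologous_equiv mu E c c' := h.
exact: h'.
Qed.

(** * Multiplication by coboundaries and open sets of classes *)

Section Twist.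
Context (R : realType) (Lam : groupType) (I : choiceType) (act : Lam -> I -> I).
Hypothesis act_action : is_action act.
Hypothesis I_countable : countable [set: I].
Local Notation Y := (posR R * bool)%type.
Local Notation X := (bernoulli_space I Y).
Local Notation E := (bernoulli_rel act (@same_fst (posR R) bool)).
Local Notation normc := (@Normc.normc R).
Local Notation wact := (@wact R Lam I act).
Context (mu : probability X R).
Variable en : nat -> seq (I + Lam).
Hypothesis en_surj : forall w, exists n, en n = w.
Local Notation Z1 := (Z1 mu E).
Local Notation H1 := (H1 mu E).

Definition unimodular (f : X -> R[i]) :=
  cmeasurable_fun setT f /\ forall x, normc (f x) = 1.

Lemma unimodular_conj f : unimodular f -> unimodular (fun x => (f x)^*%C).
Proof.
by move=> [mf f1]; split; [exact: cmeasurable_conjc|move=> x; rewrite normc_conjc].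
Qed.

(** The conjugate is the inverse for unimodular [f], so this is the product of [c] with the
    coboundary of [f]; up to null sets, its orbits are the cohomology classes. *)
Definition twist_fun (f : X -> R[i]) (c : X * X -> R[i]) (p : X * X) : R[i] :=
  c p * (f p.1 * (f p.2)^*%C).

Lemma twist_subproof f (c : Z1) : unimodular f -> twist_fun f c \in cocycle mu E.
Proof.
move=> [mf f1]; have /asboolP[mc c1 cc] := Z1P c; apply/asboolP; split.
- have m1 : cmeasurable_fun setT (fun p : X * X => f p.1 * (f p.2)^*%C).
    apply: (cmeasurable_funM (f := fun p : X * X => f p.1)).
      exact: (cmeasurable_comp measurable_fst mf).
    apply: (@cmeasurable_conjc _ _ _ _ (fun p : X * X => f p.2)).
    exact: (cmeasurable_comp measurable_snd mf).
  have m2 : cmeasurable_fun E (fun p : X * X => f p.1 * (f p.2)^*%C).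
    by case: m1 => m2 m3; split; exact: measurable_funTS.
  exact: (cmeasurable_funM mc m2).
- by move=> p Ep; rewrite /twist_fun !Normc.normcM c1// normc_conjc !f1 !mulr1.
- apply: filterS cc => x h y z Exy Eyz; rewrite /twist_fun /=.
  rewrite -(h y z Exy Eyz) -!(normc1_inv (f1 _)).
  by have := normc1_neq0 (f1 y) => fy; field; rewrite fy normc1_neq0.
Qed.

Definition twist f (uf : unimodular f) (c : Z1) : Z1 := MkZ1 (twist_subproof c uf).

Lemma twist_dist f (uf : unimodular f) (c c' : Z1) p :
  normc (twist uf c p - c' p) = normc (c p - twist (unimodular_conj uf) c' p).
Proof.
have [_ f1] := uf; rewrite /twist /= /twist_fun /=.
set u := f p.1; set v := f p.2.
have u1 : normc u = 1 by exact: f1.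
have v1 : normc v = 1 by exact: f1.
rewrite -[LHS]mul1r -[X in X * _](_ : normc (u^*%C * v) = 1); last first.
  by rewrite Normc.normcM normc_conjc u1 v1 mulr1.
rewrite -Normc.normcM; congr normc.
rewrite conjcK -!normc1_inv//; field.
by rewrite !normc1_neq0.
Qed.

Lemma measure_ball_twist f (uf : unimodular f) c W e r :
  twist uf @^-1` measure_ball c W e r =
  measure_ball (twist (unimodular_conj uf) c) W e r.
Proof.
have eqs c' : W `&` [set p | e <= normc (twist uf c' p - c p)] =
    W `&` [set p | e <= normc (c' p - twist (unimodular_conj uf) c p)].
  by congr (W `&` _); apply/funext => p; rewrite /mkset twist_dist.
by apply/seteqP; split => c'; rewrite /preimage /measure_ball /mkset eqs.
Qed.

Lemma open_measure_ball (c : Z1) W e r : measurable W -> W `<=` E ->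
  (mu_left mu W < +oo)%E -> 0 < e -> 0 < r -> open (measure_ball c W e r).
Proof.
move=> mW WE Woo e0 r0; exists [set measure_ball c W e r]; last by rewrite bigcup_set1.
by move=> _ ->; apply: (@finI_from1 _ _ _ id); exists c, W, e, r.
Qed.

(** Convergence in measure on the graph of each word is all that the argument needs, and finitely
    many graphs of finite measure keep these neighborhoods open. *)
Fixpoint nbhd_words (c : Z1) (r : R) (k : nat) : set Z1 :=
  if k is k'.+1 then nbhd_words c r k' `&` measure_ball c (graph (wact (en k'))) r r
  else setT.

Lemma nbhd_wordsP c r k c' : nbhd_words c r k c' <->
  forall j, (j < k)%N -> measure_ball c (graph (wact (en j))) r r c'.
Proof.
elim: k => [|k IH] /=; first by split.
split=> [[/IH h1 h2] j|h].
  by rewrite ltnS leq_eqVlt => /predU1P[-> //|/h1].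
by split; [apply/IH => j jk; apply/h/ltnW|exact: h].
Qed.

Lemma mu_left_graph_fin w : (mu_left mu (graph (wact w)) < +oo)%E.
Proof.
have mg : measurable (graph (wact w)) by exact: measurable_graph_wact.
rewrite (mu_left_graph_wact (act := act) mu (w := w) mg)//.
rewrite (_ : [set x | _] = setT); last by apply/seteqP.
by rewrite (le_lt_trans (probability_le1 _ _))// ?ltry.
Qed.

Lemma open_twist_nbhd f (uf : unimodular f) c r k : 0 < r ->
  open (twist uf @^-1` nbhd_words c r k).
Proof.
move=> r0; elim: k => [|k IH] /=; first by rewrite preimage_setT; exact: openT.
rewrite preimage_setI; apply: openI => //; rewrite measure_ball_twist.
apply: open_measure_ball => //.
- exact: measurable_graph_wact.
- exact: graph_wact_sub.
- exact: mu_left_graph_fin.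
Qed.

(** Elements of [Z1] are functions, and cohomology identifies them with twists only a.e.; the balls
    do not see the difference. *)
Lemma measure_ball_ae (c0 c c' : Z1) W e r : measurable W -> W `<=` E ->
  {ae mu, forall x, forall y, E (x, y) -> c (x, y) = c' (x, y)} ->
  measure_ball c0 W e r c -> measure_ball c0 W e r c'.
Proof.
move=> mW WE cc'; rewrite /measure_ball /mkset.
rewrite (mu_left_rel_ae_eq act_action I_countable en_surj
  (W' := W `&` [set p | e <= normc (c' p - c0 p)]))//.
- exact: measurable_Z1_dist.
- exact: measurable_Z1_dist.
- by move=> p [/WE].
- by move=> p [/WE].
- by apply: filterS cc' => x h y Exy; rewrite /setI /mkset h.
Qed.

Lemma open_class_nbhd c r k : 0 < r ->
  open ([set h | exists2 c', nbhd_words c r k c' & (\pi_H1 c' = h)%qT] : set H1).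
Proof.
move=> r0; set S := [set h | _].
suff SE : (\pi_H1)%qT @^-1` S =
    \bigcup_(V in [set V | exists f (uf : unimodular f), V = twist uf @^-1` nbhd_words c r k]) V.
  suff : open ((\pi_H1)%qT @^-1` S) by [].
  by rewrite SE; apply: bigcup_open => _ [f [uf ->]]; exact: open_twist_nbhd.
apply/seteqP; split => c'.
  move=> [c1 Vc1 /pi_H1P/asboolP[f [mf f1 fc]]].
  have uf : unimodular f by [].
  exists (twist uf @^-1` nbhd_words c r k); first by exists f, uf.
  apply/nbhd_wordsP => j jk; move/nbhd_wordsP : Vc1 => /(_ j jk).
  apply: measure_ball_ae.
  - exact: measurable_graph_wact.
  - exact: graph_wact_sub.
  - apply: filterS fc => x h y Exy; have := h y Exy.
    rewrite /twist /= /twist_fun /= -(normc1_inv (f1 y)) => <-.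
    by rewrite mulrC divfK// normc1_neq0// Z1_normc.
move=> [_ [f [uf ->]] Vc']; exists (twist uf c') => //.
apply/pi_H1P/asboolP; have [mf f1] := uf; exists f; split => //.
apply: aeW => x y Exy; rewrite /twist /= /twist_fun /= mulrAC divff ?mul1r.
  by rewrite (normc1_inv (f1 y)).
by rewrite normc1_neq0// Z1_normc.
Qed.

End Twist.

(** * Neighborhoods in the cohomology group *)

Section SpectralNbhd.
Context (R : realType) (Lam : groupType) (I : choiceType) (act : Lam -> I -> I).
Hypothesis act_action : is_action act.
Hypothesis I_countable : countable [set: I].
Hypothesis no_mean : ~ exists m : set I -> R, invariant_mean act m.
Local Notation Y := (posR R * bool)%type.
Local Notation X := (bernoulli_space I Y).
Local Notation E := (bernoulli_rel act (@same_fst (posR R) bool)).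
Local Notation normc := (@Normc.normc R).
Local Notation wact := (@wact R Lam I act).
Local Notation wom := (@wom R Lam I act).
Context (xi : {finite_measure set (posR R) -> \bar R}) (eta : probability Y R).
Hypothesis etaE : forall f : Y -> \bar R,
  measurable_fun setT f -> (forall y, 0 <= f y)%E ->
  (\int[eta]_y f y = \int[xi]_x f (x, false) +
                        \int[xi]_x ((x : R)%:E * f (x, true)))%E.
Context (mu : probability X R).
Hypothesis mu_prod : is_product_measure eta mu.
Variable en : nat -> seq (I + Lam).
Hypothesis en_surj : forall w, exists n, en n = w.
Local Notation delta := (delta_mu mu E).
Local Notation dc := (delta_cocycle mu E).
Local Notation H1 := (H1 mu E).
Local Notation bact := (@bernoulli_act _ _ act _ Y).

Lemma ler_Re_normc (z : R[i]) : `|complex.Re z| <= normc z.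
Proof.
rewrite -(ler_pXn2r (n := 2))// ?nnegrE ?normc_ge0// real_normK ?num_real// normc2E.
by rewrite lerDl sqr_ge0.
Qed.

Lemma ler_Im_normc (z : R[i]) : `|complex.Im z| <= normc z.
Proof.
rewrite -(ler_pXn2r (n := 2))// ?nnegrE ?normc_ge0// real_normK ?num_real// normc2E.
by rewrite lerDr sqr_ge0.
Qed.

Lemma measurable_normcB (f h : X -> R[i]) :
  cmeasurable_fun setT f -> cmeasurable_fun setT h ->
  measurable_fun setT (fun x => normc (f x - h x)).
Proof. by move=> mf mh; apply: measurable_normc; exact: cmeasurable_funB. Qed.

(** [part] stands for the real or the imaginary part, since the spectral gap is stated for real
    functions. *)
Lemma almost_invariant_part (f : nat -> X -> R[i]) (part : R[i] -> R) :
  (forall n, unimodular (f n)) ->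
  (forall n, measurable_fun setT (fun x => part (f n x))) ->
  (forall z w, part (z - w) = part z - part w) -> (forall z, `|part z| <= normc z) ->
  (forall h, cvg_measure mu (fun n x => normc (f n x - f n (bact h x)))) ->
  \int[mu]_x (part (f n x) - \int[mu]_x part (f n x)) ^+ 2 @[n --> \oo] --> (0 : R).
Proof.
move=> uf mp partB pn finv.
have p1 n x : `|part (f n x)| <= 1 by rewrite (le_trans (pn _))// (uf n).2.
have bp n : bmeas (fun x => part (f n x)) by split => //; exists 1.
have mb h : measurable_fun setT (bact h) by exact: measurable_bact.
have bph n h : bmeas (fun x => part (f n (bact h x))) by exact: (bmeas_comp (mb h) (bp n)).
apply: (almost_invariant_variance mu_prod act_action no_mean (C := 1)) => //.
  by move=> n; rewrite -[leRHS](expr1n _ 2); exact: N2_le.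
move=> h; apply: (cvg_measure_N2 _ _ _ _ (finv h)).
- by move=> n; exact: bmeasB.
- move=> n; apply: measurable_normcB; first by case: (uf n).
  exact: (cmeasurable_comp (mb h) (uf n).1).
- move=> n x; rewrite (le_trans (ler_normB _ _))// -[2]/(1 + 1).
  by apply: lerD; exact: p1.
- by move=> n x; rewrite -partB normc_dist; exact: pn.
Qed.

(** The constants are the integrals of the [f n]. They may have modulus below 1, but only distances
    to them enter later. *)
Lemma almost_invariant_unimodular (f : nat -> X -> R[i]) :
  (forall n, unimodular (f n)) ->
  (forall h, cvg_measure mu (fun n x => normc (f n x - f n (bact h x)))) ->
  exists a : nat -> R[i], cvg_measure mu (fun n x => normc (f n x - a n)).
Proof.
move=> uf finv.
have mRe n : measurable_fun setT (fun x => complex.Re (f n x)) by case: (uf n) => -[].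
have mIm n : measurable_fun setT (fun x => complex.Im (f n x)) by case: (uf n) => -[].
have ReB (z w : R[i]) : complex.Re (z - w) = complex.Re z - complex.Re w.
  by case: z w => ? ? [].
have ImB (z w : R[i]) : complex.Im (z - w) = complex.Im z - complex.Im w.
  by case: z w => ? ? [].
have cRe := almost_invariant_part uf mRe ReB ler_Re_normc finv.
have cIm := almost_invariant_part uf mIm ImB ler_Im_normc finv.
exists (fun n => (\int[mu]_x complex.Re (f n x) +i* \int[mu]_x complex.Im (f n x))%C).
apply: (N2_cvg_measure _ _ _ _ _ cRe cIm).
- move=> n; apply: bmeasB; last exact: bmeas_cst.
  by split => //; exists 1 => x; rewrite (le_trans (ler_Re_normc _))// (uf n).2.
- move=> n; apply: bmeasB; last exact: bmeas_cst.
  by split => //; exists 1 => x; rewrite (le_trans (ler_Im_normc _))// (uf n).2.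
- move=> n; apply: measurable_normcB; first by case: (uf n).
  exact: cmeasurable_cst.
- by move=> n x; exact: normc_ge0.
- by move=> n x; rewrite normc2E ReB ImB.
Qed.

Lemma cvg_measure_wact w (g : nat -> X -> R) : (forall n, measurable_fun setT (g n)) ->
  cvg_measure mu g -> cvg_measure mu (fun n x => g n (wact w x)).
Proof.
move=> mg cg k k0.
have [r [r0 Hr]] := preimage_abs_continuous (measurable_wact act w)
  (measurable_wact act (winv w)) (measurable_wom act w) (wom_gt0 act w)
  (change_var_wact act_action etaE mu_prod w) k0.
have kr : 0 < Num.min k r by rewrite lt_min k0.
have [N HN] := cg _ kr; exists N => n /HN h.
have -> : [set x | k <= g n (wact w x)] = wact w @^-1` [set x | k <= g n x] by [].
apply: Hr; first exact: measurable_ge.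
apply: (@le_lt_trans _ _ (mu [set x | Num.min k r <= g n x])).
  apply: le_measure; rewrite ?inE; [exact: measurable_ge|exact: measurable_ge|].
  by move=> x /= kx; rewrite ge_min kx.
by apply: lt_le_trans h _; rewrite lee_fin ge_min lexx orbT.
Qed.

Section Sequence.
Variables (t : R) (s : nat -> R) (f : nat -> X -> R[i]).
Hypothesis uf : forall n, unimodular (f n).
Hypothesis fs : forall w, cvg_measure mu (fun n x =>
  normc (powRit (wom w x) (s n) * f n x - powRit (wom w x) t * f n (wact w x))).

Lemma approx_coboundary_far (i : I) e : 0 < e ->
  exists N, forall n, (N <= n)%N -> near_t eta t e (s n).
Proof.
move=> e0.
have [a fa] : exists a : nat -> R[i], cvg_measure mu (fun n x => normc (f n x - a n)).
  apply: almost_invariant_unimodular => // h; have := fs [:: inr h].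
  rewrite (_ : (fun n x => _) = fun n x => normc (f n x - f n (bact h x)))//.
  apply/funext => n; apply/funext => x; rewrite /= mulr1.
  by rewrite !powRit1 !mul1r.
have mf n : cmeasurable_fun setT (f n) by case: (uf n).
have mw : measurable_fun setT (wact [:: inl i]) by exact: measurable_wact.
have mfw n : cmeasurable_fun setT (fun x => f n (wact [:: inl i] x)).
  exact: (cmeasurable_comp mw (mf n)).
have mo u : cmeasurable_fun setT (fun x => powRit (wom [:: inl i] x) u).
  by apply: cmeasurable_powRit; exact: measurable_wom.
have fa' := @cvg_measure_wact [:: inl i] _ (fun n => measurable_normcB (mf n) (cmeasurable_cst setT (a n))) fa.
pose g1 n x := normc (powRit (wom [:: inl i] x) (s n) * f n x -
  powRit (wom [:: inl i] x) t * f n (wact [:: inl i] x)).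
pose g2 n x := normc (f n (wact [:: inl i] x) - a n).
pose g3 n x := normc (f n x - a n).
pose g n x := normc (powRit (wom [:: inl i] x) (s n) - powRit (wom [:: inl i] x) t).
have mg1 n : measurable_fun setT (g1 n).
  by apply: measurable_normcB; apply: cmeasurable_funM.
have mg2 n : measurable_fun setT (g2 n).
  by apply: measurable_normcB => //; exact: cmeasurable_cst.
have mg3 n : measurable_fun setT (g3 n).
  by apply: measurable_normcB => //; exact: cmeasurable_cst.
have mg n : measurable_fun setT (g n) by exact: measurable_normcB.
have mg23 n : measurable_fun setT (fun x => g2 n x + g3 n x) by exact: measurable_funD.
have c23 : cvg_measure mu (fun n x => g2 n x + g3 n x).
  exact: (cvg_measureD mg2 mg3 mg23 (fun n x => lexx _) fa' fa).
have cg : cvg_measure mu g.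
  apply: (cvg_measureD mg1 mg23 mg _ (fs [:: inl i]) c23) => n x.
  rewrite /g /g1 /g2 /g3; set p := powRit _ (s n); set q := powRit _ t.
  set fx := f n x; set fy := f n (wact _ x).
  have fx1 : normc fx = 1 by exact: (uf n).2.
  have q1 : normc q = 1 by exact: normc_powRit.
  rewrite -[leLHS]mulr1 -{1}fx1 -Normc.normcM.
  (* Multiplying by the unimodular [fx] exposes the coboundary defect; the rest is at most the
     distances of [fx] and [fy] to the constant [a n]. *)
  rewrite (_ : (p - q) * fx = (p * fx - q * fy) + q * (fy - fx)); last by ring.
  apply: le_trans (ler_normcD _ _) _; rewrite lerD2l Normc.normcM q1 mul1r.
  by apply: le_trans (ler_normc_dist _ (a n) _) _; rewrite lerD2l normc_dist.
have [N HN] := cg _ e0; exists N => n /HN; rewrite /near_t.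
rewrite (_ : [set x | e <= g n x] = [set x : X | far (s n) t e (x i)]).
  by rewrite (mu_coord mu_prod i (measurable_far _ _ _)).
have Ex x : g n x = normc (powRit (x i).1 (s n) - powRit (x i).1 t).
  have wE : wom [:: inl i] x = bitpow (x i) by rewrite /= mul1r.
  by rewrite /g wE; exact: normc_bitpow.
by apply/seteqP; split => x; rewrite /far /mkset Ex.
Qed.

End Sequence.

(** If no open set of classes works, each [On n] contains the class of some parameter that is not
    near [t], together with a function trivializing the difference. This sequence contradicts
    [approx_coboundary_far]. *)
Lemma delta_class_nbhd (i : I) t e : 0 < e -> exists O : set H1,
  [/\ open O, O (delta_class mu E t) & forall s, O (delta_class mu E s) -> near_t eta t e s].
Proof.
move=> e0; apply: contrapT => H.
(* The number of words grows while the radius shrinks, so every fixed word is eventually tested at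
   arbitrarily small radius. *)
pose On n : set H1 := [set h | exists2 c',
  nbhd_words en (dc t) n.+1%:R^-1 n.+1 c' & (\pi_H1 c' = h)%qT].
have ex n : exists p : R * (X -> R[i]), [/\ unimodular p.2, ~ near_t eta t e p.1 &
    forall j, (j <= n)%N ->
    (mu [set x | (n.+1%:R^-1 <= normc (powRit (wom (en j) x) p.1 * p.2 x -
       powRit (wom (en j) x) t * p.2 (wact (en j) x)))%R] < n.+1%:R^-1%:E)%E].
  have r0 : 0 < n.+1%:R^-1 :> R by rewrite invr_gt0.
  apply: contrapT => H'; apply: H; exists (On n); split.
  - exact: (open_class_nbhd act_action I_countable en_surj).
  - exists (dc t) => //; apply/nbhd_wordsP => j _; rewrite /measure_ball /mkset.
    rewrite (_ : _ `&` _ = set0).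
      rewrite (mu_left_graph_wact (act := act) mu (w := [::]))//.
      by rewrite (_ : [set x | _] = set0) ?measure0// lte_fin.
    apply/seteqP; split => // p [_]; rewrite /mkset subrr Normc.normc0.
    by rewrite leNgt r0.
  move=> s [c' Vc' /pi_H1P/asboolP[f [mf f1 fc]]]; apply: contrapT => nns.
  apply: H'; exists (s, f); split => //= j jn.
  move/nbhd_wordsP : Vc' => /(_ j jn); rewrite /measure_ball /mkset.
  have mg : measurable (graph (wact (en j))) by exact: measurable_graph_wact.
  have gE : graph (wact (en j)) `<=` E by exact: graph_wact_sub.
  rewrite (mu_left_graph_wact (act := act) mu (w := en j)); last 2 first.
  - exact: measurable_Z1_dist.
  - by move=> p [].
  apply: le_lt_trans; apply: ae_sub_le_measure.
  - apply: measurable_ge; apply: measurable_normcB.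
      apply: cmeasurable_funM => //; apply: cmeasurable_powRit; exact: measurable_wom.
    apply: (cmeasurable_funM (f := fun x => powRit (wom (en j) x) t)).
      by apply: cmeasurable_powRit; exact: measurable_wom.
    exact: (cmeasurable_comp (measurable_wact act (en j)) mf).
  - apply: measurable_left_pre; first exact: measurable_wact.
    exact: measurable_Z1_dist.
  have dw := delta_mu_wact act_action I_countable etaE mu_prod en_surj.
  apply: filterS2 dw fc => x dx fx h; split => //; rewrite /mkset.
  move: h; rewrite /mkset; have := fx _ (bernoulli_rel_wact act_action (en j) x).
  have dE := delta_cocycleE act_action I_countable etaE mu_prod en_surj.
  rewrite !dE dx.
  set p := powRit _ s; set q := powRit _ t; set fy := f (wact _ x).
  set z := c' _ => zE h; apply: le_trans h _.
  have p1 : normc p = 1 by exact: normc_powRit.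
  have fy1 : normc fy = 1 by exact: f1.
  (* The cohomology reads z / p = f x / fy. Clearing denominators turns the distance from z to q
     into that from p * f x to q * fy. *)
  have -> : p * f x = z * fy.
    have p0 := normc1_neq0 p1; have fy0 := normc1_neq0 fy1.
    by rewrite -(divfK p0 z) zE; field.
  by rewrite -mulrBl Normc.normcM fy1 mulr1.
have [p Hp] := choice ex.
have [||N HN] := @approx_coboundary_far t (fun n => (p n).1) (fun n => (p n).2) _ _ i e e0.
- by move=> n; case: (Hp n).
- move=> w k k0; have [j <-] := en_surj w.
  have [N0 _ HN0] : \forall n \near \oo, n.+1%:R^-1 <= k.
    have /cvgrPdist_le/(_ _ k0) := @cvg_harmonic R; apply: filterS => n /=.
    by rewrite sub0r normrN ger0_norm// invr_ge0.
  exists (maxn j N0) => n; rewrite geq_max => /andP[jn Nn].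
  case: (Hp n) => -[mf f1] _ /(_ j jn) h; have nk := HN0 n Nn.
  apply: (@lt_le_trans _ _ n.+1%:R^-1%:E); last by rewrite lee_fin.
  apply: le_lt_trans h; apply: le_measure; rewrite ?inE.
  + apply: measurable_ge; apply: measurable_normcB.
      apply: cmeasurable_funM => //; apply: cmeasurable_powRit; exact: measurable_wom.
    apply: (cmeasurable_funM (f := fun x => powRit (wom (en j) x) t)).
      by apply: cmeasurable_powRit; exact: measurable_wom.
    exact: (cmeasurable_comp (measurable_wact act (en j)) mf).
  + apply: measurable_ge; apply: measurable_normcB.
      apply: cmeasurable_funM => //; apply: cmeasurable_powRit; exact: measurable_wom.
    apply: (cmeasurable_funM (f := fun x => powRit (wom (en j) x) t)).
      by apply: cmeasurable_powRit; exact: measurable_wom.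
    exact: (cmeasurable_comp (measurable_wact act (en j)) mf).
  + by move=> x /=; exact: le_trans.
by case: (Hp N) => _ + _; apply; exact: HN.
Qed.

End SpectralNbhd.

(** * The strong topology of the multiplication representation *)

Section UnitarySide.
Context (R : realType) (xi : {finite_measure set (posR R) -> \bar R}).
Local Notation Y := (posR R * bool)%type.
Local Notation normc := (@Normc.normc R).
Context (eta : probability Y R).
Hypothesis xi_first_moment : (\int[xi]_x (x : R)%:E < +oo)%E.
Hypothesis etaE : forall f : Y -> \bar R,
  measurable_fun setT f -> (forall y, 0 <= f y)%E ->
  (\int[eta]_y f y = \int[xi]_x f (x, false) +
                        \int[xi]_x ((x : R)%:E * f (x, true)))%E.
Local Notation L2 := (L2 xi).
Local Notation rho := (rho xi).

Definition farR (s t e : R) : set (posR R) :=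
  [set x : posR R | e <= normc (powRit x s - powRit x t)].

Lemma cmeasurable_powR_dist s t :
  cmeasurable_fun setT (fun x : posR R => powRit x s - powRit x t).
Proof.
by apply: cmeasurable_funB; apply: cmeasurable_powRit; exact: measurable_posR_val.
Qed.

Lemma measurable_farR s t e : measurable (farR s t e).
Proof.
rewrite -[farR _ _ _]setTI; apply: measurable_normc_ge => //.
exact: cmeasurable_powR_dist.
Qed.

(** [far] ignores the bit, so the two bits contribute the densities 1 and x. *)
Lemma eta_far s t e : eta (far s t e) = (\int[xi]_(x in farR s t e) (1 + (x : R))%:E)%E.
Proof.
have mf := measurable_far s t e; have mR := measurable_farR s t e.
have mv : measurable_fun setT (fun x : posR R => (x : R)%:E).
  by apply/measurable_EFinP; exact: measurable_posR_val.
transitivity (\int[eta]_y (\1_(far s t e) y)%:E)%E; first by rewrite integral_indic ?setIT.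
rewrite (etaE (f := fun y => (\1_(far s t e) y)%:E)); last 2 first.
- by apply/measurable_EFinP; exact: measurable_indic.
- by move=> y; rewrite lee_fin.
have ind b x : (\1_(far s t e) (x, b) : R) = \1_(farR s t e) x.
  rewrite !indicE; suff -> : ((x, b) \in far s t e) = (x \in farR s t e) by [].
  by apply/idP/idP; rewrite !inE.
under eq_integral do rewrite ind.
under [X in (_ + X)%E]eq_integral do rewrite ind muleC.
rewrite integral_indicM integral_indic// setIT.
under [RHS]eq_integral do rewrite EFinD.
rewrite ge0_integralD//.
- by rewrite integral_cst// mul1e.
- by move=> x _; rewrite lee_fin ltW// posR_val_gt0.
- exact: measurable_funTS.
Qed.

Lemma xi_farR_le s t e : (xi (farR s t e) <= eta (far s t e))%E.
Proof.
have mR := measurable_farR s t e; rewrite eta_far -[leLHS]mul1e -integral_cst//.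
apply: ge0_le_integral => //.
- apply: measurable_funTS; apply/measurable_EFinP; apply: measurable_funD => //.
  exact: measurable_posR_val.
- by move=> x _; rewrite lee_fin lerDl ltW// posR_val_gt0.
Qed.

Lemma normL2_ge0 (u : L2) : 0 <= normL2 u.
Proof. exact: sqrtr_ge0. Qed.

Lemma reprL2N (u : L2) : {ae xi, forall x, repr (- u) x = - repr u x}.
Proof.
rewrite -[- u]scaleN1r; have := reprL2M (bounded_cmeasurable_cst (posR R) (-1 : R[i])) u.
by apply: filterS => x; rewrite mulN1r.
Qed.

Lemma normL2_sqr (u : L2) : normL2 u ^+ 2 = \int[xi]_x (normc (repr u x) ^+ 2).
Proof.
rewrite /normL2 sqr_sqrtr /=; last first.
  apply: Rintegral_ge0 => x _; case: (repr u x) => a b /=.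
  by rewrite mulrN opprK -!expr2 addr_ge0 ?sqr_ge0.
apply: eq_Rintegral => x _; rewrite normc2E; case: (repr u x) => a b /=.
by rewrite mulrN opprK -!expr2.
Qed.

Lemma measurable_normcX (f : posR R -> R[i]) : cmeasurable_fun setT f ->
  measurable_fun setT (fun x => normc (f x) ^+ 2).
Proof. by move=> mf; apply: measurable_funX; exact: measurable_normc. Qed.

Lemma eq_ae_Rintegral_normc (f g : posR R -> R[i]) :
  cmeasurable_fun setT f -> cmeasurable_fun setT g ->
  {ae xi, forall x, f x = g x} ->
  \int[xi]_x (normc (f x) ^+ 2) = \int[xi]_x (normc (g x) ^+ 2).
Proof.
move=> mf mg fg; congr fine; apply: ae_eq_integral => //.
- by apply/measurable_EFinP; exact: measurable_normcX.
- by apply/measurable_EFinP; exact: measurable_normcX.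
- by apply: filterS fg => x /= ->.
Qed.

Lemma normL2_rho_sqr (u w : L2) s : normL2 (rho s u - w) ^+ 2 =
  \int[xi]_x (normc (powRit x s * repr u x - repr w x) ^+ 2).
Proof.
rewrite normL2_sqr; apply: eq_ae_Rintegral_normc.
- exact: measurable_reprL2.
- apply: cmeasurable_funB; last exact: measurable_reprL2.
  apply: (cmeasurable_funM (f := fun x : posR R => powRit x s)).
    by apply: cmeasurable_powRit; exact: measurable_posR_val.
  exact: measurable_reprL2.
- have h1 := reprL2D (rho s u) (- w); have h2 := reprL2N w.
  have h3 := reprL2M (powRit_bounded s) u.
  by apply: filterS3 h1 h2 h3 => x -> -> ->.
Qed.

Lemma integrable_normcX (f : posR R -> R[i]) : f \in square_integrable xi ->
  xi.-integrable setT (EFin \o (fun x => normc (f x) ^+ 2)).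
Proof.
move=> /square_integrableP[mf foo]; apply/integrableP; split.
  by apply/measurable_EFinP; exact: measurable_normcX.
by under eq_integral do rewrite /= ger0_norm ?sqr_ge0//.
Qed.

Lemma integrable_lin (a b : R) (f g : posR R -> R) :
  xi.-integrable setT (EFin \o f) -> xi.-integrable setT (EFin \o g) ->
  xi.-integrable setT (EFin \o (fun x => a * f x + b * g x)).
Proof.
move=> jf jg; rewrite (_ : _ \o _ =
    (fun x => a%:E * (EFin \o f) x) \+ (fun x => b%:E * (EFin \o g) x))%E.
  by apply: integrableD => //; exact: integrableZl.
by apply/funext => x /=; rewrite EFinD !EFinM.
Qed.

Lemma integrable_scal (a : R) (f : posR R -> R) :
  xi.-integrable setT (EFin \o f) -> xi.-integrable setT (EFin \o (fun x => a * f x)).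
Proof.
move=> jf; rewrite (_ : _ \o _ = (fun x => a%:E * (EFin \o f) x))%E.
  exact: integrableZl.
by apply/funext => x /=; rewrite EFinM.
Qed.

Lemma le_integrable_normcX (f : posR R -> R[i]) (g : posR R -> R) :
  cmeasurable_fun setT f -> xi.-integrable setT (EFin \o g) ->
  (forall x, normc (f x) ^+ 2 <= g x) ->
  xi.-integrable setT (EFin \o (fun x => normc (f x) ^+ 2)).
Proof.
move=> mf ig fg; apply: le_integrable ig => //.
  by apply/measurable_EFinP; exact: measurable_normcX.
move=> x _ /=; rewrite lee_fin ger0_norm ?sqr_ge0//.
by rewrite (le_trans (fg x))// ler_norm.
Qed.

(** Changing [t] to [s] adds (x^{is} - x^{it}) u to the vector. Its norm is small: off [farR] the
    factor is small, and on [farR], of small measure, it is at most 2 and the integral of |u|^2 is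
    small. *)
Lemma near_open_strong_ball (U : unitary xi) (u : L2) e : 0 < e ->
  near_open (near_t eta) (rho @^-1` strong_ball U u e).
Proof.
move=> e0 t; rewrite /preimage /strong_ball /mkset => ht.
set w := U u; pose v x := repr u x; pose z x := repr w x.
have mv : cmeasurable_fun setT v by exact: measurable_reprL2.
have mz : cmeasurable_fun setT z by exact: measurable_reprL2.
pose pw s (x : posR R) := powRit x s.
have mpw s : cmeasurable_fun setT (pw s).
  by apply: cmeasurable_powRit; exact: measurable_posR_val.
pose F s x := pw s x * v x - z x.
pose h s x := (pw s x - pw t x) * v x.
pose G x := normc (v x) ^+ 2.
have mF s : cmeasurable_fun setT (F s).
  by apply: cmeasurable_funB => //; exact: (cmeasurable_funM (mpw s) mv).
have mh s : cmeasurable_fun setT (h s).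
  exact: (cmeasurable_funM (cmeasurable_funB (mpw s) (mpw t)) mv).
have iG : xi.-integrable setT (EFin \o G) by exact/integrable_normcX/L2funP.
have iz : xi.-integrable setT (EFin \o (fun x => normc (z x) ^+ 2)).
  exact/integrable_normcX/L2funP.
have pw1 s x : normc (pw s x) = 1 by exact: normc_powRit.
have iF s : xi.-integrable setT (EFin \o (fun x => normc (F s x) ^+ 2)).
  apply: (le_integrable_normcX (g := fun x => 2 * G x + 2 * normc (z x) ^+ 2)) => //.
    exact: integrable_lin.
  move=> x; rewrite /F /G; have := ler_normcD (pw s x * v x) (- z x).
  rewrite normc_opp Normc.normcM pw1 mul1r.
  have := normc_ge0 (pw s x * v x - z x); have := normc_ge0 (v x).
  have := normc_ge0 (z x); set a := normc (v x); set b := normc (z x).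
  set c := normc _ => a0 b0 c0 cab; have := sqr_ge0 (a - b).
  have : c ^+ 2 <= (a + b) ^+ 2 by rewrite lerXn2r// nnegrE addr_ge0.
  by nra.
have hG s x : normc (h s x) ^+ 2 = normc (pw s x - pw t x) ^+ 2 * G x.
  by rewrite /h /G Normc.normcM exprMn.
have pw2 s x : normc (pw s x - pw t x) <= 2.
  by apply: le_trans (ler_normcD _ _) _; rewrite normc_opp !pw1.
have G0 x : 0 <= G x by exact: sqr_ge0.
have pwX s x : normc (pw s x - pw t x) ^+ 2 <= 4.
  by have := pw2 s x; have := normc_ge0 (pw s x - pw t x); nra.
have ih s : xi.-integrable setT (EFin \o (fun x => normc (h s x) ^+ 2)).
  apply: (le_integrable_normcX (g := fun x => 4 * G x)) => //.
    exact: integrable_scal.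
  by move=> x; rewrite hG ler_wpM2r.
have small c : 0 < c -> exists e', 0 < e' /\ forall s, near_t eta t e' s ->
    \int[xi]_x (normc (h s x) ^+ 2) < c.
  move=> c0; have c8 : 0 < c / 8 by rewrite divr_gt0.
  have [r [r0 Hr]] := integral_normr_continuous iG c8.
  pose A := \int[xi]_x G x; have A0 : 0 <= A by apply: Rintegral_ge0.
  (* Off [farR] the integral is at most e'^2 A, hence at most c / 4; on [farR] it is below 4 * (c /
     8). *)
  pose e' := Num.min r (Num.min 1 (c / (4 * (A + 1)))).
  have c4 : 0 < c / (4 * (A + 1)).
    by rewrite divr_gt0// mulr_gt0// ltr_wpDl.
  have e'0 : 0 < e' by rewrite !lt_min r0 ltr01.
  exists e'; split => // s ns.
  have mD := measurable_farR s t e'.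
  have xiD : (xi (farR s t e') < r%:E)%E.
    apply: le_lt_trans (xi_farR_le s t e') _; apply: lt_le_trans ns _.
    by rewrite lee_fin ge_min lexx.
  have iD : xi.-integrable setT (EFin \o (fun x => G x * \1_(farR s t e') x)).
    apply: le_integrable iG => //.
      apply/measurable_EFinP; apply: measurable_funM; first exact: measurable_normcX.
      exact: measurable_indic.
    move=> x _ /=; rewrite lee_fin normrM ler_piMr// indicE.
    by case: (_ \in _); rewrite ?normr1 ?normr0.
  have IG : \int[xi]_x (G x * \1_(farR s t e') x) < c / 8.
    apply: le_lt_trans (Hr _ mD xiD); rewrite le_eqVlt; apply/orP; left; apply/eqP.
    rewrite [RHS]Rintegral_mkcond; apply: eq_Rintegral => x _.
    rewrite patchE indicE; case: ifPn => _; rewrite ?mulr1 ?mulr0//.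
    by rewrite ger0_norm.
  apply: (@le_lt_trans _ _ (\int[xi]_x (e' ^+ 2 * G x + 4 * (G x * \1_(farR s t e') x)))).
    apply: le_Rintegral => //.
      exact: integrable_lin.
    move=> x _; rewrite hG indicE; have [xD|xD] := boolP (x \in farR s t e').
      rewrite mulr1; apply: (@le_trans _ _ (4 * G x)); first by rewrite ler_wpM2r.
      by rewrite lerDr mulr_ge0// sqr_ge0.
    rewrite !mulr0 addr0 ler_wpM2r// lerXn2r// ?nnegrE ?normc_ge0 ?ltW//.
    by rewrite ltNge; apply/negP => hx; move/negP: xD; apply; rewrite inE.
  rewrite RintegralD//; [|exact: integrable_scal|exact: integrable_scal].
  rewrite !RintegralZl// -/A.
  have e1 : e' <= 1 by rewrite !ge_min lexx orbT.
  have e2 : e' <= c / (4 * (A + 1)) by rewrite !ge_min lexx !orbT.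
  have A1 : 0 < 4 * (A + 1) by rewrite mulr_gt0// ltr_wpDl.
  have e3 : e' * (4 * (A + 1)) <= c by rewrite -ler_pdivlMr.
  have e4 : e' ^+ 2 <= e' by rewrite expr2 ler_piMr// ltW.
  have e5 : e' ^+ 2 * A <= e' * A by rewrite ler_wpM2r.
  by lra.
have ht2 : \int[xi]_x (normc (F t x) ^+ 2) < e ^+ 2.
  by rewrite -normL2_rho_sqr ltr_pXn2r// nnegrE ?normL2_ge0// ltW.
set A := \int[xi]_x _ in ht2; have A0 : 0 <= A.
  by apply: Rintegral_ge0 => x _; exact: sqr_ge0.
pose g := e ^+ 2 - A; have g0 : 0 < g by rewrite subr_gt0.
(* In |a + b|^2 <= (1 + l) |a|^2 + (1 + l^-1) |b|^2, the slack [g] is shared: l * A takes at most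
   half of it, and [c] is chosen so that the term in [h] takes less than the other half. *)
pose l := g / (2 * (A + 1)).
have A1 : 0 < 2 * (A + 1) by rewrite mulr_gt0// ltr_wpDl.
have l0 : 0 < l by rewrite divr_gt0.
have lV : 0 < 1 + l^-1 by rewrite addr_gt0// invr_gt0.
pose c := g / (2 * (1 + l^-1)).
have c0 : 0 < c by rewrite divr_gt0// mulr_gt0.
have [e' [e'0 He']] := small c c0.
exists e'; split; first exact: e'0.
move=> s ns; rewrite -(@ltr_pXn2r _ 2)// ?nnegrE ?normL2_ge0 ?ltW//.
rewrite normL2_rho_sqr -/(F s).
have hs := He' s ns.
apply: (@le_lt_trans _ _ (\int[xi]_x ((1 + l) * normc (F t x) ^+ 2 +
    (1 + l^-1) * normc (h s x) ^+ 2))).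
  apply: le_Rintegral => //; first exact: iF.
    exact: integrable_lin (iF t) (ih s).
  move=> x _; have FE : pw s x * v x - z x = F t x + h s x by rewrite /F /h; ring.
  rewrite -/(pw s x) -/(v x) -/(z x) FE.
  have := ler_normcD (F t x) (h s x); have := normc_ge0 (F t x + h s x).
  have := normc_ge0 (F t x); have := normc_ge0 (h s x).
  set a := normc (F t x); set b := normc (h s x); set q := normc _ => b0 a0 q0 qab.
  apply: (@le_trans _ _ ((a + b) ^+ 2)); first by rewrite lerXn2r// nnegrE addr_ge0.
  rewrite -subr_ge0 (_ : _ - _ = l^-1 * (l * a - b) ^+ 2).
    by rewrite mulr_ge0 ?sqr_ge0// invr_ge0 ltW.
  by field; rewrite gt_eqF.
rewrite RintegralD//; last 2 first.
- by exact: integrable_scal (iF t).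
- by exact: integrable_scal (ih s).
rewrite !RintegralZl//.
rewrite -/A.
have h2 : (1 + l^-1) * (\int[xi]_x (normc (h s x) ^+ 2)) < g / 2.
  apply: (@lt_le_trans _ _ ((1 + l^-1) * c)); first by rewrite ltr_pM2l.
  rewrite /c le_eqVlt; apply/orP; left; apply/eqP.
  by move: (1 + l^-1) lV => m m0; field; rewrite gt_eqF.
have h3 : l * A <= g / 2.
  have lA : l * (2 * (A + 1)) = g by rewrite /l divfK// gt_eqF.
  by lra.
have ge : g = e ^+ 2 - A by [].
by lra.
Qed.

Lemma one_square_integrable : (fun _ : posR R => 1 : R[i]) \in square_integrable xi.
Proof.
apply/square_integrableP; split; first exact: cmeasurable_cst.
rewrite Normc.normc1 expr1n integral_cst// mul1e.
by rewrite ltey_eq fin_num_measure.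
Qed.

(** The constant vector 1 suffices: by Chebyshev a small norm of its displacement makes [xi] of the
    far set small, and integrability of 1 + x then makes its [eta]-measure small. *)
Lemma strong_ball_near t e : 0 < e -> exists O : set (unitary xi),
  [/\ open O, O (rho t) & forall s, O (rho s) -> near_t eta t e s].
Proof.
move=> e0.
have i1 : xi.-integrable setT (EFin \o (fun x : posR R => 1 + (x : R))).
  apply/integrableP; split.
    apply/measurable_EFinP; apply: measurable_funD => //; exact: measurable_posR_val.
  under eq_integral do rewrite /= ger0_norm ?addr_ge0 ?(ltW (posR_val_gt0 _))// EFinD.
  rewrite ge0_integralD//.
  - by rewrite integral_cst// mul1e lte_add_pinfty// ltey_eq fin_num_measure.
  - by move=> x _; rewrite lee_fin ltW// posR_val_gt0.
  - by apply/measurable_EFinP; exact: measurable_posR_val.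
have [r [r0 Hr]] := integral_normr_continuous i1 e0.
pose one : L2 := (\pi_L2 (MkL2fun one_square_integrable))%qT.
have er : 0 < Num.sqrt (e ^+ 2 * r) by rewrite sqrtr_gt0 mulr_gt0// exprn_gt0.
exists (strong_ball (rho t) one (Num.sqrt (e ^+ 2 * r))); split.
- exists [set strong_ball (rho t) one (Num.sqrt (e ^+ 2 * r))]; last by rewrite bigcup_set1.
  move=> _ ->; apply: (@finI_from1 _ _ _ id).
  by exists (rho t), one, (Num.sqrt (e ^+ 2 * r)).
- rewrite /strong_ball /mkset subrr (_ : normL2 0 = 0)//.
  apply/eqP; rewrite -sqrf_eq0 -(subrr (rho t one)) normL2_rho_sqr.
  rewrite (eq_ae_Rintegral_normc (g := fun=> 0)).
  + under eq_Rintegral do rewrite Normc.normc0 expr0n/=.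
    by rewrite Rintegral_cst// mul0r.
  + apply: cmeasurable_funB; last exact: measurable_reprL2.
    apply: (cmeasurable_funM (f := fun x : posR R => powRit x t)).
      by apply: cmeasurable_powRit; exact: measurable_posR_val.
    exact: measurable_reprL2.
  + exact: cmeasurable_cst.
  + have := reprL2M (powRit_bounded t) one.
    by apply: filterS => x ->; rewrite subrr.
move=> s; rewrite /strong_ball /mkset => hs; rewrite /near_t.
have mD := measurable_farR s t e.
have hs2 : \int[xi]_x (normc (powRit x s - powRit x t) ^+ 2) < e ^+ 2 * r.
  have : normL2 (rho s one - rho t one) ^+ 2 < e ^+ 2 * r.
    rewrite -[ltRHS]sqr_sqrtr; last by rewrite mulr_ge0 ?sqr_ge0// ltW.
    by rewrite ltr_pXn2r// nnegrE ?normL2_ge0// ltW.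
  rewrite normL2_rho_sqr; apply: le_lt_trans; rewrite le_eqVlt; apply/orP; left; apply/eqP.
  apply: eq_ae_Rintegral_normc.
  - exact: cmeasurable_powR_dist.
  - apply: cmeasurable_funB; last exact: measurable_reprL2.
    apply: (cmeasurable_funM (f := fun x : posR R => powRit x s)).
      by apply: cmeasurable_powRit; exact: measurable_posR_val.
    exact: measurable_reprL2.
  - have h1 := reprL2M (powRit_bounded t) one.
    have h2 : {ae xi, forall x, repr one x = 1} by exact: reprL2K.
    by apply: filterS2 h1 h2 => x -> ->; rewrite !mulr1.
have bd : bmeas (fun x : posR R => normc (powRit x s - powRit x t) ^+ 2).
  split; first by apply: measurable_normcX; exact: cmeasurable_powR_dist.
  exists (2 ^+ 2) => x; rewrite ger0_norm ?sqr_ge0// lerXn2r// ?nnegrE ?normc_ge0//.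
  by apply: le_trans (ler_normcD _ _) _; rewrite normc_opp !normc_powRit.
have xiD : (xi (farR s t e) < r%:E)%E.
  rewrite -[X in (X < _)%E]fineK ?fin_num_measure// lte_fin.
  rewrite -(ltr_pM2l (exprn_gt0 2 e0)); apply: le_lt_trans hs2.
  rewrite -bintegral_indic// -bintegralZ; last exact: bmeas_indic.
  apply: le_bintegral => //.
    by apply: bmeasM; [exact: bmeas_cst|exact: bmeas_indic].
  move=> x; rewrite indicE; have [/set_mem xD|_] := boolP (x \in farR s t e).
    by rewrite mulr1 lerXn2r// nnegrE ?normc_ge0// ltW.
  by rewrite mulr0 sqr_ge0.
have := Hr _ mD xiD; rewrite eta_far -lte_fin; apply: le_lt_trans.
rewrite /Rintegral fineK.
  rewrite le_eqVlt; apply/orP; left; apply/eqP; apply: eq_integral => x _.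
  by rewrite ger0_norm// addr_ge0// ltW// posR_val_gt0.
apply: integrable_fin_num => //; apply: integrable_norm.
exact: integrableS i1.
Qed.

End UnitarySide.

(** * Strong ergodicity *)

Section StrongErgodicity.
Context (R : realType) (Lam : groupType) (I : choiceType) (act : Lam -> I -> I).
Hypothesis act_action : is_action act.
Local Notation Y := (posR R * bool)%type.
Local Notation X := (bernoulli_space I Y).
Local Notation E := (bernoulli_rel act (@same_fst (posR R) bool)).
Context (eta : probability Y R) (mu : probability X R).
Hypothesis mu_prod : is_product_measure eta mu.
Local Notation bact g := (@bernoulli_act _ _ act _ Y g).

Lemma image_bact g (A : set X) : bact g^-1%g @` A = bact g @^-1` A.
Proof.
apply/seteqP; split => [_ [x Ax <-]|x Ax]; first by rewrite /preimage /= bactVK.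
by exists (bact g x); rewrite ?bactK.
Qed.

Lemma bact_full_group g : full_group mu E (bact g).
Proof.
split.
- by exists (bact g^-1%g); [exact: bactK|exact: bactVK].
- exact: measurable_bact.
- move=> A mA; rewrite -{1}[g]invgK image_bact -[X in measurable X]setTI.
  exact: measurable_bact.
- by move=> A mA; rewrite (mu_bact mu_prod act_action).
- by apply: aeW => x; exact: (bernoulli_rel_wact act_action [:: inr g] x).
Qed.

Lemma N2_indicB (A B : set X) : measurable A -> measurable B ->
  \int[mu]_x (\1_B x - \1_A x) ^+ 2 = fine (mu (A `+` B)) :> R.
Proof.
move=> mA mB; rewrite -bintegral_indic; last first.
  by apply: measurableU; exact: measurableD.
apply: eq_Rintegral => x _; rewrite !indicE in_setU !in_setD.
by case: (x \in A); case: (x \in B); rewrite /= ?(subrr, subr0, sub0r, sqrrN, expr1n, expr0n).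
Qed.

(** This identifies the quantity in the definition of strong ergodicity with the variance controlled
    by the spectral gap. *)
Lemma variance_indic (A : set X) : measurable A ->
  \int[mu]_x (\1_A x - \int[mu]_x' \1_A x') ^+ 2 =
  fine (mu A) * (1 - fine (mu A)) :> R.
Proof.
move=> mA; rewrite bintegral_indic//; set a := fine _.
transitivity (\int[mu]_x ((1 - 2 * a) * \1_A x + a ^+ 2)).
  apply: eq_Rintegral => x _; rewrite indicE.
  by case: (x \in A) => /=; rewrite ?mulr1n ?mulr0n; ring.
have bA : bmeas (\1_A : X -> R) by exact: bmeas_indic.
rewrite bintegralD; last 2 first.
- by apply: bmeasM => //; exact: bmeas_cst.
- exact: bmeas_cst.
by rewrite bintegralZ// bintegral_indic// bintegral_cst -/a; ring.
Qed.

Lemma bernoulli_strongly_ergodic :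
  ~ (exists m : set I -> R, invariant_mean act m) -> strongly_ergodic mu E.
Proof.
move=> no_mean A mA Ainv.
have H : (\int[mu]_x (\1_(A n) x - \int[mu]_x' \1_(A n) x') ^+ 2) @[n --> \oo] --> (0 : R).
  apply: (almost_invariant_variance mu_prod act_action no_mean (C := 1)).
  - by move=> n; exact: bmeas_indic.
  - move=> n; rewrite (_ : (fun x => _) = \1_(A n)).
      rewrite bintegral_indic// -lee_fin fineK ?fin_num_measure//.
      exact: probability_le1.
    apply/funext => x; rewrite indicE.
    by case: (x \in A n); rewrite /= ?expr1n ?expr0n.
  move=> g; have mg n : measurable (bact g @^-1` A n).
    by rewrite -[X in measurable X]setTI; exact: measurable_bact.
  (* The inverse appears because images under it are preimages under the translation by [g]. *)
  have /fine_cvg := Ainv _ (bact_full_group g^-1%g).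
  apply: cvg_trans; rewrite (_ : (fun n => _) =
    (fun n => fine (mu (A n `+` bact g^-1%g @` A n))))//.
  by apply/funext => n; rewrite image_bact -N2_indicB.
rewrite (_ : (fun n => _) = EFin \o (fun n =>
    \int[mu]_x (\1_(A n) x - \int[mu]_x' \1_(A n) x') ^+ 2)).
  by apply: cvg_EFin; [exact: nearW|exact: H].
apply/funext => n /=; rewrite variance_indic// EFinM EFinB fineK//.
exact: fin_num_measure.
Qed.

End StrongErgodicity.

Local Open Scope ereal_scope.

Theorem theorem6p4 (R : realType)
    (Lam : groupType) (I : choiceType) (act : Lam -> I -> I)
    (Lam_countable : countable [set: Lam])
    (I_countable : countable [set: I]) (I_nonempty : [set: I] !=set0)
    (act_action : is_action act)
    (no_invariant_mean : ~ exists m : set I -> R, invariant_mean act m)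
    (xi : {finite_measure set (posR R) -> \bar R})
    (xi_neq0 : xi setT <> 0)
    (xi_first_moment : \int[xi]_x (x : R)%:E < +oo)
    (xi_normalized : \int[xi]_x (1 + (x : R))%:E = 1)
    (eta : probability (posR R * bool)%type R)
    (etaE : forall f : posR R * bool -> \bar R,
      measurable_fun setT f -> (forall y, 0 <= f y) ->
      \int[eta]_y f y = \int[xi]_x f (x, false) +
                        \int[xi]_x ((x : R)%:E * f (x, true)))
    (mu : probability (bernoulli_space I (posR R * bool)%type) R)
    (mu_product : is_product_measure eta mu) :
  let E := bernoulli_rel act (@same_fst (posR R) bool) in
  strongly_ergodic mu E /\ tau_rel mu E = tau_measure xi.
Proof.
move=> E; split; first exact: (bernoulli_strongly_ergodic act_action mu_product).
have [en en_surj] := word_enum Lam_countable I_countable.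
have [i _] := I_nonempty.
transitivity (near_open (near_t eta)).
  apply: (initial_open_near (f := delta_class mu E)).
    move=> V oV.
    (* An open set of classes is one whose preimage in [Z1] is open, so the map is lifted to
       cocycles, where a subbase is available. *)
    apply: (near_open_subbase (@near_t_mono R eta) (f := delta_cocycle mu E)
      (D := [set A | exists c W e r, [/\ measurable W, W `<=` E,
        mu_left mu W < +oo, (0 < e)%R & (0 < r)%R] /\ A = measure_ball c W e r]) _
      (O := (\pi_(H1 mu E))%qT @^-1` V)); last exact: oV.
    move=> _ [c [W [e [r [[mW WE Woo e0 r0] ->]]]]].
    exact: (near_open_delta_ball act_action I_countable etaE mu_product en_surj).
  move=> t e e0.
  exact: (delta_class_nbhd act_action I_countable no_invariant_mean etaE mu_product
    en_surj i).
symmetry; apply: (initial_open_near (f := rho xi)).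
  move=> V oV.
  apply: (near_open_subbase (@near_t_mono R eta) (f := rho xi)
    (D := [set A | exists U u e, (0 < e)%R /\ A = strong_ball U u e]) _ (O := V)).
    by move=> _ [U [u [e [e0 ->]]]]; exact: near_open_strong_ball.
  exact: oV.
by move=> t e e0; exact: strong_ball_near.
Qed.
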